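(* Let $\gamma \ge 1/2$ and let $N\ge 1$ be an integer. If $N$ is even, then $$L_{\gamma,N} = L_\gamma ,$$ and, if $N$ is odd, then $$L_{\gamma,N} \le \frac{N+1}{N}\, L_\gamma .$$ Here $L_{\gamma,N}$ is the optimal constant in the Lieb--Thirring inequality on the star graph $\Gamma_N$ and $L_\gamma$ is the optimal constant in the Lieb--Thirring inequality on $\mathbb{R}$, as defined in the context.
   Context: For an integer $N\ge 1$, the star graph $\Gamma_N$ consists of $N$ half-lines (edges) $[0,\infty)$ with their endpoints $0$ identified (the vertex), equipped with Lebesgue measure $dx$ on each edge. A function $\psi$ on $\Gamma_N$ is given by its restrictions $\psi_1,\dots,\psi_N$ to the edges, and $\int_{\Gamma_N} f\,dx=\sum_{j=1}^N\int_0^\infty f_j\,dt$. The Sobolev space $H^1(\Gamma_N)$ consists of the functions $\psi$ on $\Gamma_N$ with $\psi_j\in H^1(0,\infty)$ for all $j$ and $\psi_1(0)=\dots=\psi_N(0)$. The graph $\Gamma_2$ is identified with $\mathbb{R}$. For a real-valued function $V$, write $V_\pm=\max(\pm V,0)$. A potential $V:\Gamma_N\to\mathbb{R}$ is called admissible if $V_-\in L_p(\Gamma_N)$ for some $1\le p<\infty$ and $V_+\in L_1^{\mathrm{loc}}(\Gamma_N)$ (integrable on compact subsets of $\Gamma_N$, including neighbourhoods of the vertex). For admissible $V$, the Schrödinger operator $H=-\frac{d^2}{dx^2}+V$ in $L_2(\Gamma_N)$ is the self-adjoint operator associated with the closed, lower semi-bounded quadratic form $$h[\psi]=\int_{\Gamma_N}\left(|\psi'|^2+V|\psi|^2\right)dx,\qquad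 \psi\in H^1(\Gamma_N)\cap L_2(\Gamma_N,V_+\,dx)$$ (this corresponds to Kirchhoff conditions $\sum_{j=1}^N\psi_j'(0+)=0$ at the vertex). Its negative spectrum consists of discrete eigenvalues of finite multiplicity, and $\operatorname{Tr} H_-^\gamma$ denotes the sum of the $\gamma$-th powers of the absolute values of the negative eigenvalues of $H$, counted with multiplicity. For $\gamma\ge 1/2$, $L_{\gamma,N}$ denotes the optimal (smallest possible) constant such that $$\operatorname{Tr} H_-^\gamma\le L_{\gamma,N}\int_{\Gamma_N}V_-^{\gamma+1/2}\,dx$$ for all admissible $V$ on $\Gamma_N$ (it is known that such a finite constant exists). Set $L_\gamma:=L_{\gamma,2}$; that is, $L_\gamma$ is the smallest constant such that $\operatorname{Tr}\left(-\frac{d^2}{dx^2}+V\right)_-^\gamma\le L_\gamma\int_{\mathbb{R}}V_-^{\gamma+1/2}\,dx$ for all admissible $V$ on $\mathbb{R}$, with the operator acting in $L_2(\mathbb{R})$. *)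

(* Defs.v *)
From HB Require Import structures.
From mathcomp Require Import all_boot all_order all_algebra.
From mathcomp Require Import all_classical all_reals all_analysis.
From mathcomp Require Export complex.

Set Implicit Arguments.
Unset Strict Implicit.
Unset Printing Implicit Defensive.

Import Order.TTheory GRing.Theory Num.Theory.
Import numFieldNormedType.Exports.

Local Open Scope classical_set_scope.
Local Open Scope ring_scope.
Local Open Scope complex_scope.

Section StarGraph.
Context {R : realType}.
Local Notation mu := (@lebesgue_measure R).

(* The closed half-line, i.e. one edge; the vertex is the point 0. *)
Definition edge : set R := [set` `[0, +oo[ ].

(* A function on the star graph with N edges, given by its restrictions to the
   edges.  Only the values on [edge] matter: the values of each restriction at
   negative arguments are junk and are never used. *)
Definition graph_fun (N : nat) (T : Type) : Type := 'I_N -> R -> T.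

(* Integral over the graph of a nonnegative extended real function. *)
Definition graph_integral N (f : graph_fun N (\bar R)) : \bar R :=
  (\sum_(j < N) \int[mu]_(t in edge) f j t)%E.

(* The library has no integral of complex-valued functions: it is taken
   componentwise (and only used below for integrable functions). *)
Definition Cintegral (f : R -> R[i]) : R[i] :=
  (\int[mu]_(t in edge) complex.Re (f t))
    +i* (\int[mu]_(t in edge) complex.Im (f t)).

Definition graph_Cintegral N (f : graph_fun N R[i]) : R[i] :=
  \sum_(j < N) Cintegral (f j).

(* f belongs to L_2(0, oo) with the weight w >= 0. *)
Definition weighted_L2 (w : R -> R) (f : R -> R[i]) : Prop :=
  [/\ measurable_fun edge (fun t => complex.Re (f t)),
      measurable_fun edge (fun t => complex.Im (f t)) &
      (\int[mu]_(t in edge) (w t * ComplexField.Normc.normc (f t) ^+ 2)%:E < +oo)%E].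

Definition edge_L2 (f : R -> R[i]) : Prop := weighted_L2 (fun=> 1) f.

(* C^1 functions with compact support in the open half-line. *)
Definition test_function (phi : R -> R) : Prop :=
  [/\ forall t, derivable phi t 1,
      continuous (derive1 phi) &
      exists a b : R, 0 < a /\ forall t, t \notin `[a, b] -> phi t = 0].

(* g is the weak derivative of f on the open half-line. *)
Definition weak_derivative (f g : R -> R[i]) : Prop :=
  forall phi : R -> R, test_function phi ->
    Cintegral (fun t => f t * (derive1 phi t)%:C) =
    - Cintegral (fun t => g t * (phi t)%:C).

(* H^1(0, oo), each class being represented by its continuous representative on
   the closed half-line, so that the boundary value is the value at 0. *)
Definition edge_H1 (f : R -> R[i]) : Prop :=
  [/\ {within edge, continuous (fun t => complex.Re (f t))},
      {within edge, continuous (fun t => complex.Im (f t))},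
      edge_L2 f &
      exists g, edge_L2 g /\ weak_derivative f g].

(* A weak derivative in L_2 (unique up to null sets), 0 if there is none. *)
Definition wderiv (f : R -> R[i]) : R -> R[i] :=
  xget (fun=> 0) [set g | edge_L2 g /\ weak_derivative f g].

Definition graph_L2 N (psi : graph_fun N R[i]) : Prop :=
  forall j, edge_L2 (psi j).

Definition graph_H1 N (psi : graph_fun N R[i]) : Prop :=
  (forall j, edge_H1 (psi j)) /\ (forall i j, psi i 0 = psi j 0).

(* In the library V^\+ = max(V, 0) and V^\- = max(-V, 0).  A compact subset of
   the graph is a union of one compact subset of [0, oo) per edge. *)
Definition admissible N (V : graph_fun N R) : Prop :=
  [/\ forall j, measurable_fun edge (V j),
      exists p : R, 1 <= p /\
        (graph_integral (fun j t => (((V j)^\- t) `^ p)%:E) < +oo)%E &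
      forall j (K : set R), compact K -> K `<=` edge ->
        mu.-integrable K (EFin \o (V j)^\+)].

(* Form domain H^1 /\ L_2(V_+ dx). *)
Definition form_domain N (V : graph_fun N R) (psi : graph_fun N R[i]) : Prop :=
  graph_H1 psi /\ forall j, weighted_L2 (V j)^\+ (psi j).

(* The sesquilinear form whose diagonal is
   h[psi] = \int (|psi'|^2 + V |psi|^2) dx, and the inner product of L_2. *)
Definition schrodinger_form N (V : graph_fun N R) (psi phi : graph_fun N R[i]) : R[i] :=
  graph_Cintegral (fun j t =>
    wderiv (psi j) t * (wderiv (phi j) t)^* +
    (V j t)%:C * (psi j t * (phi j t)^*)).

Definition graph_inner N (f phi : graph_fun N R[i]) : R[i] :=
  graph_Cintegral (fun j t => f j t * (phi j t)^*).

(* Graph of the self-adjoint operator H associated with the form (first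
   representation theorem): psi is in the domain of H and H psi = f. *)
Definition schrodinger N (V : graph_fun N R) (psi f : graph_fun N R[i]) : Prop :=
  [/\ form_domain V psi, graph_L2 f &
      forall phi, form_domain V phi -> schrodinger_form V psi phi = graph_inner f phi].

(* H psi = lam psi; psi = 0 is allowed. *)
Definition eigenvector N (V : graph_fun N R) (lam : R)
    (psi : graph_fun N R[i]) : Prop :=
  schrodinger V psi (fun j t => lam%:C * psi j t).

(* Linear independence in L_2, i.e. modulo equality almost everywhere. *)
Definition linearly_independent N n (psi : 'I_n -> graph_fun N R[i]) : Prop :=
  forall c : 'I_n -> R[i],
    (forall j, {ae mu, forall t, edge t -> \sum_(k < n) c k * psi k j t = 0}) ->
    forall k, c k = 0.

(* Dimension of the eigenspace: 0 iff lam is not an eigenvalue. *)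
Definition multiplicity N (V : graph_fun N R) (lam : R) : \bar R :=
  ereal_sup [set (n%:R)%:E | n in [set n : nat |
    exists psi : 'I_n -> graph_fun N R[i],
      (forall k, eigenvector V lam (psi k)) /\ linearly_independent psi]].

(* Tr H_-^gamma. *)
Definition trace_neg N (gamma : R) (V : graph_fun N R) : \bar R :=
  \esum_(lam in [set lam : R | lam < 0])
    (multiplicity V lam * (`|lam| `^ gamma)%:E)%E.

Definition LT_inequality (gamma : R) (N : nat) (C : R) : Prop :=
  forall V : graph_fun N R, admissible V ->
    (trace_neg gamma V <=
     C%:E * graph_integral (fun j t =>
              (((V j)^\- t) `^ (gamma + 2^-1))%:E))%E.

(* The optimal constant L_{gamma,N}, as an extended real: it would be +oo if no
   finite constant were admissible. *)
Definition LT_const (gamma : R) (N : nat) : \bar R :=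
  ereal_inf [set C%:E | C in [set C : R | LT_inequality gamma N C]].

(* L_gamma: the graph with two edges is the real line. *)
Definition LT_const_line (gamma : R) : \bar R := LT_const gamma 2.

End StarGraph.

(* Main.v *)
Require Import Defs.
From mathcomp Require Import all_boot all_order all_algebra.
From mathcomp Require Import all_classical all_reals all_analysis.
From mathcomp Require Import finmap measurable_realfun ring lra zify.

(** Both parts follow from comparing finite orthonormal families of eigenfunctions by the
min-max principle.

From the line to the star graph.  Replace V by -V_-: the form domain grows to all of H^1, the
form decreases and the integral of V_- is unchanged.  Group the edges in pairs and impose
continuity at the vertex only within each pair ([vertex_domain]).  This enlarges the form domain
once more, hence lowers the eigenvalues ([relaxed_eigenvectors]); the new operator is an
orthogonal sum of Schrodinger operators on lines, one for each pair, and the inequality on the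
line applies to each of them ([block_bound]).  If N is even, the sum over the pairs is the
inequality on the star graph.  If N is odd, an edge j remains.  An eigenfunction there, with the
Neumann condition at the vertex, extends evenly to an eigenfunction on a line whose potential
has twice the integral.  So the trace is at most C times the integral over the graph plus the
integral over the edge j ([trace_upper_bound]), and the average over j produces the factor
(N + 1) / N ([LT_line_odd]).

From the star graph to the line, for N >= 2.  Move the vertex far away: for large S, the point at
distance S on the second half-line is put at the vertex.  One edge carries everything before
that point, and each of the other edges a copy of the tail after it, only one copy with the
potential ([spread]).  The potential term and the integral of V_- do not change, while the
kinetic energy and the norm of a function increase by N - 2 copies of those of its tail, which
tend to 0 as S grows.  Hence the images of eigenfunctions are trial functions with almost the
same quotients ([spread_trial]), and the trace on the line inherits the bound of the star graph
([trace_lower_bound]).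

The eigenfunctions below given trial values come from the direct method of the calculus of
variations: an integrable power of V_- makes its form small with respect to the energy up to
finitely many point evaluations ([edge_potential_compact]), so the form attains its minimum on
the orthogonal complement of finitely many eigenfunctions ([exists_minimizer]), the minimizer is
an eigenfunction, and iterating yields the min-max principle ([minmax],
[eigenvectors_below_trial]).  On an edge, H^1 is described as the set of the square integrable
primitives of square integrable functions ([edge_H1P]), which gives completeness and the point
evaluations.  Finally [trace_ge] and [trace_le] say that the trace is the supremum of the sums of
powers over finite orthonormal families of eigenfunctions.  *)

Set Implicit Arguments.
Unset Strict Implicit.
Unset Printing Implicit Defensive.

Import Order.TTheory GRing.Theory Num.Theory.
Import numFieldNormedType.Exports.

Local Open Scope classical_set_scope.
Local Open Scope ring_scope.
Local Open Scope complex_scope.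

(** * Hermitian forms on a subspace *)

Section ComplexAux.
Context {R : realType}.

Definition nsq (a : R[i]) : R := complex.Re a ^+ 2 + complex.Im a ^+ 2.

Lemma nsq_ge0 a : 0 <= nsq a.
Proof. by rewrite addr_ge0 ?sqr_ge0. Qed.

Lemma nsq_eq0 a : nsq a = 0 -> a = 0.
Proof.
case: a => x y /eqP; rewrite /nsq /= paddr_eq0 ?sqr_ge0// !sqrf_eq0.
by move=> /andP[/eqP-> /eqP->].
Qed.

Lemma ReD (a b : R[i]) : complex.Re (a + b) = complex.Re a + complex.Re b.
Proof. by case: a; case: b. Qed.
Lemma ImD (a b : R[i]) : complex.Im (a + b) = complex.Im a + complex.Im b.
Proof. by case: a; case: b. Qed.
Lemma Re_sum (I : Type) (r : seq I) (P : pred I) (F : I -> R[i]) :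
  complex.Re (\sum_(i <- r | P i) F i) = \sum_(i <- r | P i) complex.Re (F i).
Proof. by apply: (big_morph _ ReD). Qed.

(** More unknowns than equations.  A span of m + 1 trial vectors therefore meets the orthogonal
    complement of m vectors. *)
Lemma exists_kernel_vector n m (f : 'I_n -> 'I_m -> R[i]) : (m < n)%N ->
  exists c : 'I_n -> R[i],
    (exists k, c k != 0) /\ forall j, \sum_(k < n) c k * f k j = 0.
Proof.
move=> mn; pose A : 'M[R[i]]_(n, m) := \matrix_(i, j) f i j.
have /rowV0Pn[r] : kermx A != 0.
  rewrite kermx_eq0 /row_free; apply/eqP => rk.
  by have := rank_leq_col A; rewrite rk leqNgt mn.
move=> /sub_kermxP rA r0; exists (fun k => r 0 k); split.
  apply/existsP; apply: contraNT r0; rewrite negb_exists => /forallP r0.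
  by apply/eqP/rowP => k; rewrite mxE; apply/eqP; rewrite -[_ == _]negbK r0.
move=> j; have /matrixP/(_ 0 j) := rA.
rewrite !mxE => rA0; rewrite -[RHS]rA0.
by apply: eq_bigr => k _; rewrite !mxE.
Qed.

End ComplexAux.

Section HermitianForms.
Context {R : realType} {E : lmodType R[i]}.
Implicit Types (u v w : E) (h s : E -> E -> R[i]) (D : E -> Prop).

Definition subspace D := D 0 /\ forall a u v, D u -> D v -> D (a *: u + v).
(** Sesquilinearity is required on a domain only: outside, the integrals that define the forms
    below need not converge. *)
Definition hermitian D h :=
  (forall a u v w, D u -> D v -> D w ->
     h (a *: u + v) w = a * h u w + h v w) /\
  (forall u v, D u -> D v -> h v u = (h u v)^*).
Definition diag h u : R := complex.Re (h u u).

Section OneForm.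
Variables (D : E -> Prop) (sD : subspace D).

Lemma subspaceD u v : D u -> D v -> D (u + v).
Proof. by move=> Du Dv; rewrite -[u]scale1r; apply: sD.2. Qed.
Lemma subspaceZ a u : D u -> D (a *: u).
Proof. by move=> Du; rewrite -[_ *: _]addr0; apply: sD.2 => //; exact: sD.1. Qed.
Lemma subspaceB u v : D u -> D v -> D (u - v).
Proof. by move=> Du Dv; rewrite -scaleN1r; apply: subspaceD => //; exact: subspaceZ. Qed.
Lemma subspace_sum (I : finType) (u : I -> E) : (forall i, D (u i)) -> D (\sum_i u i).
Proof.
move=> Du; elim/big_ind: _ => //; [exact: sD.1 | exact: subspaceD].
Qed.

Variables (h : E -> E -> R[i]) (hh : hermitian D h).

Lemma hermD u v w : D u -> D v -> D w -> h (u + v) w = h u w + h v w.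
Proof. by move=> Du Dv Dw; rewrite -{1}[u]scale1r hh.1// mul1r. Qed.
Lemma herm0 w : D w -> h 0 w = 0.
Proof.
move=> Dw; have D0 := sD.1.
by have := hermD D0 D0 Dw; rewrite addr0 => /eqP; rewrite addrC -subr_eq subrr eq_sym => /eqP.
Qed.
Lemma hermZ a u w : D u -> D w -> h (a *: u) w = a * h u w.
Proof.
move=> Du Dw; have D0 := sD.1.
by rewrite -[a *: u]addr0 hh.1// herm0// addr0.
Qed.
Lemma hermB u v w : D u -> D v -> D w -> h (u - v) w = h u w - h v w.
Proof.
move=> Du Dv Dw; rewrite -scaleN1r addrC hh.1//.
by rewrite mulN1r addrC.
Qed.
Lemma herm_sum (I : finType) (u : I -> E) w : (forall i, D (u i)) -> D w ->
  h (\sum_i u i) w = \sum_i h (u i) w.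
Proof.
move=> Du Dw.
have : D (\sum_i u i) /\ h (\sum_i u i) w = \sum_i h (u i) w.
  elim/big_ind2: _ => //; first by split; [exact: sD.1 | exact: herm0].
  move=> x1 x2 y1 y2 [D1 <-] [D2 <-]; split; first exact: subspaceD.
  exact: hermD.
by case.
Qed.
Lemma hermDr u v w : D u -> D v -> D w -> h w (u + v) = h w u + h w v.
Proof.
move=> Du Dv Dw; have Duv := subspaceD Du Dv.
by rewrite (hh.2 _ _ Duv Dw) (hh.2 _ _ Du Dw) (hh.2 _ _ Dv Dw) hermD// rmorphD.
Qed.
Lemma hermZr a u w : D u -> D w -> h w (a *: u) = a^* * h w u.
Proof.
move=> Du Dw; have Dau := subspaceZ a Du.
by rewrite (hh.2 _ _ Dau Dw) (hh.2 _ _ Du Dw) hermZ// rmorphM.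
Qed.
Lemma herm_sumr (I : finType) (u : I -> E) w : (forall i, D (u i)) -> D w ->
  h w (\sum_i u i) = \sum_i h w (u i).
Proof.
move=> Du Dw; rewrite (hh.2 _ _ (subspace_sum Du) Dw) herm_sum// rmorph_sum.
by apply: eq_bigr => i _; rewrite [RHS](hh.2 (u i)).
Qed.

Lemma herm_diag u : D u -> h u u = (diag h u)%:C.
Proof.
move=> Du; have := hh.2 _ _ Du Du; rewrite /diag; case: (h u u) => x y /= [].
by move=> yN; congr (_ +i* _); lra.
Qed.

Lemma diag_comb a u v : D u -> D v -> diag h (a *: u + v) =
  nsq a * diag h u + 2 * complex.Re (a * h u v) + diag h v.
Proof.
move=> Du Dv; have Dau := subspaceZ a Du.
rewrite /diag hermD//; last exact: subspaceD.
rewrite hermDr// hermDr// !hermZ// !hermZr// (hh.2 u v)// (herm_diag Du).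
rewrite !ReD /nsq /diag.
by case: (h u v) => x y; case: a {Dau} => a b; simpc => /=; ring.
Qed.

Lemma diagD u v : D u -> D v -> diag h (u + v) =
  diag h u + 2 * complex.Re (h u v) + diag h v.
Proof.
move=> Du Dv; rewrite -{1}[u]scale1r diag_comb// mul1r /nsq /=.
by rewrite expr1n expr0n/= addr0 mul1r.
Qed.

Lemma diagZ a u : D u -> diag h (a *: u) = nsq a * diag h u.
Proof.
move=> Du; have D0 := sD.1.
rewrite -[a *: u]addr0 diag_comb// {2}/diag herm0//= (hh.2 0 u)//.
by rewrite herm0// rmorph0 mulr0/= mulr0 !addr0.
Qed.

Lemma diag0 : diag h 0 = 0.
Proof. by rewrite /diag herm0//; exact: sD.1. Qed.

Lemma diagB u v : D u -> D v -> diag h (u - v) =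
  diag h u - 2 * complex.Re (h u v) + diag h v.
Proof.
move=> Du Dv; rewrite -scaleN1r addrC diag_comb// /nsq (hh.2 u v)//.
by case: (h u v) => x y; simpc => /=; ring.
Qed.

Lemma parallelogram u v : D u -> D v ->
  diag h (u - v) = 2 * diag h u + 2 * diag h v - diag h (u + v).
Proof. by move=> Du Dv; rewrite diagB// diagD//; ring. Qed.

Hypothesis h_ge0 : forall u, D u -> 0 <= diag h u.

Lemma cauchy_schwarz u v : D u -> D v -> nsq (h u v) <= diag h u * diag h v.
Proof.
move=> Du Dv; have key t : 0 <= t ^+ 2 * nsq (h u v) * diag h u
    - 2 * t * nsq (h u v) + diag h v.
  have := h_ge0 (sD.2 (- t%:C * (h u v)^*) _ _ Du Dv).
  rewrite diag_comb//.
  suff -> : nsq (- t%:C * (h u v)^*) * diag h u +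
    2 * complex.Re (- t%:C * (h u v)^* * h u v) =
    t ^+ 2 * nsq (h u v) * diag h u - 2 * t * nsq (h u v) by [].
  by case: (h u v) => x y; rewrite /nsq; simpc => /=; ring.
have [u0|u0] := eqVneq (diag h u) 0.
  rewrite u0 mul0r leNgt; apply/negP => n0.
  have := key ((diag h v + 1) / nsq (h u v)).
  rewrite u0 mulr0 add0r -mulrA divfK ?gt_eqF// => {}key.
  have := h_ge0 Dv; lra.
have up : 0 < diag h u by rewrite lt_neqAle eq_sym u0 h_ge0.
have := key (diag h u)^-1; rewrite expr2.
set q := diag h u in u0 up *; set z := nsq _.
have -> : q^-1 * q^-1 * z * q - 2 * q^-1 * z + diag h v = (q * diag h v - z) / q.
  by field.
by rewrite pmulr_lge0 ?invr_gt0// subr_ge0.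
Qed.

Lemma diagD_le u v : D u -> D v -> diag h (u + v) <= 2 * diag h u + 2 * diag h v.
Proof. by move=> Du Dv; have := h_ge0 (subspaceB Du Dv); rewrite parallelogram//; lra. Qed.

Lemma diagB_le u v : D u -> D v -> diag h (u - v) <= 2 * diag h u + 2 * diag h v.
Proof. by move=> Du Dv; have := h_ge0 (subspaceD Du Dv); rewrite parallelogram//; lra. Qed.

End OneForm.

Lemma hermitian_lincomb D (a : R) h s : hermitian D h -> hermitian D s ->
  hermitian D (fun u v => h u v + a%:C * s u v).
Proof.
move=> hh hs; split => [c u v w Du Dv Dw|u v Du Dv].
  by rewrite hh.1// hs.1//; ring.
rewrite (hh.2 u v)// (hs.2 u v)//.
by case: (h u v) => x y; case: (s u v) => z t; simpc.
Qed.

Lemma diag_lincomb (a : R) h s u :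
  diag (fun u v => h u v + a%:C * s u v) u = diag h u + a * diag s u.
Proof. by rewrite /diag ReD; case: (s u u) => x y; simpc. Qed.

End HermitianForms.

(** * Existence of minimizers *)

(** Limits along one ultrafilter play the role of extracted subsequences: the same ultrafilter
    serves finitely many functionals at every precision. *)
Lemma ultra_bounded_limit {R : realType} (U : set_system nat) (f : nat -> R) M :
  UltraFilter U -> (forall n, `|f n| <= M) ->
  exists x, forall d, 0 < d -> U [set n | `|f n - x| < d].
Proof.
move=> FU fM; pose S := [set y | U [set n | y <= f n]].
have SM y : S y -> y <= M.
  move=> Sy; rewrite leNgt; apply/negP => My.
  have /filter_ex[n /= yn] := Sy.
  have := fM n; rewrite ler_norml => /andP[_ nM].
  by have := lt_le_trans My (le_trans yn nM); rewrite ltxx.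
have S0 : S (- M).
  apply: filterE => n /=; by have := fM n; rewrite ler_norml => /andP[].
have hS : has_sup S by split; [exists (- M) | exists M => y /SM].
exists (sup S) => d d0.
have [y Sy yS] := sup_adherent d0 hS.
have nS : ~ S (sup S + d).
  move=> /(ub_le_sup hS.2); lra.
have [//|US] := in_ultra_setVsetC [set n | sup S + d <= f n] FU.
apply: filterS (filterI Sy US) => n /= [yn /negP]; rewrite -ltNge => nd.
by rewrite ltr_norml; apply/andP; split; lra.
Qed.

(** In the applications, [X] is the orthogonal complement of the eigenvectors already found; it is
    closed in the norm of [s]. *)
Definition has_minimizers {R : realType} {E : lmodType R[i]} (D : E -> Prop)
    (s h : E -> E -> R[i]) :=
  forall X : E -> Prop, subspace X -> (forall u, X u -> D u) ->
  (forall (u : nat -> E) w, (forall n, X (u n)) -> D w ->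
     (forall eps, 0 < eps -> exists n, diag s (u n - w) <= eps) -> X w) ->
  (exists2 u, X u & diag h u < 0) ->
  exists2 u, X u & [/\ diag s u = 1, diag h u < 0 &
    forall v, X v -> diag h u * diag s v <= diag h v].

Section Minimizer.
Context {R : realType} {E : lmodType R[i]}.
Variables (D : E -> Prop) (tau s b : E -> E -> R[i]).
Hypotheses (sD : subspace D) (htau : hermitian D tau) (hs : hermitian D s)
  (hb : hermitian D b).
Hypotheses (tau_ge0 : forall u, D u -> 0 <= diag tau u)
  (s_ge0 : forall u, D u -> 0 <= diag s u)
  (b_ge0 : forall u, D u -> 0 <= diag b u).

Let a u := diag tau u + diag s u.

Definition form_bounded := forall eps, 0 < eps -> exists M, forall u, D u ->
  diag b u <= eps * a u + M * diag s u.

(** The form [b] is relatively compact: a small multiple of the energy and finitely many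
    functionals that are bounded for the energy control it.  Below, these functionals are the
    values at sampling points. *)
Definition form_compact := forall eps, 0 < eps ->
  exists (I : finType) (l : I -> E -> R) K, [/\ 0 <= K,
    forall i u v, D u -> D v -> l i (u - v) = l i u - l i v,
    forall i u, D u -> l i u ^+ 2 <= K * a u &
    forall u, D u -> diag b u <= eps * a u + K * \sum_i l i u ^+ 2].

(** It is enough to consider sequences that converge fast.  The rate 16^-n leaves room for the
    weights 4^n in the proof of [riesz_fischer]. *)
Definition form_complete := forall u : nat -> E, (forall n, D (u n)) ->
  (forall n m, (n <= m)%N -> a (u n - u m) <= 16^-1 ^+ n) ->
  exists2 w, D w & forall eps, 0 < eps -> exists n0, forall n, (n0 <= n)%N ->
    a (u n - w) <= eps.

Hypotheses (bdd : form_bounded) (cpt : form_compact) (cpl : form_complete).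

Let h u v := tau u v + (-1)%:C * b u v.
Let hh : hermitian D h := hermitian_lincomb (-1) htau hb.
Let diag_h u : diag h u = diag tau u - diag b u.
Proof. by rewrite /h diag_lincomb mulN1r. Qed.

Lemma form_lower_bound : exists M, [/\ 0 <= M &
  forall u, D u -> 2^-1 * diag tau u - M * diag s u <= diag h u].
Proof.
have [|M bM] := @bdd 2^-1; first by rewrite invr_gt0.
exists (2^-1 + Num.max M 0); split.
  by rewrite addr_ge0 ?invr_ge0// le_max lexx orbT.
move=> u Du; have := bM u Du; rewrite diag_h /a => bu.
have : M * diag s u <= Num.max M 0 * diag s u.
  by rewrite ler_wpM2r ?s_ge0// le_max lexx.
by lra.
Qed.

(** The direct method.  Let mu < 0 be the infimum of [h] on the unit sphere of [X], so that
    q = h - mu s is nonnegative on [X], and take a minimizing sequence.  By the parallelogram law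
    q is small on differences of its terms.  Along an ultrafilter the functionals of
    [form_compact] converge, so [b] is small on these differences up to a small multiple of the
    energy.  Since - mu > 0, q + b controls the energy: the sequence is Cauchy, and its limit
    minimizes. *)
Lemma exists_minimizer : has_minimizers D s h.
Proof.
move=> X sX XD Xcl [u0 Xu0 hu0].
have [M [M0 hM]] := form_lower_bound.
pose S := [set diag h u | u in [set u | X u /\ diag s u = 1]].
have normalize u : X u -> 0 < diag s u -> exists v,
    [/\ X v, diag s v = 1 & diag h v = diag h u / diag s u].
  move=> Xu su; have Du := XD _ Xu.
  pose c := (Num.sqrt (diag s u))^-1; exists (c%:C *: u).
  have c2 : nsq c%:C = (diag s u)^-1.
    by rewrite /nsq /= expr0n addr0 exprVn sqr_sqrtr// ltW.
  split; first exact: subspaceZ.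
    by rewrite (diagZ sD hs)// c2 mulVf// gt_eqF.
  by rewrite (diagZ sD hh)// c2 mulrC.
have hs0 u : X u -> diag s u = 0 -> 0 <= diag h u.
  move=> /XD Du su; have := hM _ Du; have := tau_ge0 Du; rewrite su; lra.
have s0 u : X u -> diag h u < 0 -> 0 < diag s u.
  move=> Xu hu; rewrite lt_neqAle s_ge0 ?andbT; last exact: XD.
  by apply: contraTneq hu => su; rewrite -leNgt hs0.
have Sl : lbound S (- M).
  move=> _ [u [Xu su] <-]; have := hM _ (XD _ Xu).
  have := tau_ge0 (XD _ Xu); rewrite su; lra.
have [v0 [Xv0 sv0 hv0]] := normalize _ Xu0 (s0 _ Xu0 hu0).
have Sne : S !=set0 by exists (diag h v0); exists v0.
have hS : has_inf S by split => //; exists (- M).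
pose mu := inf S.
have mu0 : mu < 0.
  have Sv : S (diag h v0) by exists v0.
  apply: (le_lt_trans (ge_inf hS.2 Sv)).
  by rewrite hv0 pmulr_llt0// invr_gt0 s0.
have qX u : X u -> mu * diag s u <= diag h u.
  move=> Xu; have := s_ge0 (XD _ Xu); rewrite le_eqVlt => /predU1P[/esym su|su].
    by rewrite su mulr0 hs0.
  have [v [Xv sv hv]] := normalize _ Xu su.
  rewrite -ler_pdivlMr// -hv; apply: (ge_inf hS.2); by exists v.
pose q u v := h u v + (- mu)%:C * s u v.
have hq : hermitian D q := hermitian_lincomb (- mu) hh hs.
have hqX : hermitian X q.
  split=> [c u v w /XD Du /XD Dv /XD Dw|u v /XD Du /XD Dv]; [exact: hq.1|exact: hq.2].
have diag_q u : diag q u = diag h u - mu * diag s u.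
  by rewrite /q diag_lincomb mulNr.
have q_ge0 u : X u -> 0 <= diag q u.
  by move=> Xu; rewrite diag_q subr_ge0; exact: qX.
have /choice[u uP] : forall n, exists u, [/\ X u, diag s u = 1 & diag h u < mu + n.+1%:R^-1].
  move=> n; have [|_ [u [Xu su] <-] hu] := inf_adherent _ hS (eps := n.+1%:R^-1).
    by rewrite invr_gt0.
  by exists u.
have Xu n : X (u n) by case: (uP n).
have Du n : D (u n) by exact: XD.
have su n : diag s (u n) = 1 by case: (uP n).
have qu n : diag q (u n) <= n.+1%:R^-1.
  rewrite diag_q su; case: (uP n) => _ _; move: (n.+1%:R^-1) => x; lra.
have au n : a (u n) <= 2 * (2 + M).
  have := hM _ (Du n); case: (uP n) => _ -> hn; rewrite /a su.
  have : n.+1%:R^-1 <= 1 :> R by rewrite invf_le1// ler1n.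
  move: hn; move: (n.+1%:R^-1) => x; lra.
have [U [FU Uoo]] := ultraFilterLemma (@eventually_filter).
have invU d : 0 < d -> U [set n | n.+1%:R^-1 <= d :> R].
  move=> d0; apply: Uoo; near=> n => /=.
  have dn : d^-1 <= n%:R by near: n; exact: nbhs_infty_ger.
  rewrite -[d]invrK lef_pV2 ?posrE ?invr_gt0//.
  by rewrite (le_trans dn)// ler_nat.
have Cauchy eps : 0 < eps -> exists2 P : set nat, U P &
    forall n m, P n -> P m -> a (u n - u m) <= eps.
  move=> e0; pose c := Num.min 1 (- mu).
  have c0 : 0 < c by rewrite lt_min ltr01 oppr_gt0.
  have [|I [l [K [K0 lB lK bK]]]] := @cpt (c / 2); first by rewrite divr_gt0.
  have /choice[x xP] : forall i, exists x, forall d, 0 < d ->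
      U [set n | `|l i (u n) - x| < d].
    move=> i; apply: (@ultra_bounded_limit _ _ _ (K * (2 * (2 + M)) + 1)) => n.
    have := lK i _ (Du n); have := ler_wpM2l K0 (au n).
    set y := l i (u n); set A := K * (2 * _) => h1 h2.
    have : y ^+ 2 <= A by exact: le_trans h2 h1.
    by rewrite ler_norml => yA; apply/andP; split; nra.
  pose d := c * eps / (8 * (K + 1) * #|I|.+1%:R).
  have m0 : 0 < #|I|.+1%:R :> R by [].
  have K1 : 0 < K + 1 by lra.
  have d0 : 0 < d by rewrite divr_gt0 ?mulr_gt0.
  have d'0 : 0 < Num.min 1 d / 2 by rewrite divr_gt0// lt_min ltr01.
  (* The parallelogram law turns q <= c eps / 16 into q <= c eps / 4 on differences. *)
  exists ([set n | n.+1%:R^-1 <= c * eps / 16] `&`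
          [set n | forall i, `|l i (u n) - x i| < Num.min 1 d / 2]).
    apply: filterI; first by apply: invU; rewrite divr_gt0 ?mulr_gt0.
    by apply: filter_forall => i; exact: xP.
  move=> n n' [/= nq nl] [/= n'q n'l].
  have Dnn := subspaceB sD (Du n) (Du n').
  have q1 : diag q (u n - u n') <= c * eps / 4.
    have := diagB_le sX hqX q_ge0 (Xu n) (Xu n').
    have := le_trans (qu n) nq; have := le_trans (qu n') n'q.
    move: (c * eps) => z; lra.
  have q2 : c * a (u n - u n') - diag b (u n - u n') <= diag q (u n - u n').
    rewrite diag_q diag_h /a.
    have : c * diag tau (u n - u n') <= diag tau (u n - u n').
      by rewrite ler_piMl ?tau_ge0// ge_min lexx.
    have : c * diag s (u n - u n') <= - mu * diag s (u n - u n').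
      by rewrite ler_wpM2r ?s_ge0// ge_min lexx orbT.
    by lra.
  have l1 i : l i (u n - u n') ^+ 2 <= d.
    rewrite lB//; have := nl i; have := n'l i.
    set y := l i (u n); set y' := l i (u n').
    set e := Num.min 1 d; have e1 : e <= 1 by rewrite ge_min lexx.
    have ed : e <= d by rewrite ge_min lexx orbT.
    have e00 : 0 < e by rewrite lt_min ltr01.
    rewrite !ltr_norml => /andP[? ?] /andP[? ?]; apply: le_trans ed.
    have ? : - e <= y - y' by lra.
    have ? : y - y' <= e by lra.
    by nra.
  have l2 : K * \sum_i l i (u n - u n') ^+ 2 <= c * eps / 8.
    have : \sum_i l i (u n - u n') ^+ 2 <= #|I|.+1%:R * d.
      apply: le_trans (ler_sum _ (fun i _ => l1 i)) _.
      by rewrite sumr_const mulr_natl mulrSr lerDl ltW.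
    have dE : (K + 1) * (#|I|.+1%:R * d) = c * eps / 8.
      by rewrite /d; field; rewrite ?gt_eqF//=; lra.
    have S0 : 0 <= \sum_i l i (u n - u n') ^+ 2.
      by rewrite sumr_ge0// => i _; rewrite sqr_ge0.
    by move=> h1; rewrite -dE ler_pM// lerDl.
  have b1 := bK _ Dnn.
  have : c * a (u n - u n') <= c * eps.
    have ce : 0 < c * eps by rewrite mulr_gt0.
    lra.
  by rewrite ler_pM2l.
have /choice[P PP] : forall k, exists P : set nat, U P /\
    forall n m, P n -> P m -> a (u n - u m) <= 16^-1 ^+ k.
  move=> k; have [|P UP aP] := Cauchy (16^-1 ^+ k); last by exists P.
  by rewrite exprn_gt0// invr_gt0.
(* The k-th term is chosen in the intersection of the first k + 1 sets, for the Cauchy rate 16^-k. *)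
have /choice[n_ nP] : forall k, exists n, (k.+1%:R : R) <= n.+1%:R /\
    forall i : 'I_k.+1, P i n.
  move=> k.
  suff : U ([set n | k <= n]%N `&` [set n | forall i : 'I_k.+1, P i n]).
    by move=> /filter_ex[n [/= kn Pn]]; exists n; rewrite ler_nat.
  apply: filterI; first by apply: Uoo; exact: nbhs_infty_ge.
  by apply: filter_forall => i; case: (PP i).
have [|n m nm|w Dw wP] := cpl (u := fun k => u (n_ k)); first by [].
  apply: (PP n).2; first exact: ((nP n).2 ord_max).
  have nm1 : (n < m.+1)%N by [].
  exact: ((nP m).2 (Ordinal nm1)).
have Xw : X w.
  apply: (Xcl (fun k => u (n_ k))) => // eps e0.
  have [n0 /(_ n0 (leqnn _)) an] := wP _ e0; exists n0; apply: le_trans an.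
  by rewrite lerDr tau_ge0//; exact: subspaceB.
have qw : diag q w <= 0.
  apply/ler_addgt0Pr => eps e0; rewrite add0r.
  pose C := 1 - mu; have C0 : 0 < C by rewrite /C; lra.
  have e4 : 0 < eps / (4 * C) by rewrite divr_gt0// mulr_gt0.
  have [n0 an] := wP _ e4.
  have [k [k0 ke]] : exists k, (n0 <= k)%N /\ k.+1%:R^-1 <= eps / 4.
    have : \forall k \near \oo, (n0 <= k)%N /\ k.+1%:R^-1 <= eps / 4.
      near=> k; split; first by near: k; exact: nbhs_infty_ge.
      have dn : (eps / 4)^-1 <= k%:R by near: k; exact: nbhs_infty_ger.
      rewrite -[eps / 4]invrK lef_pV2 ?posrE ?invr_gt0 ?divr_gt0//.
      by rewrite (le_trans dn)// ler_nat.
    by move=> /filter_ex.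
  have := diagB_le sX hqX q_ge0 (Xu (n_ k)) (subspaceB sX (Xu (n_ k)) Xw).
  rewrite subKr => /le_trans; apply.
  have q1 : diag q (u (n_ k)) <= eps / 4.
    apply: le_trans (qu _) _; apply: le_trans ke.
    by rewrite lef_pV2 ?posrE//; exact: (nP k).1.
  have : diag q (u (n_ k) - w) <= C * a (u (n_ k) - w).
    have Dd := subspaceB sD (Du (n_ k)) Dw.
    rewrite diag_q diag_h /a /C.
    have := b_ge0 Dd; have := s_ge0 Dd; have := tau_ge0 Dd; nra.
  have : C * a (u (n_ k) - w) <= eps / 4.
    rewrite -ler_pdivlMl// (le_trans (an k k0))// le_eqVlt; apply/orP; left.
    by apply/eqP; field; rewrite gt_eqF.
  lra.
have q0 : diag q w = 0 by apply/eqP; rewrite eq_le qw q_ge0.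
have sw : 0 < diag s w.
  have e4 : 0 < 4^-1 :> R by rewrite invr_gt0.
  have [n0 /(_ n0 (leqnn _))] := wP _ e4.
  have Dd := subspaceB sD (Du (n_ n0)) Dw.
  have := diagB_le sD hs s_ge0 (Du (n_ n0)) Dd; rewrite subKr.
  rewrite /a => h1 h2; have := tau_ge0 Dd.
  have := diagD_le sD hs s_ge0 Dw Dd; rewrite addrC subrK su; lra.
have [w' [Xw' sw' hw']] := normalize _ Xw sw.
have hmu : diag h w / diag s w = mu.
  have -> : diag h w = mu * diag s w by apply/eqP; rewrite -subr_eq0 -diag_q q0.
  by rewrite mulfK// gt_eqF.
exists w' => //; split => //.
  by rewrite hw' hmu.
by move=> v Xv; rewrite hw' hmu; exact: qX.
Unshelve. all: by end_near. Qed.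

End Minimizer.

(** * The min-max principle for forms that respect a block decomposition *)

Section MinMax.
Context {R : realType} {E : lmodType R[i]}.
Variables (D : E -> Prop) (s h : E -> E -> R[i]).
Hypotheses (sD : subspace D) (hs : hermitian D s) (hh : hermitian D h).
Hypothesis s_ge0 : forall u, D u -> 0 <= diag s u.

Definition form_eigenvector mu u := forall v, D v -> h u v = mu%:C * s u v.

Definition orthonormal n (u : 'I_n -> E) :=
  forall i j, s (u i) (u j) = (i == j)%:R.

(** The form h - h[u] s is nonnegative on [X] and vanishes at [u], so by the Cauchy-Schwarz
    inequality [u] is in its kernel. *)
Lemma minimizer_eigenvector (X : E -> Prop) u : subspace X ->
  (forall v, X v -> D v) -> X u -> diag s u = 1 ->
  (forall v, X v -> diag h u * diag s v <= diag h v) ->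
  forall v, X v -> h u v = (diag h u)%:C * s u v.
Proof.
move=> sX XD Xu su umin v Xv.
pose q x y := h x y + (- diag h u)%:C * s x y.
have hq : hermitian X q.
  have hq : hermitian D q := hermitian_lincomb (- diag h u) hh hs.
  split=> [c x y w /XD Dx /XD Dy /XD Dw|x y /XD Dx /XD Dy]; [exact: hq.1|exact: hq.2].
have diag_q x : diag q x = diag h x - diag h u * diag s x.
  by rewrite /q diag_lincomb mulNr.
have q_ge0 x : X x -> 0 <= diag q x by move=> Xx; rewrite diag_q subr_ge0 umin.
have := cauchy_schwarz sX hq q_ge0 Xu Xv.
rewrite (diag_q u) su mulr1 subrr mul0r => q0.
have /nsq_eq0 : nsq (q u v) = 0 by apply/eqP; rewrite eq_le q0 nsq_ge0.
by move=> /eqP; rewrite /q addr_eq0 rmorphN mulNr opprK => /eqP.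
Qed.

Lemma subspace_orthogonal n (u : 'I_n -> E) : (forall i, D (u i)) ->
  subspace (fun v => D v /\ forall i, s v (u i) = 0).
Proof.
move=> Du; split; first by split; [exact: sD.1 | move=> i; exact: (herm0 sD hs)].
move=> a v w [Dv v0] [Dw w0]; split; first exact: sD.2.
by move=> i; rewrite hs.1// v0 w0 mulr0 addr0.
Qed.

Section Blocks.
Variables (B : finType) (P : B -> E -> E).
Hypotheses (PD : forall b u, D u -> D (P b u))
  (PP : forall b c u, P b (P c u) = if b == c then P b u else 0)
  (PZ : forall b a u, P b (a *: u) = a *: P b u)
  (Psum : forall u, \sum_b P b u = u)
  (Ps : forall b u v, D u -> D v -> s (P b u) v = s u (P b v))
  (Ph : forall b u v, D u -> D v -> h (P b u) v = h u (P b v)).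

Let Pid b u : P b (P b u) = P b u.
Proof. by rewrite PP eqxx. Qed.

Let herm_blocks (f : E -> E -> R[i]) u : hermitian D f ->
  (forall b u v, D u -> D v -> f (P b u) v = f u (P b v)) -> D u ->
  diag f u = \sum_b diag f (P b u).
Proof.
move=> hf Pf Du; rewrite /diag -Re_sum; congr complex.Re.
rewrite -{1}[u]Psum.
have : D (\sum_b P b u) /\ f (\sum_b P b u) u = \sum_b f (P b u) u.
  elim/big_ind2: _ => [|x1 x2 y1 y2 [D1 <-] [D2 <-]|b _].
  - by split; [exact: sD.1 | exact: (herm0 sD hf)].
  - by split; [exact: subspaceD | exact: (hermD hf)].
  - by split=> //; exact: PD.
case=> _ ->; apply: eq_bigr => b _.
by rewrite -Pf ?Pid//; exact: PD.
Qed.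

Hypothesis hmin : has_minimizers D s h.

Variables (n : nat) (phi : nat -> E) (lam : nat -> R).
Hypotheses (Dphi : forall k, (k < n)%N -> D (phi k))
  (lam0 : forall k, (k < n)%N -> lam k < 0).
Hypothesis trial : forall m, (m < n)%N -> forall c : 'I_m.+1 -> R[i],
  let psi := \sum_(k < m.+1) c k *: phi k in
  diag h psi <= lam m * diag s psi /\ (diag s psi = 0 -> forall k, c k = 0).

Let step m (u : 'I_m -> E) (mu : 'I_m -> R) (beta : 'I_m -> B) : (m < n)%N ->
  (forall i, D (u i)) -> (forall i, P (beta i) (u i) = u i) ->
  (forall i, form_eigenvector (mu i) (u i)) -> orthonormal u ->
  exists v nu b, [/\ D v, P b v = v, form_eigenvector nu v, nu <= lam m &
    diag s v = 1 /\ forall i, s v (u i) = 0].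
Proof.
move=> mn Du Pu eu ou.
pose X v := D v /\ forall i, s v (u i) = 0.
have sX : subspace X := subspace_orthogonal Du.
have XD v : X v -> D v by case.
have Dphi' (k : 'I_m.+1) : D (phi k).
  by apply: Dphi; apply: leq_ltn_trans mn; rewrite -ltnS.
have [c [[k0 ck0] c0]] := exists_kernel_vector (fun k j => s (phi k) (u j)) (ltnSn m).
pose psi := \sum_(k < m.+1) c k *: phi k.
have Dpsi : D psi by apply: (subspace_sum sD) => k; exact: subspaceZ.
have Xpsi : X psi.
  split=> // i; rewrite (herm_sum sD hs)//; last by move=> k; exact: subspaceZ.
  by rewrite -[RHS](c0 i); apply: eq_bigr => k _; rewrite (hermZ sD hs).
have [hpsi spsi] := trial mn c.
have spsi0 : 0 < diag s psi.
  rewrite lt_neqAle s_ge0// andbT eq_sym; apply/eqP => /spsi/(_ k0) ck.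
  by rewrite ck eqxx in ck0.
have [] := hmin sX XD.
- move=> f w fX Dw fw; split=> // i; apply: nsq_eq0; apply/eqP.
  rewrite eq_le nsq_ge0 andbT; apply/ler_addgt0Pr => e e0; rewrite add0r.
  have [k fk] := fw _ e0; have [Dfk fk0] := fX k.
  have sui : diag s (u i) = 1 by rewrite /diag ou eqxx.
  have := cauchy_schwarz sD hs s_ge0 (subspaceB sD Dfk Dw) (Du i).
  rewrite sui mulr1 (hermB hs)// fk0 sub0r.
  suff -> : nsq (- s w (u i)) = nsq (s w (u i)) by move=> /le_trans; apply.
  by case: (s w (u i)) => x y; rewrite /nsq /= !sqrrN.
- exists psi => //; apply: le_lt_trans hpsi _.
  by rewrite pmulr_llt0// lam0.
move=> v Xv [sv hv vmin]; set nu := diag h v in hv vmin.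
have Dv := XD _ Xv.
have XP b : X (P b v).
  split; first exact: PD.
  move=> i; rewrite Ps// -Pu PP; case: ifP => [/eqP ->|_]; first by rewrite Pu Xv.2.
  by rewrite (hs.2 _ _ sD.1 Dv) (herm0 sD hs)// rmorph0.
have gap : \sum_b (diag h (P b v) - nu * diag s (P b v)) = 0.
  rewrite sumrB -mulr_sumr -!herm_blocks// sv mulr1; exact: subrr.
have gap_ge0 b : 0 <= diag h (P b v) - nu * diag s (P b v).
  by rewrite subr_ge0; exact: vmin.
have [b sb] : exists b, 0 < diag s (P b v).
  apply: contrapT => nb; have := oner_neq0 R.
  rewrite -sv (herm_blocks hs)// big1 ?eqxx// => b _.
  apply/eqP; rewrite eq_le (s_ge0 (XD _ (XP b))) andbT leNgt.
  by apply/negP => sb; apply: nb; exists b.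
have hb : diag h (P b v) = nu * diag s (P b v).
  apply/eqP; rewrite -subr_eq0; move/eqP: gap; rewrite psumr_eq0//.
  by move=> /allP/(_ b); rewrite mem_index_enum => /(_ isT).
pose t := (Num.sqrt (diag s (P b v)))^-1.
have t2 : nsq t%:C = (diag s (P b v))^-1.
  by rewrite /nsq /= expr0n addr0 exprVn sqr_sqrtr// ltW.
have DPb := XD _ (XP b).
pose w := t%:C *: P b v.
have sw : diag s w = 1 by rewrite (diagZ sD hs)// t2 mulVf// gt_eqF.
have hw : diag h w = nu by rewrite (diagZ sD hh)// t2 hb mulrC mulfK// gt_eqF.
have Xw : X w by exact: (subspaceZ sX).
have Dw := XD _ Xw.
have wX : forall x, X x -> h w x = nu%:C * s w x.
  rewrite -hw; apply: minimizer_eigenvector => //.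
  by move=> x Xx; rewrite hw; exact: vmin.
have hwu i : h w (u i) = 0.
  by rewrite (hh.2 (u i))// eu// (hs.2 w)// (Xw.2 i) conjc0 mulr0 conjc0.
exists w, nu, b; split => //; last by split=> // i; exact: Xw.2.
- by rewrite PZ Pid.
- move=> x Dx.
  pose y := \sum_(i < m) s x (u i) *: u i.
  have Dsu i : D (s x (u i) *: u i) by exact: subspaceZ.
  have Dy : D y by exact: (subspace_sum sD).
  have Xxy : X (x - y).
    split; first exact: subspaceB.
    move=> i; rewrite (hermB hs)// (herm_sum sD hs)//.
    rewrite (bigD1 i)//= big1 => [|j ji]; rewrite (hermZ sD hs)// ou.
      by rewrite eqxx mulr1 addr0 subrr.
    by rewrite (negbTE ji) mulr0.
  have sy : s w y = 0.
    rewrite (herm_sumr sD hs)// big1// => i _.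
    by rewrite (hermZr sD hs)// (Xw.2 i) mulr0.
  have hy : h w y = 0.
    rewrite (herm_sumr sD hh)// big1// => i _.
    by rewrite (hermZr sD hh)// hwu mulr0.
  have Dxy := XD _ Xxy; rewrite -[x](subrK y).
  by rewrite (hermDr sD hh Dxy)// (hermDr sD hs Dxy)// hy sy !addr0 wX.
- rewrite -(ler_pM2r spsi0); apply: le_trans hpsi; exact: vmin.
Qed.

(** The eigenvectors are constructed one at a time, each in a single block: the projections of a
    minimizer to the blocks have nonnegative gaps h - nu s that add up to 0, hence every nonzero
    projection is itself a minimizer. *)
Theorem minmax : exists (u : 'I_n -> E) (mu : 'I_n -> R) (beta : 'I_n -> B),
  [/\ forall i, D (u i), forall i, P (beta i) (u i) = u i,
      forall i, form_eigenvector (mu i) (u i), orthonormal u &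
      forall i, mu i <= lam i].
Proof.
suff : forall m, (m <= n)%N ->
    exists (u : 'I_m -> E) (mu : 'I_m -> R) (beta : 'I_m -> B),
    [/\ forall i, D (u i), forall i, P (beta i) (u i) = u i,
      forall i, form_eigenvector (mu i) (u i), orthonormal u &
      forall i, mu i <= lam i] by exact.
elim=> [_|m IH mn].
  have f T : 'I_0 -> T by case.
  exists (f E), (f R), (f B); by split; case.
have [u [mu [beta [Du Pu eu ou mul]]]] := IH (ltnW mn).
have [v [nu [b [Dv Pv ev nul [sv svu]]]]] := step mn Du Pu eu ou.
pose ext T (x : T) (f : 'I_m -> T) (i : 'I_m.+1) :=
  if unlift ord_max i is Some j then f j else x.
exists (ext _ v u), (ext _ nu mu), (ext _ b beta).
rewrite /ext; split => [i|i|i|i j|i].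
- by case: unliftP.
- by case: unliftP.
- by case: unliftP.
- case: (unliftP ord_max i) => [i' ->|->]; case: (unliftP ord_max j) => [j' ->|->].
  + by rewrite ou (inj_eq lift_inj).
  + by rewrite (hs.2 v)// svu conjc0 eq_sym (negbTE (neq_lift _ _)).
  + by rewrite svu (negbTE (neq_lift _ _)).
  + by rewrite (herm_diag hs Dv) sv eqxx.
- case: unliftP => [i' ->|->] //.
  by rewrite lift_max.
Qed.

End Blocks.
End MinMax.

(** * Orthonormal families and trial vectors *)

Section Orthonormalisation.
Context {R : realType} {E : lmodType R[i]}.
Variables (D : E -> Prop) (s : E -> E -> R[i]).
Hypotheses (sD : subspace D) (hs : hermitian D s).
Hypothesis s_ge0 : forall u, D u -> 0 <= diag s u.

Lemma normalize_vector u : D u -> 0 < diag s u ->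
  exists2 c : R, 0 < c & diag s (c%:C *: u) = 1.
Proof.
move=> Du su; exists (Num.sqrt (diag s u))^-1; first by rewrite invr_gt0 sqrtr_gt0.
rewrite (diagZ sD hs)// /nsq /= expr0n addr0 exprVn sqr_sqrtr ?ltW//.
by rewrite mulVf// gt_eqF.
Qed.

(** The next vector is a combination of the [psi k] that is orthogonal to the vectors found so
    far, which exists by counting dimensions. *)
Lemma exists_orthonormal (Z : E -> Prop) n (psi : 'I_n -> E) : subspace Z ->
  (forall u, Z u -> D u) -> (forall k, Z (psi k)) ->
  (forall c : 'I_n -> R[i], diag s (\sum_k c k *: psi k) = 0 -> forall k, c k = 0) ->
  exists u : 'I_n -> E, (forall k, Z (u k)) /\ orthonormal s u.
Proof.
move=> sZ ZD Zpsi indep.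
suff : forall m, (m <= n)%N -> exists u : 'I_m -> E,
    (forall k, Z (u k)) /\ orthonormal s u by exact.
elim=> [_|m IH mn].
  have f : 'I_0 -> E by case.
  by exists f; split; case.
have [u [Zu ou]] := IH (ltnW mn).
have [c [[k0 ck0] c0]] := exists_kernel_vector (fun k j => s (psi k) (u j)) mn.
pose v := \sum_(k < n) c k *: psi k.
have Zv : Z v by apply: (subspace_sum sZ) => k; exact: (subspaceZ sZ).
have Dv := ZD _ Zv.
have sv0 : 0 < diag s v.
  rewrite lt_neqAle s_ge0// andbT eq_sym; apply/eqP => /indep/(_ k0) ck.
  by rewrite ck eqxx in ck0.
have vu i : s v (u i) = 0.
  rewrite (herm_sum sD hs); [|by move=> k; apply: (subspaceZ sD); exact: ZD|exact: ZD].
  by rewrite -[RHS](c0 i); apply: eq_bigr => k _; rewrite (hermZ sD hs)//; exact: ZD.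
have [t t0 st] := normalize_vector Dv sv0.
pose ext (i : 'I_m.+1) := if unlift ord_max i is Some j then u j else t%:C *: v.
have Dtv : D (t%:C *: v) by exact: (subspaceZ sD).
have tvu i : s (t%:C *: v) (u i) = 0.
  by rewrite (hermZ sD hs)// ?vu ?mulr0//; exact: ZD.
exists ext; rewrite /ext; split => [i|i j].
  by case: unliftP => // _; exact: (subspaceZ sZ).
case: (unliftP ord_max i) => [i' ->|->]; case: (unliftP ord_max j) => [j' ->|->].
+ by rewrite ou (inj_eq lift_inj).
+ rewrite (hs.2 (t%:C *: v))//; last exact: ZD.
  by rewrite tvu conjc0 eq_sym (negbTE (neq_lift _ _)).
+ by rewrite tvu (negbTE (neq_lift _ _)).
+ by rewrite (herm_diag hs Dtv) st eqxx.
Qed.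

Section Orthonormal.
Variables (h : E -> E -> R[i]) (hh : hermitian D h).
Variables (I : finType) (u : I -> E) (lam : I -> R).
Hypotheses (Du : forall i, D (u i))
  (eu : forall i, form_eigenvector D s h (lam i) (u i))
  (ou : forall i j, s (u i) (u j) = (i == j)%:R).

Lemma diag_eigencombination (c : I -> R[i]) :
  diag h (\sum_i c i *: u i) = \sum_i lam i * nsq (c i) /\
  diag s (\sum_i c i *: u i) = \sum_i nsq (c i).
Proof.
have Dc i : D (c i *: u i) by exact: (subspaceZ sD).
have DS : D (\sum_i c i *: u i) by exact: (subspace_sum sD).
have su i : s (u i) (\sum_j c j *: u j) = (c i)^*.
  rewrite (herm_sumr sD hs)// (bigD1 i)//= big1 ?addr0 => [|j ji].
    by rewrite (hermZr sD hs)// ou eqxx mulr1.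
  by rewrite (hermZr sD hs)// ou eq_sym (negbTE ji) mulr0.
split; rewrite /diag.
  rewrite (herm_sum sD hh)// Re_sum; apply: eq_bigr => i _.
  rewrite (hermZ sD hh)// eu// su /nsq; case: (c i) => x y; simpc => /=; ring.
rewrite (herm_sum sD hs)// Re_sum; apply: eq_bigr => i _.
by rewrite (hermZ sD hs)// su /nsq; case: (c i) => x y; simpc => /=; ring.
Qed.

End Orthonormal.

End Orthonormalisation.

Section FromTrial.
Context {R : realType} {E : lmodType R[i]}.
Variables (D : E -> Prop) (s h : E -> E -> R[i]).
Hypotheses (sD : subspace D) (hs : hermitian D s) (hh : hermitian D h).
Hypothesis s_ge0 : forall u, D u -> 0 <= diag s u.
Hypothesis hmin : has_minimizers D s h.
Variables (B : finType) (P : B -> E -> E).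
Hypotheses (PD : forall b u, D u -> D (P b u))
  (PP : forall b c u, P b (P c u) = if b == c then P b u else 0)
  (PZ : forall b a u, P b (a *: u) = a *: P b u)
  (Psum : forall u, \sum_b P b u = u)
  (Ps : forall b u v, D u -> D v -> s (P b u) v = s u (P b v))
  (Ph : forall b u v, D u -> D v -> h (P b u) v = h u (P b v)).

(** The min-max principle for trial vectors in any order: sort them by their trial values.  The
    bijection [sigma] that sorts is described by its effect on sums, the form in which it is
    used. *)
Theorem eigenvectors_below_trial (I : finType) (phi : I -> E) (lam : I -> R) :
  (forall i, D (phi i)) -> (forall i, lam i < 0) ->
  (forall (t : R) (c : I -> R[i]), t < 0 -> (forall i, c i != 0 -> lam i <= t) ->
    diag h (\sum_i c i *: phi i) <= t * diag s (\sum_i c i *: phi i)) ->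
  (forall c : I -> R[i], diag s (\sum_i c i *: phi i) = 0 -> forall i, c i = 0) ->
  exists n (u : 'I_n -> E) (nu : 'I_n -> R) (beta : 'I_n -> B) (sigma : 'I_n -> I),
  [/\ forall k, D (u k) /\ P (beta k) (u k) = u k,
      forall k, form_eigenvector D s h (nu k) (u k), orthonormal s u,
      forall k, nu k <= lam (sigma k) &
      forall F : I -> R, \sum_i F i = \sum_k F (sigma k)].
Proof.
move=> Dphi lam0 below indep.
have [i0 _|I0] := pickP (fun _ : I => true).
  pose le i j := lam i <= lam j.
  pose r := sort le (enum I).
  have pr : perm_eq r (enum I) by rewrite perm_sort.
  have ur : uniq r by rewrite (perm_uniq pr) enum_uniq.
  have rI i : i \in r by rewrite (perm_mem pr) mem_enum.
  have le_tr : transitive le by move=> x y z; exact: le_trans.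
  have sr : sorted le r by apply: sort_sorted => x y; exact: le_total.
  pose n := size r; pose sigma k := nth i0 r k.
  have sumE (V : nmodType) (F : I -> V) : \sum_i F i = \sum_(k < n) F (sigma k).
    by rewrite -big_enum /= -(perm_big _ pr) /= (big_nth i0) big_mkord.
  have mono i m : (index i r <= m)%N -> (m < n)%N -> lam i <= lam (sigma m).
    move=> im mn; have := sorted_leq_nth le_tr (fun x => lexx (lam x)) i0 sr.
    move=> /(_ (index i r) m); rewrite !inE index_mem rI mn nth_index//.
    by apply.
  have [|||u [nu [beta [Du Pu eu ou nul]]]] := minmax sD hs hh s_ge0 PD PP PZ Psum Ps Ph hmin
    (n := n) (phi := fun k => phi (sigma k)) (lam := fun k => lam (sigma k)).
  - by move=> k _; exact: Dphi.
  - by move=> k _; exact: lam0.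
  - move=> m mn c /=.
    (* The combinations of the first m + 1 sorted vectors, as combinations of all of them. *)
    pose c' i := if (index i r <= m)%N then c (inord (index i r)) else 0.
    have cE : \sum_(k < m.+1) c k *: phi (sigma k) = \sum_i c' i *: phi i.
      rewrite sumE; transitivity (\sum_(k < m.+1) c (inord k) *: phi (sigma k)).
        by apply: eq_bigr => k _; rewrite inord_val.
      rewrite (big_ord_widen n (fun k => c (inord k) *: phi (sigma k)) mn) big_mkcond.
      apply: eq_bigr => k _; rewrite /c' index_uniq// ltnS.
      by case: ifP => // _; rewrite scale0r.
    split.
      rewrite cE; apply: below => [|i]; first exact: lam0.
      by rewrite /c'; case: ifP => [im _|]; [exact: mono|rewrite eqxx].
    rewrite cE => /indep c0 k.
    have kn : (k < n)%N by apply: leq_ltn_trans mn; rewrite -ltnS.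
    have := c0 (sigma k); rewrite /c' index_uniq// -ltnS ltn_ord inord_val.
    by [].
  exists n, u, nu, beta, (fun k => sigma k); split => //.
  - by move=> F; exact: sumE.
have f T : 'I_0 -> T by case.
exists 0%N, (f E), (f R), (f B), (f I); split; try by case.
by move=> F; rewrite big_ord0 big1// => i _; have := I0 i.
Qed.

End FromTrial.

(** Lebesgue measurability, with the sigma-algebra fixed: elaborating a bare set of reals would
    leave it ambiguous. *)
Definition meas {R : realType} (A : set R) := measurable (A : set (measurableTypeR R)).

(** * Weighted square integrable functions on an edge *)

Section RealIntegrals.
Context {R : realType}.
Local Notation mu := (@lebesgue_measure R).
Implicit Types (A : set R) (f g w : R -> R).

Definition integ A f := mu.-integrable A (EFin \o f).

Lemma integ_meas A f : integ A f -> measurable_fun A f.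
Proof. by move=> /measurable_int/measurable_EFinP. Qed.

Lemma integ_dom A f g : meas A -> measurable_fun A f ->
  (forall t, A t -> `|f t| <= g t) -> integ A g -> integ A f.
Proof.
move=> mA mf fg; apply: le_integrable => //; first exact/measurable_EFinP.
move=> t At /=; rewrite lee_fin (le_trans (fg _ At))//; exact: ler_norm.
Qed.

Lemma eq_integ A f g : meas A -> (forall t, A t -> f t = g t) ->
  integ A f -> integ A g.
Proof.
by move=> mA fg; apply: eq_integrable => // t /set_mem At /=; rewrite fg.
Qed.

Lemma integD A f g : meas A -> integ A f -> integ A g ->
  integ A (fun t => f t + g t).
Proof. by move=> mA If Ig; have := integrableD mA If Ig. Qed.

Lemma integZ A a f : meas A -> integ A f -> integ A (fun t => a * f t).
Proof. by move=> mA If; have := integrableZl mA a If. Qed.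

Lemma integN A f : meas A -> integ A f -> integ A (fun t => - f t).
Proof. by move=> mA /(integZ (-1) mA); apply: eq_integ => // t _; rewrite mulN1r. Qed.

Lemma integB A f g : meas A -> integ A f -> integ A g ->
  integ A (fun t => f t - g t).
Proof. by move=> mA If Ig; apply: integD => //; exact: integN. Qed.

Lemma integ0 A : integ A (fun=> 0).
Proof. exact: integrable0. Qed.

Lemma integS A B f : meas A -> meas B -> B `<=` A -> integ A f -> integ B f.
Proof. by move=> mA mB BA; exact: (integrableS mA mB BA). Qed.

Lemma integ_cst (a b c : R) : integ `[a, b] (fun=> c).
Proof.
apply: measurable_bounded_integrable => //=.
  by rewrite lebesgue_measure_itv/=; case: ifP => _; rewrite ?ltry// -EFinB ltry.
by exists `|c|; split => // x x1 t _ /=; rewrite ltW.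
Qed.

Lemma eq_Rint A f g : (forall t, A t -> f t = g t) ->
  \int[mu]_(t in A) f t = \int[mu]_(t in A) g t.
Proof. by move=> fg; apply: eq_Rintegral => t /set_mem; exact: fg. Qed.

Lemma RintZ A a f : meas A -> integ A f ->
  \int[mu]_(t in A) (a * f t) = a * \int[mu]_(t in A) f t.
Proof. by move=> mA If; rewrite RintegralZl. Qed.

Lemma RintD A f g : meas A -> integ A f -> integ A g ->
  \int[mu]_(t in A) (f t + g t) = \int[mu]_(t in A) f t + \int[mu]_(t in A) g t.
Proof. by move=> mA If Ig; rewrite RintegralD. Qed.

Lemma RintB A f g : meas A -> integ A f -> integ A g ->
  \int[mu]_(t in A) (f t - g t) = \int[mu]_(t in A) f t - \int[mu]_(t in A) g t.
Proof. by move=> mA If Ig; rewrite RintegralB. Qed.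

Lemma le_Rint A f g : meas A -> integ A f -> integ A g ->
  (forall t, A t -> f t <= g t) ->
  \int[mu]_(t in A) f t <= \int[mu]_(t in A) g t.
Proof. by move=> mA If Ig fg; exact: (le_Rintegral mA If Ig fg). Qed.

Lemma Rint_EFin A f : meas A -> integ A f ->
  (\int[mu]_(t in A) (f t)%:E = (\int[mu]_(t in A) f t)%:E)%E.
Proof. by move=> mA If; rewrite /Rintegral fineK//; exact: integrable_fin_num. Qed.

Lemma Rint_subset A B f : meas A -> meas B -> B `<=` A -> integ A f ->
  (forall t, A t -> 0 <= f t) -> \int[mu]_(t in B) f t <= \int[mu]_(t in A) f t.
Proof.
move=> mA mB BA If f0; have IfB := integS mA mB BA If.
rewrite -lee_fin -(Rint_EFin mB IfB) -(Rint_EFin mA If).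
apply: (ge0_subset_integral _ mB mA) => //.
by apply/measurable_EFinP; exact: integ_meas If.
Qed.

Lemma Rint_cst (a b c : R) : a <= b -> \int[mu]_(t in `[a, b]) c = c * (b - a).
Proof.
move=> ab; rewrite Rintegral_cst//= lebesgue_measure_itv/= lte_fin.
by move: ab; rewrite le_eqVlt => /predU1P[->|->] //=; rewrite ltxx subrr.
Qed.

Lemma ge0_integ A f : meas A -> measurable_fun A f ->
  (forall t, A t -> 0 <= f t) ->
  integ A f <-> (\int[mu]_(t in A) (f t)%:E < +oo)%E.
Proof.
move=> mA mf f0.
have E : (\int[mu]_(t in A) `|(f t)%:E| = \int[mu]_(t in A) (f t)%:E)%E.
  by apply: eq_integral => t /set_mem At; rewrite gee0_abs// lee_fin f0.
split=> [/integrableP[_]|fi]; first by rewrite E.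
by apply/integrableP; split; [exact/measurable_EFinP | rewrite E].
Qed.

Lemma ae_eq_Rint A f g : meas A -> measurable_fun A f -> measurable_fun A g ->
  {ae mu, forall t, A t -> f t = g t} ->
  \int[mu]_(t in A) f t = \int[mu]_(t in A) g t.
Proof.
move=> mA mf mg fg; congr fine; apply: ae_eq_integral => //; [exact/measurable_EFinP|exact/measurable_EFinP|].
case: fg => N [mN N0 sN]; exists N; split => // t /= nt; apply: sN.
by apply: contra_not nt => /= fg At; rewrite fg.
Qed.

End RealIntegrals.

Section EdgeIntegrals.
Context {R : realType}.
Local Notation mu := (@lebesgue_measure R).
Local Notation edge := (@edge R).
Implicit Types (f g w : R -> R).

Lemma measurable_edge : meas edge. Proof. exact: measurable_itv. Qed.
Hint Resolve measurable_edge : core.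

Lemma edgeE (t : R) : edge t = (0 <= t) :> Prop.
Proof. by rewrite /Defs.edge /= in_itv /= andbT. Qed.

Lemma edge_ge0 (t : R) : edge t -> 0 <= t. Proof. by rewrite edgeE. Qed.

Lemma itv_edge (a b : R) : 0 <= a -> `[a, b] `<=` edge.
Proof. by move=> a0 t /=; rewrite in_itv /= => /andP[at_ _]; rewrite edgeE; exact: le_trans at_. Qed.

(** The weight is the constant 1 for the norm of the space, and a part of the potential for the
    other terms of the form. *)
Definition L2 w f := measurable_fun edge f /\ integ edge (fun t => w t * f t ^+ 2).

Definition ip w f g := \int[mu]_(t in edge) (w t * (f t * g t)).
Definition sqnorm w f := ip w f f.

Definition weight w := measurable_fun edge w /\ forall t : R, 0 <= t -> 0 <= w t.

Lemma weight1 : weight (fun=> 1).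
Proof. by split=> //; exact: measurable_cst. Qed.

Lemma meas_wf2 w f : measurable_fun edge w -> measurable_fun edge f ->
  measurable_fun edge (fun t => w t * f t ^+ 2).
Proof. by move=> mw mf; apply: measurable_funM => //; exact: measurable_funX. Qed.

Lemma L2P w f : weight w -> measurable_fun edge f ->
  L2 w f <-> (\int[mu]_(t in edge) (w t * f t ^+ 2)%:E < +oo)%E.
Proof.
move=> [mw w0] mf.
have H : integ edge (fun t => w t * f t ^+ 2) <->
    (\int[mu]_(t in edge) (w t * f t ^+ 2)%:E < +oo)%E.
  apply: ge0_integ => //; first exact: meas_wf2.
  by move=> t /edge_ge0 t0; rewrite mulr_ge0 ?w0// sqr_ge0.
by split=> [[_ /H]|/H].
Qed.

Lemma L2_prod w f g : weight w -> L2 w f -> L2 w g ->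
  integ edge (fun t => w t * (f t * g t)).
Proof.
move=> [mw w0] [mf If] [mg Ig].
apply: integ_dom (integD measurable_edge If Ig) => //.
  apply: measurable_funM => //; exact: measurable_funM.
move=> t /edge_ge0 t0; have wt := w0 t t0.
rewrite normrM (ger0_norm wt) -mulrDr ler_wpM2l// ler_norml.
apply/andP; split; nra.
Qed.

Lemma L2_lin w a f g : weight w -> L2 w f -> L2 w g -> L2 w (fun t => a * f t + g t).
Proof.
move=> ww Lf Lg; have [mf If] := Lf; have [mg Ig] := Lg.
split; first by apply: measurable_funD => //; apply: measurable_funM.
have := integD measurable_edge (integD measurable_edge
  (integZ (a ^+ 2) measurable_edge If)
  (integZ (2 * a) measurable_edge (L2_prod ww Lf Lg))) Ig.
apply: eq_integ => // t _ /=; ring.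
Qed.

Lemma L2_0 w : L2 w (fun=> 0).
Proof.
split; first exact: measurable_cst.
by apply: eq_integ (integ0 edge) => // t _ /=; rewrite expr0n/= mulr0.
Qed.

Lemma L2_Z w a f : weight w -> L2 w f -> L2 w (fun t => a * f t).
Proof.
move=> ww Lf; have := L2_lin a ww Lf (L2_0 w).
by congr L2; apply/funext => t; rewrite addr0.
Qed.

Lemma L2_B w f g : weight w -> L2 w f -> L2 w g -> L2 w (fun t => f t - g t).
Proof.
move=> ww Lf Lg; have := L2_lin (-1) ww Lg Lf.
by congr L2; apply/funext => t; rewrite mulN1r addrC.
Qed.

Lemma ip_lin w a f g k : weight w -> L2 w f -> L2 w g -> L2 w k ->
  ip w (fun t => a * f t + g t) k = a * ip w f k + ip w g k.
Proof.
move=> ww Lf Lg Lk; have I1 := L2_prod ww Lf Lk; have I2 := L2_prod ww Lg Lk.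
rewrite /ip -RintZ// -RintD//; last exact: integZ.
by apply: eq_Rint => t _; ring.
Qed.

Lemma ipC w f g : ip w f g = ip w g f.
Proof. by apply: eq_Rint => t _; rewrite (mulrC (f t)). Qed.

Lemma nrm_ge0 w f : weight w -> 0 <= sqnorm w f.
Proof.
move=> [_ w0]; apply: Rintegral_ge0 => t /edge_ge0 t0.
by rewrite mulr_ge0 ?w0// -expr2 sqr_ge0.
Qed.

Lemma L2_dom w w' f : weight w -> weight w' ->
  (forall t, 0 <= t -> w' t <= w t) -> L2 w f -> L2 w' f.
Proof.
move=> [mw w0] [mw' w'0] w'w [mf If]; split=> //.
apply: integ_dom If => //; first exact: meas_wf2.
move=> t /edge_ge0 t0; rewrite normrM ger0_norm ?w'0// ger0_norm ?sqr_ge0//.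
by rewrite ler_wpM2r ?sqr_ge0// w'w.
Qed.

Lemma L2_itv g a b : L2 (fun=> 1) g -> 0 <= a -> integ `[a, b] g.
Proof.
move=> [mg Ig] a0; have ab := itv_edge (b := b) a0.
have mab : meas `[a, b] by exact: measurable_itv.
apply: integ_dom (integD mab (integ_cst a b 1) (integS measurable_edge mab ab Ig)) => //.
  exact: (measurable_funS measurable_edge ab mg).
move=> t _; rewrite mul1r ler_norml.
by have := sqr_ge0 (g t - 1); have := sqr_ge0 (g t + 1) => ? ?; apply/andP; split; nra.
Qed.

(** Cauchy-Schwarz against a constant: the integral of (g - c)^2 is nonnegative at the mean value
    c of [g]. *)
Lemma itv_int_sq g a b : L2 (fun=> 1) g -> 0 <= a -> a <= b ->
  (\int[mu]_(t in `[a, b]) g t) ^+ 2 <= (b - a) * sqnorm (fun=> 1) g.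
Proof.
move=> Lg a0; rewrite le_eqVlt => /predU1P[<-|ab].
  by rewrite subrr mul0r set_itv1 Rintegral_set1 expr0n.
have [mg Ig] := Lg; have mab : meas `[a, b] by exact: measurable_itv.
have sub := itv_edge (b := b) a0.
set I := \int[mu]_(t in _) _; pose L := b - a.
have L0 : 0 < L by rewrite subr_gt0.
pose c := I / L.
have Iab := L2_itv b Lg a0.
have I2ab := integS measurable_edge mab sub Ig.
have : 0 <= \int[mu]_(t in `[a, b]) (1 * g t ^+ 2 + (- 2 * c) * g t + c ^+ 2).
  by apply: Rintegral_ge0 => t _; have := sqr_ge0 (g t - c); nra.
have I3 := integZ (- 2 * c) mab Iab; have I4 := integD mab I2ab I3.
rewrite (RintD mab I4 (integ_cst a b (c ^+ 2))) (RintD mab I2ab I3).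
rewrite (RintZ _ mab Iab) (Rint_cst _ (ltW ab)) -/I -/L => h1.
have h2 : \int[mu]_(t in `[a, b]) (1 * g t ^+ 2) <= sqnorm (fun=> 1) g.
  apply: (Rint_subset measurable_edge mab sub Ig) => t _.
  by rewrite mul1r sqr_ge0.
rewrite -ler_pdivrMl//.
apply: le_trans h2.
have E : - 2 * c * I + c ^+ 2 * L = - (L^-1 * I ^+ 2).
  by rewrite /c; field; rewrite gt_eqF.
lra.
Qed.

End EdgeIntegrals.
#[global] Hint Resolve measurable_edge : core.

(** * Primitives of square integrable functions *)

Section Primitives.
Context {R : realType}.
Local Notation mu := (@lebesgue_measure R).
Local Notation edge := (@edge R).
Local Notation L2 := (L2 (fun=> 1)).
Local Notation sqnorm := (sqnorm (fun=> 1)).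
Implicit Types (f g : R -> R).

(** Membership in H^1 is expressed by this relation.  Nothing is said about [f] at negative
    arguments, where the functions on an edge have arbitrary values. *)
Definition primitive f g := forall t, 0 <= t ->
  f t = f 0 + \int[mu]_(x in `[0, t]) g x.

Lemma meas_itv (a b : R) : meas `[a, b]. Proof. exact: measurable_itv. Qed.

Lemma prim_sub f g a b : L2 g -> primitive f g -> 0 <= a -> a <= b ->
  f b - f a = \int[mu]_(x in `[a, b]) g x.
Proof.
move=> Lg fg a0 ab; rewrite (fg _ a0) (fg b (le_trans a0 ab)).
rewrite opprD addrACA subrr add0r.
have I0 : integ `[0, b] g by exact: L2_itv.
have B1 : (BLeft 0 <= BRight a)%O by rewrite bnd_simp.
have B2 : (BRight a <= BRight b)%O by rewrite bnd_simp.
rewrite (Rintegral_itvB I0 B1 B2) Rintegral_itv_obnd_cbnd//.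
apply: (integS (meas_itv 0 b)) I0; first exact: measurable_itv.
by move=> t /=; rewrite !in_itv/= => /andP[/ltW at_ ->]; rewrite (le_trans a0 at_).
Qed.

Lemma prim_holder f g a b : L2 g -> primitive f g -> 0 <= a -> a <= b ->
  (f b - f a) ^+ 2 <= (b - a) * sqnorm g.
Proof. by move=> Lg fg a0 ab; rewrite (prim_sub Lg fg)//; exact: itv_int_sq. Qed.

Lemma prim_holder_dist f g a b : L2 g -> primitive f g -> 0 <= a -> 0 <= b ->
  (f b - f a) ^+ 2 <= `|b - a| * sqnorm g.
Proof.
move=> Lg fg a0 b0; have [ab|/ltW ba] := leP a b.
  by rewrite ger0_norm ?subr_ge0//; exact: prim_holder.
by rewrite distrC -sqrrN opprB ger0_norm ?subr_ge0//; exact: prim_holder.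
Qed.

(** On [[t, t + 1]] the function differs from its value at [t] by at most the norm of the derivative. *)
Lemma prim_sup f g t : L2 f -> L2 g -> primitive f g -> 0 <= t ->
  f t ^+ 2 <= 2 * sqnorm f + 2 * sqnorm g.
Proof.
move=> Lf Lg fg t0; have [mf If] := Lf.
have t1 : t <= t + 1 by rewrite lerDl.
have sub := itv_edge (b := t + 1) t0.
have mI := meas_itv t (t + 1).
have IfI := integS measurable_edge mI sub If.
have := @le_Rint _ _ (fun=> f t ^+ 2) (fun x => 2 * (1 * f x ^+ 2) + 2 * sqnorm g)
  mI (integ_cst _ _ _) (integD mI (integZ 2 mI IfI) (integ_cst _ _ _)).
rewrite (RintD mI (integZ 2 mI IfI) (integ_cst _ _ _)) (RintZ _ mI IfI) !Rint_cst//.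
rewrite addrAC subrr add0r !mulr1.
have := Rint_subset measurable_edge mI sub If.
rewrite -/(sqnorm f) => le1 le2.
have {}le2 : f t ^+ 2 <= 2 * \int[mu]_(x in `[t, t + 1]) (1 * f x ^+ 2) + 2 * sqnorm g.
  apply: le2 => x /=; rewrite in_itv /= => /andP[tx xt].
  have := prim_holder Lg fg t0 tx; have := nrm_ge0 g weight1.
  have := sqr_ge0 (2 * f x - f t).
  set G := sqnorm g => h1 h2 h3.
  have : (x - t) * G <= G by rewrite ler_piMl//; lra.
  nra.
have {}le1 : \int[mu]_(x in `[t, t + 1]) (1 * f x ^+ 2) <= sqnorm f.
  by apply: le1 => x _; rewrite mul1r sqr_ge0.
lra.
Qed.

Lemma max0_dist_le (x y : R) : `|Num.max 0 x - Num.max 0 y| <= `|x - y|.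
Proof.
rewrite /Num.max; case: ifPn; case: ifPn; rewrite -?leNgt => ? ?.
- by [].
- by rewrite ler_norml; apply/andP; split; have := ler_norm (x - y);
    rewrite distrC; have := ler_norm (y - x); lra.
- by rewrite ler_norml; apply/andP; split; have := ler_norm (x - y);
    rewrite distrC; have := ler_norm (y - x); lra.
- by rewrite subrr normr0.
Qed.

(** The extension by the value at 0 turns continuity within the edge into continuity on the line. *)
Lemma prim_ext_continuous f g : L2 g -> primitive f g ->
  continuous (fun t : R => f (Num.max 0 t)).
Proof.
move=> Lg fg x; apply/cvgrPdist_lt => e e0.
have G0 : 0 <= sqnorm g := nrm_ge0 g weight1.
have d0 : 0 < e ^+ 2 / (sqnorm g + 1) by rewrite divr_gt0 ?exprn_gt0//; lra.
near=> y.
have xy : `|x - y| < e ^+ 2 / (sqnorm g + 1).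
  by near: y; apply/nbhs_ballP; exists (e ^+ 2 / (sqnorm g + 1)).
have m0 (z : R) : 0 <= Num.max 0 z by rewrite le_max lexx.
have := prim_holder_dist Lg fg (m0 y) (m0 x).
have := max0_dist_le x y.
set D := Num.max 0 x - _ => D1 D2.
have : (f (Num.max 0 x) - f (Num.max 0 y)) ^+ 2 < e ^+ 2.
  apply: le_lt_trans D2 _.
  apply: (@le_lt_trans _ _ (`|x - y| * (sqnorm g + 1))).
    apply: ler_pM => //; lra.
  by rewrite -ltr_pdivlMr//; lra.
by move=> ?; rewrite ltr_norml; apply/andP; split; nra.
Unshelve. all: by end_near. Qed.

Lemma prim_continuous f g : L2 g -> primitive f g -> {within edge, continuous f}.
Proof.
move=> Lg fg; have := prim_ext_continuous Lg fg.
move=> /(@continuous_subspaceT _ _ edge); apply: subspace_eq_continuous.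
move=> t /set_mem /edge_ge0 t0; congr f.
by apply/max_idPr.
Qed.

Lemma prim_lin a f g f' g' : L2 g -> L2 g' -> primitive f g -> primitive f' g' ->
  primitive (fun t => a * f t + f' t) (fun t => a * g t + g' t).
Proof.
move=> Lg Lg' fg fg' t t0.
have I := L2_itv t Lg (lexx 0); have I' := L2_itv t Lg' (lexx 0).
have m := meas_itv 0 t.
rewrite RintD//; last exact: integZ.
by rewrite RintZ// (fg _ t0) (fg' _ t0); ring.
Qed.

Lemma ae_imply (P Q : R -> Prop) : (forall t, P t -> Q t) ->
  {ae mu, forall t, P t} -> {ae mu, forall t, Q t}.
Proof.
move=> PQ [N [mN N0 sN]]; exists N; split => // t /= nQ; apply: sN.
by move=> /= /PQ.
Qed.

Lemma ae_and (P Q : R -> Prop) :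
  {ae mu, forall t, P t} -> {ae mu, forall t, Q t} -> {ae mu, forall t, P t /\ Q t}.
Proof.
exact: (@filterI _ _ (ae_filter_ringOfSetsType mu)).
Qed.

Lemma ae_neq (a : R) : {ae mu, forall t, t != a}.
Proof.
exists [set a]; split; [exact: measurable_set1|exact: lebesgue_measure_set1|].
by move=> t /= /negP; rewrite negbK => /eqP.
Qed.

(** Lebesgue differentiation of the integral of [d], extended by 0 to the line. *)
Lemma int0_ae0 d : L2 d -> (forall t, 0 <= t -> \int[mu]_(x in `[0, t]) d x = 0) ->
  {ae mu, forall t, edge t -> d t = 0}.
Proof.
move=> Ld d0; have [md Id] := Ld.
pose D := d \_ edge.
have DE t : edge t -> D t = d t by move=> et; rewrite /D patchE mem_set.
have mD : measurable_fun setT D.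
  by apply/(measurable_restrictT _ measurable_edge).
have ID (K : set R) : compact K -> integ K D.
  move=> cK; have mK : meas K by exact: compact_measurable.
  have [M [_ MK]] := compact_bounded cK.
  have KM : K `<=` `[- (`|M| + 1), `|M| + 1].
    move=> t Kt /=; rewrite in_itv /= -ler_norml; apply: MK => //.
    by rewrite (le_lt_trans (ler_norm M))// ltrDl.
  have I1 := integS (meas_itv _ _) mK KM (integ_cst _ _ 1).
  have I2 : integ K (fun t => (D t) ^+ 2).
    have : integ setT (fun t => (D t) ^+ 2).
      have -> : (fun t => (D t) ^+ 2) = (fun t => 1 * d t ^+ 2) \_ edge.
        apply/funext => t; rewrite /D !patchE; case: ifP => _; first by rewrite mul1r.
        by rewrite expr0n.
      by rewrite /integ -restrict_EFin; apply/(integrable_mkcond _ measurable_edge).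
    by apply: integS => //; exact: measurableT.
  apply: integ_dom (integD mK I1 I2) => //.
    by apply: measurable_funS mD.
  by move=> t _; rewrite ler_norml; have := sqr_ge0 (D t - 1);
    have := sqr_ge0 (D t + 1) => ? ?; apply/andP; split; nra.
have locD : locally_integrable setT D.
  split => //; first exact: openT.
  move=> K _ cK; have [_] := integrableP _ _ _ (ID K cK).
  by [].
have := @FTC1 _ D (BLeft 0) (fun y => ID _ (@segment_compact _ 0 y)) locD.
move=> H; have := ae_and H (ae_neq 0).
apply: ae_imply => t [Ft t0] /[dup] et /edge_ge0 t0'.
have tp : 0 < t by rewrite lt_neqAle eq_sym t0.
have [|_] := Ft; first by rewrite /= lte_fin.
rewrite DE// => <-.
rewrite derive1E; have -> : 'D_1 (fun x : R => \int[mu]_(s in `[0, x]) D s) t =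
    'D_1 (fun x : R => 0) t.
  apply: near_eq_derive.
  near=> y; have y0 : 0 <= y.
    by near: y; apply: filterS (lt_nbhsr tp) => y /ltW.
  rewrite -[RHS](d0 y y0); apply: eq_Rint => s /=; rewrite in_itv /= => /andP[s0 _].
  by rewrite DE// edgeE.
by rewrite derive_cst.
Unshelve. all: by end_near. Qed.

Lemma prim_unique f g g' : L2 g -> L2 g' -> primitive f g -> primitive f g' ->
  {ae mu, forall t, edge t -> g t = g' t}.
Proof.
move=> Lg Lg' fg fg'; have := @int0_ae0 (fun t => g t - g' t).
have Ld := L2_B weight1 Lg Lg'.
move=> /(_ Ld) H; have {H}/ae_imply : {ae mu, forall t, edge t -> g t - g' t = 0}.
  apply: H => t t0; have I := L2_itv t Lg (lexx 0); have I' := L2_itv t Lg' (lexx 0).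
  rewrite (RintB (meas_itv 0 t) I I').
  by have := fg _ t0; rewrite (fg' _ t0) => /addrI ->; rewrite subrr.
by apply => t + et => /(_ et)/eqP; rewrite subr_eq0 => /eqP.
Qed.

End Primitives.

(** * Translations and reflections of the line *)

Section ChangeOfVariables.
Context {R : realType}.
Local Notation mu := (@lebesgue_measure R).
Local Notation edge := (@edge R).
Implicit Types (f g : R -> R) (A : set R).

Definition measure_preserving (phi : R -> R) :=
  measurable_fun setT (phi : measurableTypeR R -> measurableTypeR R) /\
  forall A, meas A -> mu (phi @^-1` A) = mu A.

Lemma mpres_shift (c : R) : measure_preserving (fun t => t + c).
Proof.
have mphi : measurable_fun setT ((fun t => t + c) : measurableTypeR R -> measurableTypeR R).
  by apply: measurable_funD.
split=> // A mA.
apply/esym; apply: (@lebesgue_measure_unique _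
  (pushforward mu (fun t : measurableTypeR R => (t + c : measurableTypeR R)))) => // _ [[a b]] _ <-.
transitivity (mu (`]a - c, b - c]%classic : set R)); last first.
  rewrite /pushforward; congr (mu _).
  by apply/seteqP; split => t /=; rewrite !in_itv /= ltrBlDr lerBrDr.
rewrite !lebesgue_measure_itv/= !lte_fin ltrD2r.
by case: ifP => // _; rewrite -!EFinB; congr EFin; ring.
Qed.

Lemma mpres_comp phi psi : measure_preserving phi -> measure_preserving psi ->
  measure_preserving (phi \o psi).
Proof.
move=> [mphi Ephi] [mpsi Epsi]; split; first exact: measurableT_comp.
move=> A mA; rewrite -(Ephi A mA) -[RHS]Epsi//.
by rewrite -[X in meas X]setTI; exact: mphi.
Qed.

Lemma mpres_reflect (c : R) : measure_preserving (fun t => c - t).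
Proof.
have -> : (fun t => c - t) = (fun t => t + c) \o -%R by apply/funext => t /=; rewrite addrC.
apply: mpres_comp; first exact: mpres_shift.
by split; [exact: oppr_measurable | move=> A mA; exact: lebesgue_measureN].
Qed.

Lemma mpres_integral phi A (f : R -> \bar R) : measure_preserving phi -> meas A ->
  measurable_fun (A : set (measurableTypeR R)) f ->
  (forall t, A t -> 0 <= f t)%E ->
  (\int[mu]_(t in phi @^-1` A) f (phi t) = \int[mu]_(t in A) f t)%E.
Proof.
move=> [mphi E] mA mf f0.
rewrite -(@ge0_integral_pushforward _ _ _ _ _ _ mphi mu A f mA mf); last first.
  by move=> t /set_mem; exact: f0.
apply: eq_measure_integral => B mB _.
by rewrite /pushforward -[RHS](E _ mB).
Qed.

Lemma mpres_meas phi A f : measure_preserving phi -> meas A -> measurable_fun A f ->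
  measurable_fun (phi @^-1` A) (f \o phi).
Proof.
move=> hphi mA mf; apply: (measurable_comp mA) => //.
- by move=> _ [t At <-].
- by apply: measurable_funS hphi.1.
Qed.

Lemma mpres_integ phi A f : measure_preserving phi -> meas A -> integ A f ->
  integ (phi @^-1` A) (fun t => f (phi t)).
Proof.
move=> hphi mA If; have mf := integ_meas If.
apply/integrableP; split.
  by apply/measurable_EFinP; exact: mpres_meas.
have /integrableP[_] := If.
rewrite -(mpres_integral hphi mA (f := fun t => `|(f t)%:E|%E))//.
by apply/measurable_EFinP; apply: measurableT_comp.
Qed.

Lemma mpres_Rint phi A f : measure_preserving phi -> meas A -> measurable_fun A f ->
  \int[mu]_(t in phi @^-1` A) f (phi t) = \int[mu]_(t in A) f t.
Proof.
move=> hphi mA mf; rewrite /Rintegral; congr fine.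
rewrite integralE [in RHS]integralE.
have mF : measurable_fun (A : set (measurableTypeR R)) (EFin \o f) by exact/measurable_EFinP.
rewrite -(mpres_integral hphi mA (measurable_funepos mF)); last by move=> t _; exact: funepos_ge0.
rewrite -(mpres_integral hphi mA (measurable_funeneg mF)); last by move=> t _; exact: funeneg_ge0.
by congr (_ - _)%E; apply: eq_integral => t _; rewrite ?funeposE ?funenegE.
Qed.

End ChangeOfVariables.

(** * Weak derivatives and primitives *)

Section WeakDerivatives.
Context {R : realType}.
Local Notation mu := (@lebesgue_measure R).
Local Notation edge := (@edge R).
Local Notation L2 := (L2 (fun=> 1)).
Local Notation sqnorm := (sqnorm (fun=> 1)).
Implicit Types (f g h phi : R -> R) (A B : set R).

Definition real_weak_derivative f g := forall phi, test_function phi ->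
  \int[mu]_(t in edge) (f t * (derive1 phi t)) =
  - \int[mu]_(t in edge) (g t * phi t).

Lemma norm_le_sqr (x r : R) : 0 <= r -> (`|x| <= r) = (x ^+ 2 <= r ^+ 2).
Proof.
by move=> r0; rewrite -[in RHS](real_normK (num_real x)) ler_pXn2r// nnegrE.
Qed.

Lemma Rint_split (a b c : R) f : a <= b -> b <= c -> integ `[a, c] f ->
  \int[mu]_(t in `[a, c]) f t =
  \int[mu]_(t in `[a, b]) f t + \int[mu]_(t in `[b, c]) f t.
Proof.
move=> ab bc If.
have B1 : (BLeft a <= BRight b)%O by rewrite bnd_simp.
have B2 : (BRight b <= BRight c)%O by rewrite bnd_simp.
have := Rintegral_itvB If B1 B2; rewrite Rintegral_itv_obnd_cbnd => [<-|].
  by rewrite addrC subrK.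
apply: (integS (meas_itv a c)) If; first exact: measurable_itv.
by move=> t /=; rewrite !in_itv/= => /andP[/ltW bt ->]; rewrite (le_trans ab bt).
Qed.

Lemma Rint_vanish A B f : B `<=` A -> (forall t, A t -> ~ B t -> f t = 0) ->
  \int[mu]_(t in A) f t = \int[mu]_(t in B) f t.
Proof.
move=> BA f0; rewrite -[in RHS](setIidr BA) Rintegral_mkcondr.
apply: eq_Rint => t At; rewrite patchE; case: ifPn => // /negP Bt.
by apply: f0 => // /mem_set.
Qed.

Lemma integ_vanish A B f : meas A -> meas B -> B `<=` A ->
  (forall t, A t -> ~ B t -> f t = 0) -> integ B f -> integ A f.
Proof.
move=> mA mB BA f0 IB; apply/(integrable_mkcond _ mA).
move/(integrable_mkcond _ mB): IB; apply: eq_integrable; first exact: measurableT.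
move=> t _; rewrite /patch; case: ifPn => Bt; case: ifPn => At //.
  by move/negP: At => []; apply/mem_set/BA/set_mem.
rewrite /= f0//; first exact: set_mem.
by move/negP: Bt => + /mem_set.
Qed.

Lemma integ_bddM A h g M : meas A -> measurable_fun A h ->
  (forall t, A t -> `|h t| <= M) -> integ A g -> integ A (fun t => h t * g t).
Proof.
move=> mA mh hM Ig.
apply: integ_dom (integZ M mA (integrable_norm Ig)) => //.
  by apply: measurable_funM => //; exact: integ_meas.
by move=> t At; rewrite normrM ler_wpM2r// hM.
Qed.

Lemma cont_integ (a b : R) h : continuous h -> integ `[a, b] h.
Proof.
move=> ch; apply: continuous_compact_integrable; first exact: segment_compact.
exact: continuous_subspaceT.
Qed.

Lemma cont_bounded (a b : R) h : continuous h ->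
  exists2 M, 0 <= M & forall t, a <= t <= b -> `|h t| <= M.
Proof.
move=> ch.
have /compact_bounded[M [_ MP]] : compact (h @` `[a, b]).
  apply: continuous_compact; last exact: segment_compact.
  exact: continuous_subspaceT.
exists (`|M| + 1) => [|t tab]; first by rewrite addr_ge0.
apply: (MP (`|M| + 1)); first by rewrite (le_lt_trans (ler_norm M))// ltrDl.
by exists t.
Qed.

Lemma cont_meas A h : continuous h -> measurable_fun A h.
Proof.
move=> ch; apply: (measurable_funS (E := setT)) => //.
exact: continuous_measurable_fun.
Qed.

Lemma FTC (a b : R) phi : (forall t, derivable phi t 1) -> continuous (derive1 phi) ->
  a <= b -> \int[mu]_(t in `[a, b]) derive1 phi t = phi b - phi a.
Proof.
move=> dphi cphi; rewrite le_eqVlt => /predU1P[->|ab].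
  by rewrite set_itv1 Rintegral_set1 subrr.
have c1 : continuous phi.
  by move=> t; apply/differentiable_continuous/derivable1_diffP.
have cd : {within `[a, b], continuous (derive1 phi)} by exact: continuous_subspaceT.
have LR : derivable_oo_LRcontinuous phi a b.
  by split=> [t _||];
      [exact: dphi|apply: cvg_at_right_filter; exact: c1|apply: cvg_at_left_filter; exact: c1].
have E : {in `]a, b[, derive1 phi =1 derive1 phi} by move=> t.
by have := continuous_FTC2 ab cd LR E; rewrite /Rintegral => ->.
Qed.

Lemma test_derive0 phi (a b : R) : (forall t, t \notin `[a, b] -> phi t = 0) ->
  forall t, t \notin `[a, b] -> derive1 phi t = 0.
Proof.
move=> phi0 t tab; rewrite derive1E.
have -> : 'D_1 phi t = 'D_1 (fun=> 0 : R) t.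
  apply: near_eq_derive.
  have oU : open (~` (`[a, b]%classic : set R)) by rewrite openC; exact: itv_closed.
  have tU : (~` (`[a, b]%classic : set R)) t by move=> /= tI; rewrite tI in tab.
  have : nbhs t (~` (`[a, b]%classic : set R)) by apply: open_nbhs_nbhs.
  by apply: filterS => y /negP; exact: phi0.
by rewrite derive_cst.
Qed.

(** Increments of order greater than 1 add up to nothing: cut [[0, B]] into n + 1 equal steps and
    let n grow. *)
Lemma superlinear_constant (K : R -> R) (B C : R) : 0 <= B -> 0 <= C ->
  (forall x y, 0 <= x -> x <= y -> y <= B -> (K y - K x) ^+ 2 <= C * (y - x) ^+ 3) ->
  K B = K 0.
Proof.
move=> B0 C0 KC; apply/eqP; rewrite -subr_eq0 -sqrf_eq0 eq_le sqr_ge0 andbT.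
have key n : (K B - K 0) ^+ 2 * n.+1%:R <= C * B ^+ 3.
  pose h := B / n.+1%:R; have h0 : 0 <= h by rewrite divr_ge0.
  pose e := Num.sqrt (C * h ^+ 3).
  have e2 : e ^+ 2 = C * h ^+ 3 by rewrite sqr_sqrtr// mulr_ge0// exprn_ge0.
  have e0 : 0 <= e by exact: sqrtr_ge0.
  have hB : h * n.+1%:R = B by rewrite divfK.
  have step i : (i <= n.+1)%N -> `|K (h * i%:R) - K 0| <= i%:R * e.
    elim: i => [_|i IH lei]; first by rewrite mulr0 subrr normr0 mul0r.
    have := IH (ltnW lei).
    have : `|K (h * i.+1%:R) - K (h * i%:R)| <= e.
      have := KC (h * i%:R) (h * i.+1%:R).
      have -> : h * i.+1%:R - h * i%:R = h by rewrite -mulrBr -natrB// subSnn mulr1.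
      rewrite -e2 => le2; have {}le2 : (K (h * i.+1%:R) - K (h * i%:R)) ^+ 2 <= e ^+ 2.
        apply: le2; first by rewrite mulr_ge0.
          by rewrite ler_wpM2l// ler_nat.
        by rewrite -hB ler_wpM2l// ler_nat.
      by rewrite norm_le_sqr.
    rewrite -[i.+1]addn1 natrD mulrDl mul1r => h1 h2.
    have -> : K (h * (i%:R + 1)) - K 0 =
      (K (h * i%:R) - K 0) + (K (h * (i%:R + 1)) - K (h * i%:R)) by ring.
    exact: le_trans (ler_normD _ _) (lerD h2 h1).
  have := step _ (leqnn _); rewrite hB => le1.
  have : (K B - K 0) ^+ 2 <= (n.+1%:R * e) ^+ 2.
    by rewrite -norm_le_sqr// mulr_ge0.
  rewrite exprMn e2 => le2.
  have -> : C * B ^+ 3 = n.+1%:R ^+ 2 * (C * h ^+ 3) * n.+1%:R by rewrite -hB; ring.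
  by rewrite ler_wpM2r.
rewrite leNgt; apply/negP => d0.
have [n nd] : exists n : nat, C * B ^+ 3 / (K B - K 0) ^+ 2 < n%:R.
  exists (Num.bound (C * B ^+ 3 / (K B - K 0) ^+ 2)).
  by rewrite archi_boundP// divr_ge0 ?sqr_ge0// mulr_ge0// exprn_ge0.
have := key n; rewrite mulrC -ler_pdivlMr// => /le_lt_trans/(_ nd).
by rewrite ltr_nat ltnNge leqnSn.
Qed.

(** Integration by parts, although [f] is differentiable only almost everywhere.  The function K x
    given by the integral of f phi' + g phi over [[0, x]] minus f x * phi x has increments of
    order 3/2, because [f] is Holder continuous of order 1/2 and phi is Lipschitz.  So K is
    constant, and phi vanishes at 0 and far away. *)
Lemma prim_rweak f g : L2 g -> primitive f g -> real_weak_derivative f g.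
Proof.
move=> Lg fg phi [dphi cphi' [a [b [a0 phi0]]]].
have phi'0 := test_derive0 phi0.
have cphi : continuous phi.
  by move=> t; apply/differentiable_continuous/derivable1_diffP.
pose B := `|b| + 1; have B0 : 0 < B by rewrite ltr_pwDr.
have bB : b < B by rewrite (le_lt_trans (ler_norm b))// ltrDl.
have out t : t <= 0 \/ B <= t -> t \notin `[a, b].
  rewrite in_itv /= => -[t0|Bt]; apply/negP => /andP[h1 h2].
  - by have := lt_le_trans a0 (le_trans h1 t0); rewrite ltxx.
  - by have := lt_le_trans bB (le_trans Bt h2); rewrite ltxx.
have [L L0 LP] := cont_bounded 0 B cphi'.
have [M M0 MP] := cont_bounded 0 B cphi.
have cf := prim_ext_continuous Lg fg.
have [F F0 FP] := cont_bounded 0 B cf.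
have fext t : 0 <= t -> f t = f (Num.max 0 t) by move=> t0; rewrite (max_idPr t0).
have mB := meas_itv 0 B.
have Ig := L2_itv B Lg (lexx 0).
have I1 : integ `[0, B] (fun t => f t * derive1 phi t).
  have : integ `[0, B] (fun t => f (Num.max 0 t) * derive1 phi t).
    apply: (@integ_bddM _ _ _ F) => //; last exact: cont_integ.
    exact: cont_meas.
  apply: eq_integ => // t /=; rewrite in_itv /= => /andP[t0 _].
  by rewrite -fext.
have I2 : integ `[0, B] (fun t => g t * phi t).
  have : integ `[0, B] (fun t => phi t * g t).
    apply: (@integ_bddM _ _ _ M) => //; first exact: cont_meas.
  by apply: eq_integ => // t _; rewrite mulrC.
have I12 := integD mB I1 I2.
have subE : `[0, B] `<=` edge := itv_edge (lexx 0).
have outI t : edge t -> ~ `[0, B]%classic t -> t \notin `[a, b].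
  move=> /edge_ge0 t0 /negP; rewrite in_itv /= t0 /= -ltNge => /ltW Bt.
  by apply: out; right.
rewrite (Rint_vanish subE); last by move=> t et nt; rewrite phi'0 ?mulr0// outI.
rewrite [in RHS](Rint_vanish subE); last by move=> t et nt; rewrite phi0 ?mulr0// outI.
apply/eqP; rewrite -addr_eq0 -RintD//; apply/eqP.
pose K x := \int[mu]_(t in `[0, x]) (f t * derive1 phi t + g t * phi t) - f x * phi x.
pose G := sqnorm g; have G0 : 0 <= G := nrm_ge0 g weight1.
suff : K B = K 0.
  rewrite /K set_itv1 Rintegral_set1 (phi0 B) ?(phi0 0) ?mulr0 ?subr0//.
  - by apply: out; left.
  - by apply: out; right.
apply: (@superlinear_constant _ _ (4 * L ^+ 2 * G)); first exact: ltW.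
  by rewrite mulr_ge0// mulr_ge0// sqr_ge0.
move=> x y x0 xy yB; have y0 := le_trans x0 xy.
have mxy := meas_itv x y.
have sub1 : `[x, y] `<=` `[0, B].
  move=> t /=; rewrite !in_itv /= => /andP[xt ty].
  by rewrite (le_trans x0 xt) (le_trans ty yB).
have sub2 : `[0, y] `<=` `[0, B].
  by move=> t /=; rewrite !in_itv /= => /andP[-> ty]; rewrite (le_trans ty yB).
have J1 := integS mB mxy sub1 I1; have J2 := integS mB mxy sub1 I2.
have Jg := integS mB mxy sub1 Ig.
have Jd : integ `[x, y] (derive1 phi) by exact: cont_integ.
have dphiE : \int[mu]_(t in `[x, y]) derive1 phi t = phi y - phi x by exact: FTC.
have dfE := prim_sub Lg fg x0 xy.
have J3 := integB mxy J1 (integZ (f y) mxy Jd).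
have J4 := integB mxy J2 (integZ (phi x) mxy Jg).
have KE : K y - K x =
    \int[mu]_(t in `[x, y]) (f t * derive1 phi t - f y * derive1 phi t) +
    \int[mu]_(t in `[x, y]) (g t * phi t - phi x * g t).
  rewrite /K (Rint_split x0 xy); last exact: integS mB (meas_itv 0 y) sub2 I12.
  rewrite (RintB mxy J1 (integZ (f y) mxy Jd)) (RintB mxy J2 (integZ (phi x) mxy Jg)).
  rewrite (RintD mxy J1 J2) !RintZ// dphiE -dfE; ring.
pose r := Num.sqrt ((y - x) * G).
have r2 : r ^+ 2 = (y - x) * G by rewrite sqr_sqrtr// mulr_ge0// subr_ge0.
have r0 : 0 <= r by exact: sqrtr_ge0.
have D1 : `|\int[mu]_(t in `[x, y]) (f t * derive1 phi t - f y * derive1 phi t)|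
    <= r * L * (y - x).
  rewrite (le_trans (le_normr_Rintegral mxy J3))// -Rint_cst//.
  apply: le_Rint => //; [exact: integrable_norm J3|exact: integ_cst|].
  move=> t tI; have /= := sub1 _ tI; rewrite in_itv => /= tB.
  move: tI; rewrite /= in_itv /= => /andP[xt ty].
  rewrite -mulrBl normrM ler_pM// ?LP//.
  have := prim_holder Lg fg (le_trans x0 xt) ty; rewrite -/G => h1.
  have : (f y - f t) ^+ 2 <= r ^+ 2.
    by rewrite r2 (le_trans h1)// ler_wpM2r// lerD2l lerN2.
  by rewrite distrC norm_le_sqr.
have D2 : `|\int[mu]_(t in `[x, y]) (g t * phi t - phi x * g t)| <= L * (y - x) * r.
  rewrite (le_trans (le_normr_Rintegral mxy J4))//.
  apply: (@le_trans _ _ (\int[mu]_(t in `[x, y]) (L * (y - x) * `|g t|))).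
    apply: le_Rint => //; [exact: integrable_norm J4|exact: integZ (integrable_norm Jg)|].
    move=> t; rewrite /= in_itv /= => /andP[xt ty].
    rewrite mulrC -mulrBl normrM ler_wpM2r//.
    have <- : \int[mu]_(s in `[x, t]) derive1 phi s = phi t - phi x by exact: FTC.
    have mxt := meas_itv x t; have Jt := cont_integ x t cphi'.
    rewrite (le_trans (le_normr_Rintegral mxt Jt))//.
    apply: (@le_trans _ _ (L * (t - x))); last by rewrite ler_wpM2l// lerD2r.
    rewrite -Rint_cst//; apply: le_Rint => //; [exact: integrable_norm Jt|exact: integ_cst|].
    move=> s; rewrite /= in_itv /= => /andP[xs st]; apply: LP.
    by rewrite (le_trans x0 xs) (le_trans st (le_trans ty yB)).
  rewrite RintZ//; last exact: integrable_norm Jg.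
  rewrite ler_wpM2l//; first by rewrite mulr_ge0// subr_ge0.
  have Lng : L2 (fun t => `|g t|).
    have [mg Igg] := Lg; split; first exact: measurableT_comp.
    by apply: eq_integ Igg => // t _; rewrite real_normK ?num_real.
  have := itv_int_sq Lng x0 xy.
  have -> : sqnorm (fun t => `|g t|) = G.
    by apply: eq_Rint => t _; rewrite -!expr2 real_normK ?num_real.
  rewrite -r2; set I := \int[mu]_(t in _) _ => h1.
  have I0 : 0 <= I by apply: Rintegral_ge0.
  by rewrite -(ger0_norm I0) norm_le_sqr.
have {D1 D2} : `|K y - K x| <= 2 * L * (y - x) * r.
  rewrite KE (le_trans (ler_normD _ _))// (le_trans (lerD D1 D2))//.
  by rewrite le_eqVlt; apply/orP; left; apply/eqP; ring.
have h0 : 0 <= y - x by rewrite subr_ge0.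
have -> : 4 * L ^+ 2 * G * (y - x) ^+ 3 = (2 * L * (y - x) * r) ^+ 2.
  by rewrite exprMn r2; ring.
have : 0 <= 2 * L * (y - x) * r by rewrite !mulr_ge0.
by move=> h1; rewrite norm_le_sqr.
Qed.

End WeakDerivatives.

Section WeakToPrimitive.
Context {R : realType}.
Local Notation mu := (@lebesgue_measure R).
Local Notation edge := (@edge R).
Local Notation L2 := (L2 (fun=> 1)).
Local Notation sqnorm := (sqnorm (fun=> 1)).
Implicit Types (f g h k phi : R -> R) (A B : set R).

Lemma within_edge_delta k : {within edge, continuous k} -> forall x, 0 <= x ->
  forall e, 0 < e -> exists2 d, 0 < d &
    forall y, 0 <= y -> `|x - y| < d -> `|k x - k y| < e.
Proof.
move=> /continuous_within_itvcyP[ck k0] x; rewrite le_eqVlt => /predU1P[<-|x0] e e0.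
  move/cvgrPdist_lt : k0 => /(_ e e0).
  rewrite near_withinE => /nbhs_ballP[d /= d0 dP].
  exists d => // y y0 yd; have [->|y1] := eqVneq y 0; first by rewrite subrr normr0.
  by apply: dP => //; rewrite lt_neqAle eq_sym y1.
have /cvgrPdist_lt/(_ e e0) : {for x, continuous k}.
  by apply: ck; rewrite in_itv /= x0.
by move=> /nbhs_ballP[d /= d0 dP]; exists d => // y _; exact: dP.
Qed.

(** A continuous bump of width [d] around [c].  Tents of equal width have equal mass, so the
    primitive of the difference of two tents is a test function. *)
Definition tent (d c x : R) : R := Num.max 0 (d - `|x - c|).

Lemma tent_continuous d c : continuous (tent d c).
Proof.
move=> x; rewrite (_ : tent d c = (fun=> 0 : R^o) \max (fun x => d - `|x - c| : R^o))//.
apply: continuous_max; first exact: cvg_cst.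
apply: cvgB; first exact: cvg_cst.
by apply: cvg_norm; apply: cvgB => //; exact: cvg_cst.
Qed.

Lemma tent_ge0 d c x : 0 <= tent d c x.
Proof. by rewrite le_max lexx. Qed.

Lemma tent_out d c x : x \notin `[c - d, c + d] -> tent d c x = 0.
Proof.
rewrite in_itv /= => xI; apply/max_idPl; rewrite subr_le0 leNgt.
by apply: contra xI; rewrite ltr_norml => /andP[? ?]; apply/andP; split; lra.
Qed.

Definition tent_mass (d : R) : R := \int[mu]_(x in `[- d, d]) tent d 0 x.

Lemma tent_mass_gt0 d : 0 < d -> 0 < tent_mass d.
Proof.
move=> d0; have d2 : - (d / 2) <= d / 2 by lra.
apply: (@lt_le_trans _ _ (\int[mu]_(x in `[- (d / 2), d / 2]) tent d 0 x)); last first.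
  apply: Rint_subset; [exact: meas_itv|exact: meas_itv| |exact: cont_integ (@tent_continuous _ _)|].
    by move=> x /=; rewrite !in_itv /= => /andP[? ?]; apply/andP; split; lra.
  by move=> x _; exact: tent_ge0.
apply: (@lt_le_trans _ _ (\int[mu]_(x in `[- (d / 2), d / 2]) (d / 2))).
  by rewrite Rint_cst// mulr_gt0 ?divr_gt0//; lra.
apply: le_Rint; [exact: meas_itv|exact: integ_cst|exact: cont_integ (@tent_continuous _ _)|].
move=> x /=; rewrite in_itv /= -ler_norml => xd.
by rewrite le_max subr0; apply/orP; right; lra.
Qed.

Lemma tent_massE d c : \int[mu]_(x in `[c - d, c + d]) tent d c x = tent_mass d.
Proof.
rewrite /tent_mass -[RHS](mpres_Rint (mpres_shift (- c)) (meas_itv _ _)); last first.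
  exact: cont_meas (@tent_continuous _ _).
set A := _ @^-1` _; have -> : A = (`[c - d, c + d]%classic : set R).
  by apply/seteqP; split => x; rewrite /A /= !in_itv /= => /andP[? ?];
    apply/andP; split; lra.
by apply: eq_Rint => x _; rewrite /tent subr0.
Qed.

Lemma tent_integ A d c : meas A -> `[c - d, c + d] `<=` A -> integ A (tent d c).
Proof.
move=> mA sub; apply: (integ_vanish mA (meas_itv _ _) sub).
  by move=> t _ /negP; exact: tent_out.
exact: cont_integ (@tent_continuous _ _).
Qed.

Lemma tent_int A d c : `[c - d, c + d] `<=` A ->
  \int[mu]_(x in A) tent d c x = tent_mass d.
Proof.
move=> sub; rewrite (Rint_vanish sub) ?tent_massE//.
by move=> t _ /negP; exact: tent_out.
Qed.

Definition tent_diff d s t x := tent d s x - tent d t x.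

Lemma tent_test d s t : 0 < d -> d < s -> s + d < t -> exists phi,
  test_function phi /\ forall x, derive1 phi x = tent_diff d s t x.
Proof.
move=> d0 ds st; pose tau := tent_diff d s t.
have ctau : continuous tau by move=> x; apply: cvgB; exact: tent_continuous.
pose phi x := \int[mu]_(y in `]-oo, x]) tau y.
have mT : meas (setT : set R) by exact: measurableT.
have Itent c : integ setT (tent d c) by exact: tent_integ.
have Itau : integ setT tau by exact: integB.
have mray u : meas (`]-oo, u]%classic : set R) by exact: measurable_itv.
have Iu u : integ `]-oo, u] tau by exact: integS mT (mray u) (@subsetT _ _) Itau.
have dphi x : derivable phi x 1 /\ derive1 phi x = tau x.
  have xx : x < x + 1 by rewrite ltrDl.
  have := @continuous_FTC1 R tau -oo%O x (x + 1) xx (Iu _).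
  by apply; [rewrite ltNyr|exact: ctau].
exists phi; split; last by move=> x; exact: (dphi x).2.
split.
- by move=> x; exact: (dphi x).1.
- by have -> : derive1 phi = tau by apply/funext => x; exact: (dphi x).2.
exists (s - d), (t + d); split; first by rewrite subr_gt0.
move=> x; rewrite in_itv /= negb_and -!ltNge => /orP[xs|tx].
  rewrite /phi -[RHS](Rintegral_set0 mu tau); apply: Rint_vanish => // y /=.
  rewrite in_itv /= => yx _; rewrite /tau /tent_diff !tent_out ?subrr// in_itv /= negb_and -!ltNge.
  - by apply/orP; left; lra.
  - by apply/orP; left; lra.
rewrite /phi /tau /tent_diff RintB//; last 2 first.
- exact: integS mT (mray x) (@subsetT _ _) (Itent _).
- exact: integS mT (mray x) (@subsetT _ _) (Itent _).
rewrite !tent_int ?subrr//; move=> y /=; rewrite !in_itv /= => /andP[_ yc]; lra.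
Qed.

(** Averaging against a tent of small width approximates the value at its centre. *)
Lemma tent_average k d c e : 0 < d -> d < c -> continuous k ->
  (forall x, `|c - x| <= d -> `|k c - k x| <= e) ->
  `|\int[mu]_(x in edge) (k x * tent d c x) - k c * tent_mass d| <= e * tent_mass d.
Proof.
move=> d0 dc ck ke.
have cd0 : 0 <= c - d by lra.
have sub : `[c - d, c + d] `<=` edge := itv_edge cd0.
have mI := meas_itv (c - d) (c + d).
have It : integ `[c - d, c + d] (tent d c) := cont_integ _ _ (@tent_continuous _ _).
have Ikt : integ `[c - d, c + d] (fun x => k x * tent d c x).
  have [M M0 MP] := cont_bounded (c - d) (c + d) ck.
  by apply: (@integ_bddM _ _ _ _ M) => //; exact: cont_meas.
rewrite (Rint_vanish sub); last by move=> t _ /negP tI; rewrite tent_out ?mulr0.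
rewrite -(tent_massE d c) -!RintZ// -RintB//; last exact: integZ.
have J := integB mI Ikt (integZ (k c) mI It).
rewrite (le_trans (le_normr_Rintegral mI J))//.
apply: le_Rint => //; [exact: integrable_norm J|exact: integZ|].
move=> x /=; rewrite in_itv /= => /andP[h1 h2].
rewrite -mulrBl normrM (ger0_norm (tent_ge0 _ _ _)) ler_wpM2r ?tent_ge0//.
by rewrite distrC ke// ler_norml; apply/andP; split; lra.
Qed.

(** The difference k of [f] and the primitive of [g] has weak derivative 0.  Tested against the
    primitive of the difference of two tents, this says that the averages of k around any two
    points coincide; as the width tends to 0, so do the values of k. *)
Lemma rweak_prim f g : {within edge, continuous f} -> L2 g -> real_weak_derivative f g -> primitive f g.
Proof.
move=> cf Lg wf; pose F t := \int[mu]_(x in `[0, t]) g x.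
have F0 : F 0 = 0 by rewrite /F set_itv1 Rintegral_set1.
have Fg : primitive F g by move=> t t0; rewrite F0 add0r.
have wF := prim_rweak Lg Fg.
pose k t := f t - F t.
have cF := prim_continuous Lg Fg.
have ck : {within edge, continuous k} by move=> x; apply: cvgB; [exact: cf|exact: cF].
have kd := within_edge_delta ck.
pose m (t : R) := Num.max 0 t.
have m0 t : 0 <= m t by rewrite le_max lexx.
have mE t : 0 <= t -> m t = t by move=> t0; exact/max_idPr.
have ext (h : R -> R) : (forall x : R, 0 <= x -> forall e, 0 < e -> exists2 d, 0 < d &
    forall y, 0 <= y -> `|x - y| < d -> `|h x - h y| < e) -> continuous (h \o m).
  move=> hd x; apply/cvgrPdist_lt => e e0.
  have [d d0 dP] := hd _ (m0 x) _ e0.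
  apply/nbhs_ballP; exists d => // y xy /=.
  by apply: dP => //; exact: le_lt_trans (max0_dist_le _ _) xy.
have cfm := ext f (within_edge_delta cf).
have cFm := ext F (within_edge_delta cF).
have ckm := ext k kd.
have kconst s t : 0 < s -> s < t -> k s = k t.
  move=> s0 st; have t0 := lt_trans s0 st.
  apply/eqP; rewrite -subr_eq0 -normr_le0; apply/ler_addgt0Pr => e e0; rewrite add0r.
  have e2 : 0 < e / 2 by rewrite divr_gt0.
  have [d1 d10 d1P] := kd s (ltW s0) _ e2.
  have [d2 d20 d2P] := kd t (ltW t0) _ e2.
  pose d := Num.min (Num.min (d1 / 2) (d2 / 2)) (Num.min (s / 2) ((t - s) / 2)).
  have d0 : 0 < d by rewrite !lt_min !divr_gt0// subr_gt0.
  have dd1 : d < d1.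
    have : d <= d1 / 2 by rewrite !ge_min lexx.
    by move=> /le_lt_trans; apply; lra.
  have dd2 : d < d2.
    have : d <= d2 / 2 by rewrite !ge_min lexx !orbT.
    by move=> /le_lt_trans; apply; lra.
  have ds : d < s.
    have : d <= s / 2 by rewrite !ge_min lexx !orbT.
    by move=> /le_lt_trans; apply; lra.
  have dts : s + d < t.
    have : d <= (t - s) / 2 by rewrite !ge_min lexx !orbT.
    by move=> dle; apply: (@le_lt_trans _ _ (s + (t - s) / 2)); [rewrite lerD2l|lra].
  have [phi [tphi phiE]] := tent_test d0 ds dts.
  have wfphi := wf _ tphi; have wFphi := wF _ tphi.
  have Itent (h : R -> R) (c : R) : d < c -> continuous h -> integ edge (fun x => h x * tent d c x).
    move=> dc ch; have cd0 : 0 <= c - d by lra.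
    apply: (integ_vanish measurable_edge (meas_itv (c - d) (c + d)) (itv_edge cd0)).
      by move=> x _ /negP xI; rewrite tent_out ?mulr0.
    have [M M0 MP] := cont_bounded (c - d) (c + d) ch.
    have Itc : integ `[c - d, c + d] (tent d c) := cont_integ _ _ (@tent_continuous _ _).
    apply: (@integ_bddM _ _ _ _ M) => //; [exact: meas_itv|exact: cont_meas].
  have dt : d < t by lra.
  have eqT (h : R -> R) : continuous (h \o m) ->
      \int[mu]_(x in edge) (h x * derive1 phi x) =
      \int[mu]_(x in edge) ((h \o m) x * tent d s x) -
      \int[mu]_(x in edge) ((h \o m) x * tent d t x).
    move=> ch; rewrite -RintB//; [|exact: Itent|exact: Itent].
    apply: eq_Rint => x /edge_ge0 x0; rewrite phiE /tent_diff /= mE//; ring.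
  have kE (c : R) : d < c -> \int[mu]_(x in edge) ((k \o m) x * tent d c x) =
      \int[mu]_(x in edge) ((f \o m) x * tent d c x) -
      \int[mu]_(x in edge) ((F \o m) x * tent d c x).
    move=> dc; rewrite -RintB//; [|exact: Itent|exact: Itent].
    by apply: eq_Rint => x _; rewrite /k /=; ring.
  have kst : \int[mu]_(x in edge) ((k \o m) x * tent d s x) =
      \int[mu]_(x in edge) ((k \o m) x * tent d t x).
    rewrite !kE//; have := wFphi; rewrite -wfphi (eqT _ cfm) (eqT _ cFm).
    by move=> /eqP; rewrite subr_eq => /eqP E; rewrite E; ring.
  have M0 := tent_mass_gt0 d0.
  have A1 : `|\int[mu]_(x in edge) ((k \o m) x * tent d s x) - k s * tent_mass d|
      <= e / 2 * tent_mass d.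
    have := @tent_average (k \o m) d s (e / 2) d0 ds ckm; rewrite /= (mE s (ltW s0)); apply.
    move=> x xs; have x0 : 0 <= x by move: xs; rewrite ler_norml => /andP[]; lra.
    by rewrite mE//; apply/ltW/d1P => //; exact: le_lt_trans dd1.
  have A2 : `|\int[mu]_(x in edge) ((k \o m) x * tent d t x) - k t * tent_mass d|
      <= e / 2 * tent_mass d.
    have := @tent_average (k \o m) d t (e / 2) d0 dt ckm; rewrite /= (mE t (ltW t0)); apply.
    move=> x xs; have x0 : 0 <= x by move: xs; rewrite ler_norml => /andP[]; lra.
    by rewrite mE//; apply/ltW/d2P => //; exact: le_lt_trans dd2.
  rewrite kst distrC in A1.
  have : `|(k s - k t) * tent_mass d| <= e * tent_mass d.
    have -> : (k s - k t) * tent_mass d =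
      (k s * tent_mass d - \int[mu]_(x in edge) ((k \o m) x * tent d t x)) +
      (\int[mu]_(x in edge) ((k \o m) x * tent d t x) - k t * tent_mass d) by ring.
    rewrite (le_trans (ler_normD _ _))// (le_trans (lerD A1 A2))//.
    by rewrite le_eqVlt; apply/orP; left; apply/eqP; field.
  by rewrite normrM (gtr0_norm M0) ler_pM2r.
have k0 t : 0 < t -> k 0 = k t.
  move=> t0; apply/eqP; rewrite -subr_eq0 -normr_le0; apply/ler_addgt0Pr => e e0.
  rewrite add0r; have [d d0 dP] := kd 0 (lexx 0) _ e0.
  pose s := Num.min (d / 2) (t / 2).
  have s0 : 0 < s by rewrite lt_min !divr_gt0.
  have sd : s < d.
    have : s <= d / 2 by rewrite ge_min lexx.
    by move=> /le_lt_trans; apply; lra.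
  have st : s < t.
    have : s <= t / 2 by rewrite ge_min lexx orbT.
    by move=> /le_lt_trans; apply; lra.
  by rewrite -(kconst s t)//; apply/ltW/dP; [exact: ltW|rewrite sub0r normrN gtr0_norm].
move=> t; rewrite le_eqVlt => /predU1P[<-|t0].
  by rewrite set_itv1 Rintegral_set1 addr0.
have := k0 t t0; rewrite /k F0 subr0 => ->; by rewrite subrK.
Qed.

End WeakToPrimitive.

(** * Completeness of the energy space of an edge *)

Section Completeness.
Context {R : realType}.
Local Notation mu := (@lebesgue_measure R).
Local Notation edge := (@edge R).
Local Notation L2 := (L2 (fun=> 1)).
Local Notation sqnorm := (sqnorm (fun=> 1)).
Implicit Types (f g h : R -> R).

Lemma half_gt0 n : 0 < 2^-1 ^+ n :> R.
Proof. by rewrite exprn_gt0// invr_gt0. Qed.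

Lemma half_small (d : R) : 0 < d -> exists n, 2^-1 ^+ n < d.
Proof.
move=> d0; pose n := Num.bound d^-1; exists n.
have nd : d^-1 < n%:R by rewrite archi_boundP// invr_ge0 ltW.
rewrite exprVn -[d]invrK ltf_pV2 ?posrE ?exprn_gt0 ?invr_gt0//.
by rewrite (lt_trans nd)// -natrX ltr_nat ltn_expl.
Qed.

(** The limit along an ultrafilter keeps the rate of convergence. *)
Lemma geometric_limit (x : nat -> R) (s : R) : 0 <= s ->
  (forall n m, (n <= m)%N -> `|x n - x m| <= s * 2^-1 ^+ n) ->
  exists l, forall n, `|x n - l| <= s * 2^-1 ^+ n.
Proof.
move=> s0 xs; have [U [FU Uoo]] := ultraFilterLemma (@eventually_filter).
have [|l lP] := @ultra_bounded_limit R U x (`|x 0%N| + s) FU.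
  move=> n; have := xs 0%N n (leq0n _); rewrite expr0 mulr1 => h1.
  have -> : x n = x 0%N - (x 0%N - x n) by ring.
  by rewrite (le_trans (ler_normB _ _))// lerD2l.
exists l => n; apply/ler_addgt0Pr => e e0.
have Un : U [set m | (n <= m)%N] by apply: Uoo; exact: nbhs_infty_ge.
have /filter_ex[m /= [xm nm]] : U ([set n | `|x n - l| < e] `&` [set m | (n <= m)%N]).
  by apply: filterI => //; exact: lP.
have -> : x n - l = (x n - x m) + (x m - l) by ring.
by rewrite (le_trans (ler_normD _ _))// lerD ?xs// ltW.
Qed.

Lemma geometric_cvg (x : nat -> R) (s l : R) :
  (forall n, `|x n - l| <= s * 2^-1 ^+ n) -> x @ \oo --> l.
Proof.
move=> xl; apply/cvgrPdist_lt => e e0.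
have s0 : 0 <= s.
  by have := le_trans (normr_ge0 _) (xl 0%N); rewrite expr0 mulr1.
have e1 : 0 < e / (s + 1) by rewrite divr_gt0// ltr_wpDl.
have [n0 n0P] := half_small e1.
near=> n; rewrite distrC (le_lt_trans (xl n))//.
have nn : (n0 <= n)%N by near: n; exact: nbhs_infty_ge.
have le2 : 2^-1 ^+ n <= 2^-1 ^+ n0 :> R.
  by rewrite ler_wiXn2l// ?invr_ge0// invf_le1// ler1n.
have := le_lt_trans le2 n0P; rewrite ltr_pdivlMr ?ltr_wpDl// => h1.
apply: le_lt_trans h1; rewrite mulrC ler_wpM2l ?lerDl//; exact/ltW/half_gt0.
Unshelve. all: by end_near. Qed.

Section RieszFischer.
Variable (h : nat -> R -> R).
Hypotheses (Lh : forall n, L2 (h n))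
  (hC : forall n m, (n <= m)%N -> sqnorm (fun t => h n t - h m t) <= 16^-1 ^+ n).

Let d2 k t := 4 ^+ k * (h k.+1 t - h k t) ^+ 2.
Let S t : \bar R := (\sum_(0 <= k <oo) (d2 k t)%:E)%E.

Let d2_ge0 k t : (0 <= (d2 k t)%:E)%E.
Proof. by rewrite lee_fin mulr_ge0 ?sqr_ge0// exprn_ge0. Qed.

Let mh n : measurable_fun edge (h n). Proof. by have [] := Lh n. Qed.

Let md2 k : measurable_fun (edge : set (measurableTypeR R)) (fun t => (d2 k t)%:E).
Proof.
apply/measurable_EFinP; apply: measurable_funM => //.
by apply: measurable_funX; exact: (measurable_funB (mh _) (mh _)).
Qed.

Let mS : measurable_fun (edge : set (measurableTypeR R)) S.
Proof. by apply: ge0_emeasurable_sum => // k t _ _. Qed.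

Let intS : mu.-integrable edge S.
Proof.
apply/integrableP; split; first exact: mS.
have S0 t : (0 <= S t)%E by apply: nneseries_ge0.
under eq_integral do rewrite gee0_abs//.
rewrite (integral_nneseries _ measurable_edge md2); last by move=> k t _; exact: d2_ge0.
apply: (@le_lt_trans _ _ (\sum_(0 <= k <oo) (2 / (2 ^ k.+1)%:R)%:E)%E).
  apply: lee_nneseries => [k _ _|k _]; first by apply: integral_ge0 => t _; exact: d2_ge0.
  have Ld := L2_B weight1 (Lh k.+1) (Lh k).
  have Id : integ edge (fun t => 4 ^+ k * (1 * (h k.+1 t - h k t) ^+ 2)).
    by apply: integZ => //; exact: Ld.2.
  have -> : (\int[mu]_(t in edge) (d2 k t)%:E =
      (\int[mu]_(t in edge) (4 ^+ k * (1 * (h k.+1 t - h k t) ^+ 2)))%:E)%E.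
    rewrite -Rint_EFin//; apply: eq_integral => t _; by rewrite /d2 mul1r.
  rewrite lee_fin RintZ//; last exact: Ld.2.
  have := hC (leqnSn k).
  have -> : sqnorm (fun t => h k t - h k.+1 t) =
      \int[mu]_(t in edge) (1 * (h k.+1 t - h k t) ^+ 2).
    by apply: eq_Rint => t _; ring.
  move=> le1; rewrite natrX exprS invfM mulrA divff// mul1r -exprVn.
  have e4 : 0 <= 4 ^+ k :> R by rewrite exprn_ge0.
  apply: le_trans (ler_wpM2l e4 le1) _; rewrite -exprMn.
  have -> : 4 * 16^-1 = 2^-1 * 2^-1 :> R by field.
  rewrite exprMn ler_piMr ?exprn_ge0 ?invr_ge0//.
  by rewrite exprn_ile1// ?invr_ge0// invf_le1// ler1n.
apply: (le_lt_trans (epsilon_trick0 predT (ler0n R 2))); exact: ltry.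
Qed.

Let bound t s : (S t <= s%:E)%E -> forall n m, (n <= m)%N ->
  `|h n t - h m t| <= 2 * Num.sqrt s * 2^-1 ^+ n.
Proof.
move=> Ss n m nm; set r := Num.sqrt s.
have step k : `|h k.+1 t - h k t| <= r * 2^-1 ^+ k.
  have : ((d2 k t)%:E <= S t)%E.
    have := @nneseries_lim_ge R (fun k => (d2 k t)%:E) predT 0 k.+1 (fun _ _ _ => d2_ge0 _ _).
    apply: le_trans; rewrite big_mkord big_ord_recr /= leeDr//.
    by apply: sume_ge0 => i _; exact: d2_ge0.
  move=> /le_trans/(_ Ss); rewrite lee_fin => ds.
  have s0 : 0 <= s by apply: le_trans ds; rewrite mulr_ge0 ?sqr_ge0// exprn_ge0.
  have r2 : r ^+ 2 = s by rewrite sqr_sqrtr.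
  rewrite norm_le_sqr; last by rewrite mulr_ge0 ?sqrtr_ge0// ltW// half_gt0.
  rewrite exprMn r2 -exprM mulnC exprM.
  have -> : 2^-1 ^+ 2 = 4^-1 :> R by field.
  by rewrite exprVn ler_pdivlMr ?exprn_gt0// mulrC.
have ind i : `|h n t - h (n + i)%N t| <= 2 * r * (2^-1 ^+ n - 2^-1 ^+ (n + i)).
  elim: i => [|i IH]; first by rewrite addn0 !subrr normr0 mulr0.
  have -> : h n t - h (n + i.+1)%N t =
    (h n t - h (n + i)%N t) - (h (n + i).+1 t - h (n + i)%N t) by rewrite addnS; ring.
  rewrite (le_trans (ler_normB _ _))// (le_trans (lerD IH (step _)))//.
  by rewrite addnS [2^-1 ^+ (_.+1)]exprS le_eqVlt; apply/orP; left; apply/eqP; field.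
have := ind (m - n)%N; rewrite subnKC// => /le_trans; apply.
rewrite ler_wpM2l//; first by rewrite mulr_ge0// sqrtr_ge0.
by rewrite lerBlDr lerDl ltW// half_gt0.
Qed.

(** The series [S] of the weighted squared increments has a finite integral, so it is finite
    almost everywhere; where it is, the increments decay geometrically. *)
Lemma riesz_fischer : exists H, [/\ L2 H,
  forall n, sqnorm (fun t => h n t - H t) <= 16^-1 ^+ n &
  {ae mu, forall t, edge t -> (fun n => h n t) @ \oo --> H t}].
Proof.
have ex : forall t : R, exists l : R, (S t < +oo)%E -> (fun n => h n t) @ \oo --> l.
  move=> t; case: (ltP (S t) +oo%E) => [St|]; last by move=> ?; exists 0.
  have S0 : (0 <= S t)%E by apply: nneseries_ge0.
  have Sfin : S t \is a fin_num by rewrite ge0_fin_numE.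
  have [||l lP] := @geometric_limit (fun n => h n t) (2 * Num.sqrt (fine (S t))).
  - by rewrite mulr_ge0// sqrtr_ge0.
  - by apply: bound; rewrite fineK.
  by exists l => _; exact: geometric_cvg lP.
have [H HP] := choice ex.
pose good := [set t | (S t < +oo)%E].
have mgood : meas (edge `&` good) := emeasurable_fun_infty_o measurable_edge mS _.
pose H' t := if t \in edge `&` good then H t else 0.
have mH' : measurable_fun edge H'.
  apply: (@measurable_fun_cvg _ _ _ (edge : set (measurableTypeR R))
    (fun n t => h n t * \1_(edge `&` good) t)) => [n|t et].
  - apply: measurable_funM; first exact: mh.
    exact: (@measurable_indic _ (measurableTypeR R) R edge _ mgood).
  - rewrite /H'; case: ifPn => tg.
      under eq_fun do rewrite indicE tg mulr1.
      by apply: HP; have [] := set_mem tg.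
    under eq_fun do rewrite indicE (negbTE tg) mulr0.
    exact: cvg_cst.
have aegood : {ae mu, forall t, edge t -> good t}.
  have := integrable_ae measurable_edge intS.
  by apply: ae_imply => t + et => /(_ et); rewrite fin_numE /good /= lt_neqAle leey andbT => /andP[].
have cvH' : {ae mu, forall t, edge t -> (fun n => h n t) @ \oo --> H' t}.
  apply: ae_imply aegood => t + et => /(_ et) gt.
  by rewrite /H' mem_set//; exact: HP.
have key n : L2 (fun t => h n t - H' t) /\ sqnorm (fun t => h n t - H' t) <= 16^-1 ^+ n.
  have mhn m : measurable_fun edge (fun t => (h n t - h (n + m)%N t) ^+ 2).
    by apply: measurable_funX; exact: (measurable_funB (mh _) (mh _)).
  have mhH : measurable_fun edge (fun t => (h n t - H' t) ^+ 2).
    by apply: measurable_funX; exact: (measurable_funB (mh _) mH').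
  have := @dominated_convergence _ _ R mu edge measurable_edge
    (fun m t => ((h n t - h (n + m)%N t) ^+ 2)%:E) (fun t => ((h n t - H' t) ^+ 2)%:E)
    (fun t => 4%:E * S t)%E.
  case.
  - by move=> m; apply/measurable_EFinP; exact: mhn.
  - by apply/measurable_EFinP; exact: mhH.
  - apply: ae_imply cvH' => t + et => /(_ et) ct.
    apply: cvg_EFin; first by apply: nearW.
    have ct' : (fun m => h (n + m)%N t) @ \oo --> H' t.
      by have := ct; rewrite -(cvg_shiftn n); under eq_fun do rewrite addnC.
    have c1 : (fun m => h n t - h (n + m)%N t : R^o) @ \oo --> (h n t - H' t : R^o).
      by apply: cvgB; [exact: cvg_cst|exact: ct'].
    rewrite expr2; apply: cvg_trans (cvgM c1 c1).
    by apply: near_eq_cvg; apply: nearW => m; rewrite /= expr2.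
  - exact: (integrableZl measurable_edge).
  - apply: (@filterE _ _ (ae_filter_ringOfSetsType mu)).
    move=> t m _ /=; have S0 : (0 <= S t)%E by apply: nneseries_ge0.
    have [St|] := ltP (S t) +oo%E; last first.
      by rewrite leye_eq => /eqP ->; rewrite gt0_muley ?lte_fin// leey.
    have Sfin : S t \is a fin_num by rewrite ge0_fin_numE.
    have f0 : 0 <= fine (S t) by exact: fine_ge0.
    rewrite -(fineK Sfin) -EFinM lee_fin ger0_norm ?sqr_ge0//.
    have -> : 4 * fine (S t) = (2 * Num.sqrt (fine (S t))) ^+ 2.
      by rewrite exprMn sqr_sqrtr//; congr (_ * _); ring.
    rewrite -norm_le_sqr; last by rewrite mulr_ge0// sqrtr_ge0.
    have := @bound t (fine (S t)) _ n (n + m) (leq_addr _ _); rewrite fineK// => /(_ (lexx _)).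
    move=> /le_trans; apply; rewrite ler_piMr ?mulr_ge0 ?sqrtr_ge0//.
    by rewrite exprn_ile1// ?invr_ge0// invf_le1// ler1n.
  move=> IH _ cI.
  have LhH : L2 (fun t => h n t - H' t).
    split; first exact: (measurable_funB (mh _) mH').
    by apply: eq_integ IH => // t _; rewrite mul1r.
  split => //.
  have E : (\int[mu]_(t in edge) ((h n t - H' t) ^+ 2)%:E =
      (sqnorm (fun t => h n t - H' t))%:E)%E.
    rewrite -Rint_EFin//; last exact: L2_prod.
    by apply: eq_integral => t _; rewrite mul1r expr2.
  rewrite -lee_fin -E; apply: (cvge_to_le cI); apply: nearW => m /=.
  have Lm := L2_B weight1 (Lh n) (Lh (n + m)).
  have -> : (\int[mu]_(t in edge) ((h n t - h (n + m)%N t) ^+ 2)%:E =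
      (sqnorm (fun t => h n t - h (n + m)%N t))%:E)%E.
    rewrite -Rint_EFin//; last exact: (L2_prod weight1 Lm Lm).
    by apply: eq_integral => t _; rewrite mul1r expr2.
  by rewrite lee_fin hC// leq_addr.
exists H'; split => //; last by move=> n; exact: (key n).2.
have := L2_B weight1 (Lh 0%N) (key 0%N).1.
have -> : (fun t => h 0%N t - (h 0%N t - H' t)) = H' by apply/funext => t; rewrite subKr.
by [].
Qed.

End RieszFischer.

(** Both sequences converge in L_2.  The values converge uniformly as well, by [prim_sup], so the
    limit of the functions has the primitive of the limit of the derivatives as its continuous
    representative. *)
Lemma prim_complete (f g : nat -> R -> R) :
  (forall n, L2 (f n)) -> (forall n, L2 (g n)) -> (forall n, primitive (f n) (g n)) ->
  (forall n m, (n <= m)%N -> sqnorm (fun t => f n t - f m t) +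
     sqnorm (fun t => g n t - g m t) <= 16^-1 ^+ n) ->
  exists F G, [/\ L2 F, L2 G, primitive F G, forall n,
    sqnorm (fun t => f n t - F t) + sqnorm (fun t => g n t - G t) <= 2 * 16^-1 ^+ n &
    forall n, `|f n 0 - F 0| <= 2 * 2^-1 ^+ n].
Proof.
move=> Lf Lg fg fgC.
have nf n m : (n <= m)%N -> sqnorm (fun t => f n t - f m t) <= 16^-1 ^+ n.
  by move=> nm; apply: le_trans (fgC n m nm); rewrite lerDl; exact: nrm_ge0 weight1.
have ng n m : (n <= m)%N -> sqnorm (fun t => g n t - g m t) <= 16^-1 ^+ n.
  by move=> nm; apply: le_trans (fgC n m nm); rewrite lerDr; exact: nrm_ge0 weight1.
have [F' [LF' nF' cF']] := riesz_fischer Lf nf.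
have [G [LG nG _]] := riesz_fischer Lg ng.
have sub n m : primitive (fun t => f n t - f m t) (fun t => g n t - g m t).
  have := prim_lin (-1) (Lg m) (Lg n) (fg m) (fg n).
  by under eq_fun do rewrite mulN1r addrC; under [X in primitive _ X]eq_fun do rewrite mulN1r addrC.
have small n : 16^-1 ^+ n <= (2^-1 ^+ n) ^+ 2 :> R.
  rewrite -exprM mulnC exprM; apply: lerXn2r; rewrite ?nnegrE ?invr_ge0 ?sqr_ge0//.
  have -> : 2^-1 ^+ 2 = 4^-1 :> R by field.
  lra.
have sup n m t : (n <= m)%N -> 0 <= t -> `|f n t - f m t| <= 2 * 2^-1 ^+ n.
  move=> nm t0; rewrite norm_le_sqr ?mulr_ge0 ?exprn_ge0 ?invr_ge0//.
  have := prim_sup (L2_B weight1 (Lf n) (Lf m)) (L2_B weight1 (Lg n) (Lg m)) (sub n m) t0.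
  move=> h1; have h2 := le_trans (fgC n m nm) (small n).
  apply: (le_trans h1); rewrite -mulrDr exprMn.
  have -> : 2 ^+ 2 = 4 :> R by ring.
  by apply: ler_pM => //; rewrite ?addr_ge0 ?(nrm_ge0 _ weight1)//; lra.
have [x0 x0P] : exists x0 : R, forall k, `|f k 0 - x0| <= 2 * 2^-1 ^+ k.
  by apply: geometric_limit => // n m nm; exact: sup.
pose F t := x0 + \int[mu]_(x in `[0, t]) G x.
have F0 : F 0 = x0 by rewrite /F set_itv1 Rintegral_set1 addr0.
have FG : primitive F G by move=> t t0; rewrite F0.
have cF t : 0 <= t -> (fun n => f n t) @ \oo --> F t.
  move=> t0; apply: (@geometric_cvg _ (2 + (t + 1))) => n.
  have -> : f n t - F t = (f n 0 - x0) + \int[mu]_(x in `[0, t]) (g n x - G x).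
    rewrite (RintB (meas_itv 0 t)); [|exact: L2_itv|exact: L2_itv].
    by rewrite (fg n t t0) /F; ring.
  rewrite (le_trans (ler_normD _ _))// mulrDl lerD//.
  rewrite norm_le_sqr; last by rewrite mulr_ge0 ?exprn_ge0 ?invr_ge0//; lra.
  have := itv_int_sq (L2_B weight1 (Lg n) LG) (lexx 0) t0; rewrite subr0.
  move=> /le_trans; apply; rewrite exprMn ler_pM//.
  - exact: nrm_ge0 weight1.
  - nra.
  - exact: le_trans (nG n) (small n).
have FF' : {ae mu, forall t, edge t -> F' t = F t}.
  apply: ae_imply cF' => t + et => /(_ et) c1.
  have c2 := cF t (edge_ge0 et).
  exact: (cvg_unique _ c1 c2).
have mF : measurable_fun edge F.
  have := @cont_meas _ edge _ (prim_ext_continuous LG FG).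
  by apply: eq_measurable_fun => t /set_mem /edge_ge0 t0; congr F; exact/max_idPr.
have LF : L2 F.
  split=> //; have [mF' IF'] := LF'.
  have mF2 : measurable_fun (edge : set (measurableTypeR R)) (fun t => 1 * F t ^+ 2).
    exact: (meas_wf2 weight1.1 mF).
  apply/integrableP; split; first exact/measurable_EFinP.
  have /integrableP[_] := IF'; congr (_ < _)%E.
  apply: (ae_eq_integral _ _ measurable_edge).
  - apply/measurable_EFinP; apply: measurableT_comp => //.
    exact: (meas_wf2 weight1.1 mF').
  - by apply/measurable_EFinP; apply: measurableT_comp.
  - by apply: ae_imply FF' => t + et => /(_ et) /= ->.
exists F, G; split => // n; last by rewrite F0.
rewrite mulrDl mul1r lerD//.
apply: le_trans (nF' n); rewrite le_eqVlt; apply/orP; left; apply/eqP.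
apply: ae_eq_Rint => //.
- by have := L2_prod weight1 (L2_B weight1 (Lf n) LF) (L2_B weight1 (Lf n) LF) => /integ_meas.
- by have := L2_prod weight1 (L2_B weight1 (Lf n) LF') (L2_B weight1 (Lf n) LF') => /integ_meas.
- by apply: ae_imply FF' => t + et => /(_ et) ->.
Qed.

End Completeness.

(** * Potentials with an integrable power *)

Section Potential.
Context {R : realType}.
Local Notation mu := (@lebesgue_measure R).
Local Notation edge := (@edge R).

Local Notation L2u := (L2 (fun=> 1)).
Local Notation sqnorm1 := (sqnorm (fun=> 1)).
Implicit Types (f g v : R -> R).

(** Any [x] is at most [d], or else at most d^(1 - p) x^p. *)
Lemma powR_split (p d x : R) : 1 <= p -> 0 < d -> 0 <= x ->
  x <= d + d `^ (1 - p) * x `^ p.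
Proof.
move=> p1 d0 x0; have c0 : 0 < d `^ (1 - p) by rewrite powR_gt0.
have [xd|dx] := leP x d.
  by rewrite (le_trans xd)// lerDl mulr_ge0 ?powR_ge0// ltW.
have xp : 0 < x := lt_trans d0 dx.
apply: (@le_trans _ _ (d `^ (1 - p) * x `^ p)); last by rewrite lerDr ltW.
have -> : x `^ p = x * x `^ (p - 1).
  rewrite -{2}[x]powRr1 ?ltW// -powRD; last by rewrite (gt_eqF xp) implybT.
  by congr (_ `^ _); ring.
have : d `^ (p - 1) <= x `^ (p - 1).
  by apply: ge0_ler_powR; rewrite ?nnegrE ?subr_ge0// ltW.
move=> le1; apply: (@le_trans _ _ (d `^ (1 - p) * (x * d `^ (p - 1)))).
  rewrite mulrCA -powRD; last by rewrite (gt_eqF d0) implybT.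
  have -> : 1 - p + (p - 1) = 0 by ring.
  by rewrite powRr0 mulr1.
by rewrite ler_wpM2l ?(ltW c0)// ler_wpM2l// ltW.
Qed.

(** Dominated convergence: every point leaves the sets [A n]. *)
Lemma integ_tail (P : R -> R) (A : nat -> set R) : integ edge P ->
  (forall n, meas (A n)) -> (forall t, edge t -> 0 <= P t) ->
  (forall t, edge t -> exists n0, forall n, (n0 <= n)%N -> ~ A n t) ->
  forall e, 0 < e -> exists n,
    integ edge (fun t => P t * \1_(A n) t) /\
    \int[mu]_(t in edge) (P t * \1_(A n) t) <= e.
Proof.
move=> IP mA P0 A0 e e0.
have mP := integ_meas IP.
have mF n : measurable_fun edge (fun t => P t * \1_(A n) t).
  apply: measurable_funM => //.
  exact: (@measurable_indic _ (measurableTypeR R) R edge _ (mA n)).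
have IF n : integ edge (fun t => P t * \1_(A n) t).
  apply: integ_dom IP => // t et; rewrite normrM (ger0_norm (P0 _ et)).
  by rewrite ler_piMr ?P0// indicE; case: (_ \in _); rewrite ?normr1 ?normr0.
have mPe : measurable_fun (edge : set (measurableTypeR R)) (EFin \o P).
  by apply/measurable_EFinP.
have bd n t : edge t -> `|P t * \1_(A n) t| <= P t.
  move=> et; rewrite normrM (ger0_norm (P0 _ et)).
  by rewrite ler_piMr ?P0// indicE; case: (_ \in _); rewrite ?normr1 ?normr0.
have H1 n : measurable_fun (edge : set (measurableTypeR R))
    (fun t => (P t * \1_(A n) t)%:E) by apply/measurable_EFinP; exact: mF.
have H2 t : edge t -> (fun n => (P t * \1_(A n) t)%:E) @ \oo --> (0%E : \bar R).
  move=> et; have [n0 n0P] := A0 t et.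
  apply: cvg_near_cst; near=> n.
  have nn : (n0 <= n)%N by near: n; exact: nbhs_infty_ge.
  by rewrite indicE memNset ?mulr0//; exact: n0P.
have H3 t : edge t -> (EFin \o P) t \is a fin_num by [].
have H5 n t : edge t -> (`|(P t * \1_(A n) t)%:E| <= (EFin \o P) t)%E.
  by move=> et; rewrite /= lee_fin bd.
have := dominated_cvg measurable_edge H1 H2 H3 IP H5.
rewrite integral0 => /fine_cvgP[_ /cvgrPdist_lt/(_ e e0)].
move=> /filter_ex[n]; rewrite sub0r normrN => ne; exists n; split => //.
exact: le_trans (ler_norm _) (ltW ne).
Unshelve. all: by end_near. Qed.

Variables (v : R -> R) (p : R).
Hypotheses (mv : measurable_fun edge v) (v0 : forall t, 0 <= t -> 0 <= v t)
  (p1 : 1 <= p) (vp : (\int[mu]_(t in edge) (v t `^ p)%:E < +oo)%E).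

Let P t := v t `^ p.

Let IP : integ edge P.
Proof.
have mP : measurable_fun edge P.
  by apply: (measurableT_comp (measurable_powR p)).
by apply/ge0_integ => // t _; exact: powR_ge0.
Qed.

Let A (n : nat) : set R := edge `&` [set t | n%:R < t] `|` edge `&` [set t | n%:R < v t].

(** Where [t] and [v t] are at most [n], the integral over [[0, n]] takes care of v f^2.
    Elsewhere v is at most d + d^(1 - p) v^p by [powR_split]; the values of [f] are bounded by the
    energy, and the integral of v^p over that region is small for large [n]. *)
Lemma edge_potential_bound e : 0 < e -> exists n : nat, forall f g, L2u f -> L2u g -> primitive f g ->
  L2 v f /\ sqnorm v f <= e * (sqnorm1 f + sqnorm1 g) +
    n%:R * \int[mu]_(t in `[0, n%:R]) (1 * f t ^+ 2).
Proof.
move=> e0; pose d := e / 2; have d0 : 0 < d by rewrite divr_gt0.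
pose c := d `^ (1 - p); have c0 : 0 < c by rewrite powR_gt0.
have mA n : meas (A n).
  apply: measurableU.
    have -> : edge `&` [set t | n%:R < t] = (`]n%:R, +oo[%classic : set R).
      apply/seteqP; split => t /=; rewrite in_itv /= andbT; first by case.
      by move=> nt; split=> //; rewrite edgeE (le_trans _ (ltW nt)).
    exact: measurable_itv.
  have mvE : measurable_fun (edge : set (measurableTypeR R)) (EFin \o v).
    exact/measurable_EFinP.
  have := emeasurable_fun_o_infty measurable_edge mvE n%:R%:E.
  by congr meas; apply/seteqP; split => t /=; rewrite lte_fin.
have P0 t : edge t -> 0 <= P t by move=> _; exact: powR_ge0.
have A0 t : edge t -> exists n0, forall n, (n0 <= n)%N -> ~ A n t.
  move=> et; have t0 := edge_ge0 et.
  exists (Num.bound (t + v t)) => n nn.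
  have : t + v t < n%:R.
    by rewrite (lt_le_trans (archi_boundP _))// ?ler_nat// addr_ge0// v0.
  have := v0 t0; move=> vt tr [[_ /= nt]|[_ /= nt]]; lra.
have d'0 : 0 < e / (4 * c) by rewrite divr_gt0// mulr_gt0.
have [n [IA Ae]] := integ_tail IP mA P0 A0 d'0.
exists n => f g Lf Lg fg.
pose a := sqnorm1 f + sqnorm1 g.
have a0 : 0 <= a by rewrite addr_ge0// nrm_ge0//; exact: weight1.
have [mf If] := Lf.
pose I0 : set R := `[0, n%:R]%classic.
have mI0 : meas I0 := meas_itv _ _.
have sI0 : I0 `<=` edge := itv_edge (lexx 0).
pose F1 t := n%:R * ((1 * f t ^+ 2) * \1_I0 t).
pose F2 t := d * (1 * f t ^+ 2).
pose F3 t := (2 * a * c) * (P t * \1_(A n) t).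
have IfI : integ edge (fun t => (1 * f t ^+ 2) * \1_I0 t).
  apply: integ_dom If => //.
    apply: measurable_funM; first exact: (meas_wf2 weight1.1 mf).
    exact: (@measurable_indic _ (measurableTypeR R) R edge _ mI0).
  move=> t _; rewrite normrM [X in X * _]ger0_norm ?mul1r ?sqr_ge0//.
  by rewrite ler_piMr ?sqr_ge0// indicE; case: (_ \in _); rewrite ?normr1 ?normr0.
have I1 : integ edge F1 by exact: integZ.
have I2 : integ edge F2 by exact: integZ.
have I3 : integ edge F3 by exact: integZ.
have I123 := integD measurable_edge (integD measurable_edge I1 I2) I3.
have point t : edge t -> v t * f t ^+ 2 <= F1 t + F2 t + F3 t.
  move=> et; have t0 := edge_ge0 et.
  have f20 := sqr_ge0 (f t).
  have sup := prim_sup Lf Lg fg t0; rewrite -mulrDr -/a in sup.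
  have Pt0 := P0 t et.
  have ind0 (X : set R) : 0 <= \1_X t :> R by rewrite indicE.
  have F10 : 0 <= F1 t by rewrite /F1 mulr_ge0 ?ler0n// mul1r mulr_ge0 ?sqr_ge0 ?ind0.
  have F20 : 0 <= F2 t by rewrite /F2 mulr_ge0 ?(ltW d0)// mul1r sqr_ge0.
  have F30 : 0 <= F3 t by rewrite /F3 !mulr_ge0 ?ind0 ?(ltW c0).
  case: (pselect (A n t)) => [At|nAt].
    have vd := powR_split p1 d0 (v0 t0); rewrite -/c -/(P t) in vd.
    have -> : F3 t = c * P t * (2 * a) by rewrite /F3 indicE mem_set// mulr1; ring.
    have : v t * f t ^+ 2 <= (d + c * P t) * f t ^+ 2 by rewrite ler_wpM2r.
    have : c * P t * f t ^+ 2 <= c * P t * (2 * a).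
      by rewrite ler_wpM2l// mulr_ge0// ltW.
    move: F10; rewrite /F2; lra.
  have [tn vn] : t <= n%:R /\ v t <= n%:R.
    by split; rewrite leNgt; apply/negP => h; apply: nAt; [left|right].
  have tI : t \in I0 by rewrite mem_set// /I0 /= in_itv /= t0.
  have : v t * f t ^+ 2 <= F1 t by rewrite /F1 indicE tI mulr1 mul1r ler_wpM2r.
  lra.
have mvf : measurable_fun edge (fun t => v t * f t ^+ 2) := meas_wf2 mv mf.
have Lvf : L2 v f.
  split=> //; apply: integ_dom I123 => // t et; rewrite ger0_norm ?point//.
  by rewrite mulr_ge0 ?sqr_ge0// v0//; exact: edge_ge0.
split=> //.
have : sqnorm v f <= \int[mu]_(t in edge) (F1 t + F2 t + F3 t).
  by apply: le_Rint => //; exact: Lvf.2.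
move=> /le_trans; apply.
rewrite (RintD measurable_edge (integD measurable_edge I1 I2) I3) (RintD measurable_edge I1 I2).
rewrite (RintZ _ measurable_edge IfI) (RintZ _ measurable_edge If) (RintZ _ measurable_edge IA).
have -> : \int[mu]_(t in edge) (1 * f t ^+ 2 * \1_I0 t) =
    \int[mu]_(t in I0) (1 * f t ^+ 2).
  rewrite (Rint_vanish sI0).
    by apply: eq_Rint => t It; rewrite indicE mem_set// mulr1.
  by move=> t _ nI; rewrite indicE memNset// mulr0.
have -> : \int[mu]_(t in edge) (1 * f t ^+ 2) = sqnorm1 f by [].
have fa : sqnorm1 f <= a by rewrite lerDl nrm_ge0//; exact: weight1.
have h1 : d * sqnorm1 f <= e / 2 * a by rewrite /d ler_wpM2l// divr_ge0// ltW.
have h2 : 2 * a * c * \int[mu]_(t in edge) (P t * \1_(A n) t) <= e / 2 * a.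
  apply: (@le_trans _ _ (2 * a * c * (e / (4 * c)))).
    by rewrite ler_wpM2l// !mulr_ge0// ltW.
  by rewrite le_eqVlt; apply/orP; left; apply/eqP; field; rewrite gt_eqF.
have -> : e * a = e / 2 * a + e / 2 * a by field.
lra.
Qed.

Lemma edge_potential_bounded e : 0 < e -> exists2 M, 0 <= M & forall f g, L2u f -> L2u g ->
  primitive f g -> sqnorm v f <= e * (sqnorm1 f + sqnorm1 g) + M * sqnorm1 f.
Proof.
move=> e0; have [n nP] := edge_potential_bound e0; exists n%:R => // f g Lf Lg fg.
have [_ /le_trans] := nP f g Lf Lg fg; apply; rewrite lerD2l ler_wpM2l//.
have [mf If] := Lf.
apply: (Rint_subset measurable_edge (meas_itv _ _) (itv_edge (lexx 0)) If).
by move=> t _; rewrite mul1r sqr_ge0.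
Qed.

(** By Holder continuity, the values at the points of a fine enough mesh control the integral over
    [[0, n]] up to a small multiple of the energy. *)
Lemma edge_potential_compact e : 0 < e -> exists m (ts : 'I_m -> R) K, [/\ 0 <= K,
  forall i, 0 <= ts i & forall f g, L2u f -> L2u g -> primitive f g ->
  sqnorm v f <= e * (sqnorm1 f + sqnorm1 g) + K * \sum_(i < m) f (ts i) ^+ 2].
Proof.
move=> e0; have e2 : 0 < e / 2 by rewrite divr_gt0.
have [n nP] := edge_potential_bound e2.
(* With this mesh, the error n^2 * 2 h * sqnorm g is at most e / 2 * sqnorm g. *)
pose h := e / (4 * (n%:R ^+ 2 + 1)).
have n1 : 0 < n%:R ^+ 2 + 1 :> R by rewrite ltr_wpDl ?sqr_ge0.
have h0 : 0 < h by rewrite divr_gt0// mulr_gt0.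
pose m := (Num.truncn (n%:R / h)).+1.
exists m, (fun i => i%:R * h), (2 * n%:R ^+ 2); split.
- by rewrite mulr_ge0// sqr_ge0.
- by move=> i; rewrite mulr_ge0// ltW.
move=> f g Lf Lg fg; have [_ /le_trans] := nP f g Lf Lg fg; apply.
set S := \sum_(i < m) _.
have G0 : 0 <= sqnorm1 g := nrm_ge0 g weight1.
have F0 : 0 <= sqnorm1 f := nrm_ge0 f weight1.
have point t : 0 <= t <= n%:R -> 1 * f t ^+ 2 <= 2 * h * sqnorm1 g + 2 * S.
  move=> /andP[t0 tn]; pose i := Num.truncn (t / h).
  have th0 : 0 <= t / h by rewrite divr_ge0// ltW.
  have /andP[i1 i2] := truncn_itv th0.
  have im : (i < m)%N by rewrite ltnS; apply: le_truncn; rewrite ler_wpM2r// invr_ge0 ltW.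
  have ih : i%:R * h <= t by rewrite -ler_pdivlMr.
  have ih' : t - i%:R * h <= h.
    by move: (ltW i2); rewrite ler_pdivrMr// -natr1 mulrDl mul1r -/i; lra.
  have ih0 : 0 <= i%:R * h by rewrite mulr_ge0// ltW.
  have := prim_holder Lg fg ih0 ih.
  have : f (i%:R * h) ^+ 2 <= S.
    rewrite /S (bigD1 (Ordinal im))//= lerDl sumr_ge0// => j _; exact: sqr_ge0.
  have : (t - i%:R * h) * sqnorm1 g <= h * sqnorm1 g by rewrite ler_wpM2r.
  set x := f t; set y := f _ => h1 h2 h3.
  have := sqr_ge0 (x - 2 * y); nra.
have : \int[mu]_(t in `[0, n%:R]) (1 * f t ^+ 2) <= n%:R * (2 * h * sqnorm1 g + 2 * S).
  have -> : n%:R * (2 * h * sqnorm1 g + 2 * S) =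
      \int[mu]_(t in `[0, n%:R]) (2 * h * sqnorm1 g + 2 * S).
    by rewrite Rint_cst// subr0 mulrC.
  apply: le_Rint; [exact: meas_itv| |exact: integ_cst|].
    exact: (integS measurable_edge (meas_itv _ _) (itv_edge (lexx 0)) Lf.2).
  by move=> t /=; rewrite in_itv /=; exact: point.
move=> le1; have := ler_wpM2l (ler0n R n) le1.
have -> : n%:R * (n%:R * (2 * h * sqnorm1 g + 2 * S)) =
   n%:R ^+ 2 * (2 * h) * sqnorm1 g + 2 * n%:R ^+ 2 * S by ring.
have : n%:R ^+ 2 * (2 * h) * sqnorm1 g <= e / 2 * sqnorm1 g.
  rewrite ler_wpM2r// /h.
  have -> : n%:R ^+ 2 * (2 * (e / (4 * (n%:R ^+ 2 + 1)))) =
    e / 2 * (n%:R ^+ 2 / (n%:R ^+ 2 + 1)) by field; rewrite gt_eqF.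
  by rewrite ler_piMr ?(ltW e2)// ler_pdivrMr// mul1r lerDl.
have : 0 <= e / 2 * sqnorm1 f by rewrite mulr_ge0// ltW.
set X := n%:R * \int[mu]_(t in _) _; lra.
Qed.

End Potential.

(** * Complex-valued functions on an edge *)

Section ComplexFunctions.
Context {R : realType}.
Local Notation mu := (@lebesgue_measure R).
Local Notation edge := (@edge R).
Implicit Types (w : R -> R) (f g k : R -> R[i]).

Definition re f t : R := complex.Re (f t).
Definition im f t : R := complex.Im (f t).

(** The prefix c marks the versions for complex-valued functions on an edge, and g those for
    functions on the graph. *)
Definition cL2 w f := L2 w (re f) /\ L2 w (im f).

Definition cip w f g : R[i] :=
  (ip w (re f) (re g) + ip w (im f) (im g)) +i*
  (ip w (im f) (re g) - ip w (re f) (im g)).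

Definition csqnorm w f := sqnorm w (re f) + sqnorm w (im f).

Definition cprimitive f g := primitive (re f) (re g) /\ primitive (im f) (im g).

Lemma re_comb (a : R[i]) f g : re (fun t => a * f t + g t) =
  fun t => complex.Re a * re f t + ((- complex.Im a) * im f t + re g t).
Proof. by apply/funext => t; rewrite /re /im; case: a (f t) (g t) => a b [x y] [z u] /=; ring. Qed.

Lemma im_comb (a : R[i]) f g : im (fun t => a * f t + g t) =
  fun t => complex.Re a * im f t + (complex.Im a * re f t + im g t).
Proof. by apply/funext => t; rewrite /re /im; case: a (f t) (g t) => a b [x y] [z u] /=; ring. Qed.

Lemma cL2_lin w a f g : weight w -> cL2 w f -> cL2 w g -> cL2 w (fun t => a * f t + g t).
Proof.
move=> ww [L1 L2] [L3 L4]; split.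
  by rewrite re_comb; do 2 apply: L2_lin => //.
by rewrite im_comb; do 2 apply: L2_lin => //.
Qed.

Lemma cL2_0 w : cL2 w (fun=> 0).
Proof. by split; exact: L2_0. Qed.

Lemma cip_lin w a f g k : weight w -> cL2 w f -> cL2 w g -> cL2 w k ->
  cip w (fun t => a * f t + g t) k = a * cip w f k + cip w g k.
Proof.
move=> ww [L1 L2] [L3 L4] [L5 L6]; rewrite /cip re_comb im_comb.
have LA := L2_lin (- complex.Im a) ww L2 L3.
have LB := L2_lin (complex.Im a) ww L1 L4.
rewrite !ip_lin//.
by case: a LA LB => a b _ _; simpc; congr (_ +i* _) => /=; ring.
Qed.

Lemma cip_herm w f g : cip w g f = (cip w f g)^*.
Proof.
rewrite /cip /=; congr (_ +i* _).
  by rewrite (ipC w (re g)) (ipC w (im g)).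
by rewrite (ipC w (im g)) (ipC w (re g)) opprB.
Qed.

Lemma cip_diag w f : cip w f f = (csqnorm w f)%:C.
Proof. by rewrite /cip /csqnorm; congr (_ +i* _); rewrite (ipC w (im f)) subrr. Qed.

Lemma cnrm_ge0 w f : weight w -> 0 <= csqnorm w f.
Proof. by move=> ww; rewrite addr_ge0// nrm_ge0. Qed.

Lemma cip_prod w f g : weight w -> cL2 w f -> cL2 w g ->
  integ edge (fun t => complex.Re ((w t)%:C * (f t * (g t)^*))) /\
  integ edge (fun t => complex.Im ((w t)%:C * (f t * (g t)^*))).
Proof.
move=> ww [L1 L2] [L3 L4]; split.
  apply: eq_integ (integD measurable_edge (L2_prod ww L1 L3) (L2_prod ww L2 L4)) => // t _.
  by rewrite /re /im; case: (f t) (g t) => [x y] [z u] /=; ring.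
apply: eq_integ (integB measurable_edge (L2_prod ww L2 L3) (L2_prod ww L1 L4)) => // t _.
by rewrite /re /im; case: (f t) (g t) => [x y] [z u] /=; ring.
Qed.

Lemma cipE w f g : weight w -> cL2 w f -> cL2 w g ->
  Cintegral (fun t => (w t)%:C * (f t * (g t)^*)) = cip w f g.
Proof.
move=> ww [L1 L2] [L3 L4]; rewrite /Cintegral /cip; congr (_ +i* _).
  rewrite /ip -RintD//; try exact: L2_prod.
  by apply: eq_Rint => t _; rewrite /re /im; case: (f t) (g t) => [x y] [z u] /=; ring.
rewrite /ip -RintB//; try exact: L2_prod.
by apply: eq_Rint => t _; rewrite /re /im; case: (f t) (g t) => [x y] [z u] /=; ring.
Qed.

Definition Cint f := integ edge (re f) /\ integ edge (im f).

Lemma CintegralD f g : Cint f -> Cint g ->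
  Cintegral (fun t => f t + g t) = Cintegral f + Cintegral g.
Proof.
move=> [f1 f2] [g1 g2]; rewrite /Cintegral; simpc; congr (_ +i* _).
  by rewrite -RintD//; apply: eq_Rint => t _; exact: ReD.
by rewrite -RintD//; apply: eq_Rint => t _; exact: ImD.
Qed.

Lemma CintD f g : Cint f -> Cint g -> Cint (fun t => f t + g t).
Proof.
move=> [f1 f2] [g1 g2]; split.
  by apply: eq_integ (integD measurable_edge f1 g1) => // t _; rewrite /re ReD.
by apply: eq_integ (integD measurable_edge f2 g2) => // t _; rewrite /im ImD.
Qed.

Lemma CintN f : Cint f -> Cint (fun t => - f t).
Proof.
move=> [f1 f2]; split.
  by apply: eq_integ (integN measurable_edge f1) => // t _; rewrite /re; case: (f t).
by apply: eq_integ (integN measurable_edge f2) => // t _; rewrite /im; case: (f t).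
Qed.

Lemma CintegralN f : Cint f -> Cintegral (fun t => - f t) = - Cintegral f.
Proof.
move=> [f1 f2]; rewrite /Cintegral; simpc; congr (_ +i* _); rewrite -mulN1r -RintZ//;
  by apply: eq_Rint => t _; rewrite mulN1r; case: (f t).
Qed.

Lemma normc_sqr (z : R[i]) : ComplexField.Normc.normc z ^+ 2 = nsq z.
Proof. by case: z => x y; rewrite /nsq /= sqr_sqrtr// addr_ge0 ?sqr_ge0. Qed.

Lemma weighted_L2E w f : weight w -> weighted_L2 w f <-> cL2 w f.
Proof.
move=> ww; have [mw w0] := ww.
have E (m1 : measurable_fun edge (re f)) (m2 : measurable_fun edge (im f)) :
    (\int[mu]_(t in edge) (w t * ComplexField.Normc.normc (f t) ^+ 2)%:E =
    \int[mu]_(t in edge) (w t * re f t ^+ 2)%:E +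
    \int[mu]_(t in edge) (w t * im f t ^+ 2)%:E)%E.
  have n0 (h : R -> R) t : edge t -> (0%:E <= (w t * h t ^+ 2)%:E)%E.
    by move=> /edge_ge0 t0; rewrite lee_fin mulr_ge0 ?w0// sqr_ge0.
  have mh (h : R -> R) : measurable_fun edge h ->
      measurable_fun (edge : set (measurableTypeR R)) (fun t => (w t * h t ^+ 2)%:E).
    by move=> m; apply/measurable_EFinP; exact: (meas_wf2 mw m).
  rewrite -(ge0_integralD _ measurable_edge (n0 _) (mh _ m1) (n0 _) (mh _ m2)).
  by apply: eq_integral => t _; rewrite normc_sqr /nsq mulrDr EFinD.
split.
  move=> [m1 m2]; rewrite E//.
  have i0 (h : R -> R) : (0 <= \int[mu]_(t in edge) (w t * h t ^+ 2)%:E)%E.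
    by apply: integral_ge0 => t /edge_ge0 t0; rewrite lee_fin mulr_ge0 ?w0// sqr_ge0.
  move=> fi; split; apply/(L2P ww) => //; apply: le_lt_trans fi.
    by rewrite leeDl.
  by rewrite leeDr.
move=> [Lr Li]; have [m1 _] := Lr; have [m2 _] := Li.
split=> //; rewrite E// lte_add_pinfty//; exact/(L2P ww).
Qed.

Lemma edge_L2E f : edge_L2 f <-> cL2 (fun=> 1) f.
Proof. exact: weighted_L2E weight1. Qed.

Lemma weak_derivativeE f g :
  weak_derivative f g <-> real_weak_derivative (re f) (re g) /\ real_weak_derivative (im f) (im g).
Proof.
have E1 h (k : R -> R) : (\int[mu]_(t in edge) complex.Re (h t * (k t)%:C)) =
    \int[mu]_(t in edge) (re h t * k t).
  by apply: eq_Rint => t _; rewrite /re; case: (h t) => x y /=; ring.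
have E2 h (k : R -> R) : (\int[mu]_(t in edge) complex.Im (h t * (k t)%:C)) =
    \int[mu]_(t in edge) (im h t * k t).
  by apply: eq_Rint => t _; rewrite /im; case: (h t) => x y /=; ring.
split=> [H|[H1 H2] phi tphi].
  split=> phi /H; rewrite /Cintegral !E1 !E2; simpc; by case.
by rewrite /Cintegral !E1 !E2; simpc; rewrite H1// H2.
Qed.

Lemma cprim_weak f g : cL2 (fun=> 1) g -> cprimitive f g -> weak_derivative f g.
Proof. by move=> [L1 L2] [p1 p2]; apply/weak_derivativeE; split; exact: prim_rweak. Qed.

(** The continuous representative of a function of H^1 is the primitive of its weak derivative. *)
Lemma edge_H1P f : edge_H1 f <-> exists g,
  [/\ cL2 (fun=> 1) f, cL2 (fun=> 1) g & cprimitive f g].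
Proof.
split=> [[c1 c2 /edge_L2E Lf [g [/edge_L2E Lg /weak_derivativeE[w1 w2]]]]|].
  exists g; split=> //; split; [exact: rweak_prim c1 Lg.1 w1|exact: rweak_prim c2 Lg.2 w2].
move=> [g [Lf Lg fg]]; split.
- exact: prim_continuous Lg.1 fg.1.
- exact: prim_continuous Lg.2 fg.2.
- exact/edge_L2E.
- by exists g; split; [exact/edge_L2E|exact: cprim_weak].
Qed.

Lemma edge_H1_L2 f : edge_H1 f -> cL2 (fun=> 1) f.
Proof. by move=> /edge_H1P[g []]. Qed.

Lemma wderivP f : edge_H1 f -> cL2 (fun=> 1) (wderiv f) /\ cprimitive f (wderiv f).
Proof.
move=> Hf; have [c1 c2 _ [g gP]] := Hf.
have : [set g | edge_L2 g /\ weak_derivative f g] (wderiv f).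
  by apply: (xgetPex (fun=> 0)); exists g.
move=> [/edge_L2E Lw /weak_derivativeE[w1 w2]]; split => //.
by split; [exact: rweak_prim c1 Lw.1 w1|exact: rweak_prim c2 Lw.2 w2].
Qed.

Lemma cprim_lin a f g f' g' : cL2 (fun=> 1) g -> cL2 (fun=> 1) g' ->
  cprimitive f g -> cprimitive f' g' ->
  cprimitive (fun t => a * f t + f' t) (fun t => a * g t + g' t).
Proof.
move=> [L1 L2] [L3 L4] [p1 p2] [p3 p4]; split.
  rewrite !re_comb; apply: prim_lin => //; first exact: L2_lin weight1 L2 L3.
  exact: prim_lin.
rewrite !im_comb; apply: prim_lin => //; first exact: L2_lin weight1 L1 L4.
exact: prim_lin.
Qed.

Lemma edge_H1_lin a f f' : edge_H1 f -> edge_H1 f' -> edge_H1 (fun t => a * f t + f' t).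
Proof.
move=> Hf Hf'; have [L1 p1] := wderivP Hf; have [L2 p2] := wderivP Hf'.
apply/edge_H1P; exists (fun t => a * wderiv f t + wderiv f' t); split.
- by apply: cL2_lin weight1 _ _; exact: edge_H1_L2.
- exact: cL2_lin weight1 L1 L2.
- exact: cprim_lin.
Qed.

(** Weak derivatives are unique only in this sense. *)
Definition aeq f g := {ae mu, forall t, edge t -> re f t = re g t} /\
  {ae mu, forall t, edge t -> im f t = im g t}.

Lemma wderiv_unique f g : edge_H1 f -> cL2 (fun=> 1) g -> cprimitive f g -> aeq (wderiv f) g.
Proof.
move=> Hf [L1 L2] [p1 p2]; have [[L3 L4] [p3 p4]] := wderivP Hf.
by split; [exact: prim_unique p3 p1|exact: prim_unique p4 p2].
Qed.

Lemma ip_ae w (f f' g : R -> R) : weight w -> L2 w f -> L2 w f' -> L2 w g ->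
  {ae mu, forall t, edge t -> f t = f' t} -> ip w f g = ip w f' g.
Proof.
move=> ww L1 L2 L3 ff'; apply: ae_eq_Rint => //.
- exact: integ_meas (L2_prod ww L1 L3).
- exact: integ_meas (L2_prod ww L2 L3).
- by apply: ae_imply ff' => t + et => /(_ et) ->.
Qed.

Lemma cip_ae w f f' g : weight w -> cL2 w f -> cL2 w f' -> cL2 w g -> aeq f f' ->
  cip w f g = cip w f' g.
Proof.
move=> ww [L1 L2] [L3 L4] [L5 L6] [e1 e2]; rewrite /cip.
by rewrite !(ip_ae ww L1 L3 _ e1)// !(ip_ae ww L2 L4 _ e2).
Qed.

End ComplexFunctions.

(** * Forms on the graph *)

Section GraphForms.
Context {R : realType} {N : nat}.
Local Notation mu := (@lebesgue_measure R).
Local Notation edge := (@edge R).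
Local Notation E := ('I_N -> R -> R[i]).
Implicit Types (psi phi : E) (w v : 'I_N -> R -> R).

Definition gweight w := forall j, weight (w j).
Definition gL2 w psi := forall j, cL2 (w j) (psi j).
Definition gip w psi phi : R[i] := \sum_j cip (w j) (psi j) (phi j).
Definition unit_weight : 'I_N -> R -> R := fun _ _ => 1.
Definition kinetic psi phi : R[i] := gip unit_weight (fun j => wderiv (psi j)) (fun j => wderiv (phi j)).

Lemma gweight1 : gweight unit_weight. Proof. by move=> j; exact: weight1. Qed.

Lemma gL2_subspace w : gweight w -> subspace (gL2 w).
Proof.
move=> ww; split; first by move=> j; exact: cL2_0.
by move=> a u v Lu Lv j; exact: cL2_lin.
Qed.

Lemma gip_hermitian w : gweight w -> hermitian (gL2 w) (gip w).
Proof.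
move=> ww; split.
  move=> a u v k Lu Lv Lk; rewrite /gip mulr_sumr -big_split /=.
  by apply: eq_bigr => j _; exact: cip_lin.
move=> u v _ _; rewrite /gip rmorph_sum; apply: eq_bigr => j _.
exact: cip_herm.
Qed.

Lemma hermitian_sub (D D' : E -> Prop) h : (forall u, D u -> D' u) ->
  hermitian D' h -> hermitian D h.
Proof.
move=> DD' [h1 h2]; split; first by move=> a u v w /DD' ? /DD' ? /DD' ?; exact: h1.
by move=> u v /DD' ? /DD' ?; exact: h2.
Qed.

Lemma gip_diag w psi : diag (gip w) psi = \sum_j csqnorm (w j) (psi j).
Proof. by rewrite /diag /gip Re_sum; apply: eq_bigr => j _; rewrite cip_diag. Qed.

Lemma gip_ge0 w psi : gweight w -> 0 <= diag (gip w) psi.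
Proof. by move=> ww; rewrite gip_diag sumr_ge0// => j _; exact: cnrm_ge0. Qed.

Definition gH1 psi := forall j, edge_H1 (psi j).

Lemma gH1_subspace : subspace gH1.
Proof.
split; last by move=> a u v Hu Hv j; exact: edge_H1_lin.
move=> j; apply/edge_H1P; exists (fun=> 0); split; [exact: cL2_0|exact: cL2_0|].
have p0 : primitive (fun=> 0 : R) (fun=> 0) by move=> t t0; rewrite Rintegral_cst ?mul0r ?addr0.
by split.
Qed.

Lemma gH1_L2 psi : gH1 psi -> gL2 unit_weight psi.
Proof. by move=> H j; exact: edge_H1_L2. Qed.

Lemma gH1_wL2 psi : gH1 psi -> gL2 unit_weight (fun j => wderiv (psi j)).
Proof. by move=> H j; case: (wderivP (H j)). Qed.

Lemma wderiv_lin a psi phi j : gH1 psi -> gH1 phi ->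
  aeq (wderiv ((a *: psi + phi) j)) (fun t => a * wderiv (psi j) t + wderiv (phi j) t).
Proof.
move=> Hp Hf; have [L1 p1] := wderivP (Hp j); have [L2 p2] := wderivP (Hf j).
apply: wderiv_unique; first exact: edge_H1_lin.
  exact: cL2_lin weight1 L1 L2.
exact: cprim_lin.
Qed.

Lemma kinetic_hermitian : hermitian gH1 kinetic.
Proof.
split; last by move=> u v Hu Hv; apply: (gip_hermitian gweight1).2; exact: gH1_wL2.
move=> a u v k Hu Hv Hk; rewrite /kinetic /gip mulr_sumr -big_split /=.
apply: eq_bigr => j _.
have L1 := gH1_wL2 Hu j; have L2 := gH1_wL2 Hv j; have L3 := gH1_wL2 Hk j.
have L0 : cL2 (fun=> 1) (wderiv ((a *: u + v) j)).
  by apply: (gH1_wL2 _ j); exact: gH1_subspace.2.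
have L12 := cL2_lin a weight1 L1 L2.
rewrite (cip_ae weight1 L0 L12 L3 (wderiv_lin a j Hu Hv)).
exact: (cip_lin a weight1 L1 L2 L3).
Qed.

Lemma kinetic_ge0 psi : 0 <= diag kinetic psi.
Proof. exact: gip_ge0 gweight1. Qed.

(** What admissibility says about the negative part of the potential. *)
Definition Lp_potential v := gweight v /\ exists2 p : R, 1 <= p &
  forall j, (\int[mu]_(t in edge) (v j t `^ p)%:E < +oo)%E.

Section FixedPotential.
Variables (v : 'I_N -> R -> R) (hv : Lp_potential v).

Lemma gH1_vL2 psi : gH1 psi -> gL2 v psi.
Proof.
move=> H j; have [wv [p p1 vp]] := hv; have [mv v0] := wv j.
have [[L1 L2] [p3 p4]] := wderivP (H j); have [L3 L4] := edge_H1_L2 (H j).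
have [n nP] := edge_potential_bound mv v0 p1 (vp j) ltr01.
by split; [case: (nP _ _ L3 L1 p3)|case: (nP _ _ L4 L2 p4)].
Qed.

Definition edge_energy (f : R -> R[i]) : R := csqnorm (fun=> 1) (wderiv f) + csqnorm (fun=> 1) f.

Lemma energyE psi : diag kinetic psi + diag (gip unit_weight) psi = \sum_j edge_energy (psi j).
Proof.
rewrite gip_diag -[diag kinetic psi]/(diag (gip unit_weight) (fun j => wderiv (psi j))) gip_diag.
by rewrite -big_split.
Qed.

Lemma edge_energy_ge0 f : 0 <= edge_energy f.
Proof. by rewrite addr_ge0// cnrm_ge0//; exact: weight1. Qed.

Lemma edge_energy_comp f : edge_H1 f ->
  edge_energy f = (sqnorm (fun=> 1) (re f) + sqnorm (fun=> 1) (re (wderiv f))) +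
                  (sqnorm (fun=> 1) (im f) + sqnorm (fun=> 1) (im (wderiv f))).
Proof. by move=> _; rewrite /edge_energy /csqnorm; ring. Qed.

Lemma potential_bounded (D : E -> Prop) : (forall u, D u -> gH1 u) ->
  form_bounded D kinetic (gip unit_weight) (gip v).
Proof.
move=> DH; rewrite /form_bounded /= => eps e0; have [wv [p p1 vp]] := hv.
have /choice[M MP] : forall j, exists M, 0 <= M /\ forall f g, L2 (fun=> 1) f -> L2 (fun=> 1) g ->
    primitive f g -> sqnorm (v j) f <=
      eps * (sqnorm (fun=> 1) f + sqnorm (fun=> 1) g) + M * sqnorm (fun=> 1) f.
  move=> j; have [mv v0] := wv j.
  by have [M M0 MP] := edge_potential_bounded mv v0 p1 (vp j) e0; exists M.
exists (\sum_j M j) => u /DH Hu; rewrite energyE gip_diag [diag (gip unit_weight) u]gip_diag.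
rewrite mulr_sumr mulr_sumr -big_split /=; apply: ler_sum => j _.
have [[L1 L2] [p3 p4]] := wderivP (Hu j); have [L3 L4] := edge_H1_L2 (Hu j).
have [M0 MPj] := MP j.
have := MPj _ _ L3 L1 p3; have := MPj _ _ L4 L2 p4.
have : M j * csqnorm (fun=> 1) (u j) <= (\sum_i M i) * csqnorm (fun=> 1) (u j).
  apply: (ler_wpM2r (cnrm_ge0 _ weight1)).
  by rewrite (bigD1 j)//= lerDl sumr_ge0// => i _; case: (MP i).
rewrite edge_energy_comp// /csqnorm /unit_weight.
set a := sqnorm _ _; set b := sqnorm _ _; set c := sqnorm _ _; set d := sqnorm _ _; lra.
Qed.

Lemma potential_compact (D : E -> Prop) : subspace D -> (forall u, D u -> gH1 u) ->
  form_compact D kinetic (gip unit_weight) (gip v).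
Proof.
move=> sD DH; rewrite /form_compact /= => eps e0; have [wv [p p1 vp]] := hv.
pose Q j (m : nat) (ts : 'I_m -> R) (K : R) := [/\ 0 <= K, forall i, 0 <= ts i &
  forall f g, L2 (fun=> 1) f -> L2 (fun=> 1) g -> primitive f g ->
  sqnorm (v j) f <= eps * (sqnorm (fun=> 1) f + sqnorm (fun=> 1) g) + K * \sum_(i < m) f (ts i) ^+ 2].
have /choice[S SP] : forall j, exists x : {m : nat & ('I_m -> R) * R}%type,
    Q j (tag x) (tagged x).1 (tagged x).2.
  move=> j; have [mv v0] := wv j.
  have [m [ts [K KP]]] := edge_potential_compact mv v0 p1 (vp j) e0.
  by exists (Tagged (fun m => ('I_m -> R) * R)%type (ts, K)).
pose m j := tag (S j); pose ts j : 'I_(m j) -> R := (tagged (S j)).1.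
pose K j : R := (tagged (S j)).2.
have K0 j : 0 <= K j by case: (SP j).
have ts0 j i : 0 <= ts j i by have [_ + _] := SP j; exact.
have KP j f g : L2 (fun=> 1) f -> L2 (fun=> 1) g -> primitive f g ->
    sqnorm (v j) f <= eps * (sqnorm (fun=> 1) f + sqnorm (fun=> 1) g) + K j * \sum_i f (ts j i) ^+ 2.
  by have [_ _] := SP j; exact.
pose I := ({j : 'I_N & 'I_(m j)} * bool)%type.
pose l (x : I) (u : E) : R :=
  (if x.2 then re else im) (u (tag x.1)) (ts (tag x.1) (tagged x.1)).
exists I, l, (\sum_j K j + 2); split.
- by rewrite addr_ge0// sumr_ge0.
- move=> [[j i] []] a b _ _; rewrite /l /= /re /im.
    by rewrite -[LHS]/(complex.Re (a j _ - b j _)); case: (a j _) (b j _) => [x y] [z t].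
  by rewrite -[LHS]/(complex.Im (a j _ - b j _)); case: (a j _) (b j _) => [x y] [z t].
- move=> [[j i] c] u /DH Hu.
  have [[L1 L2] [p3 p4]] := wderivP (Hu j); have [L3 L4] := edge_H1_L2 (Hu j).
  have e1 : edge_energy (u j) <= \sum_j edge_energy (u j).
    by rewrite (bigD1 j)//= lerDl sumr_ge0// => k _; exact: edge_energy_ge0.
  have e2 : l (Tagged (fun j => 'I_(m j)) i, c) u ^+ 2 <= 2 * edge_energy (u j).
    rewrite edge_energy_comp//.
    have := prim_sup L3 L1 p3 (ts0 j i); have := prim_sup L4 L2 p4 (ts0 j i).
    have := nrm_ge0 (re (u j)) weight1; have := nrm_ge0 (im (u j)) weight1.
    have := nrm_ge0 (re (wderiv (u j))) weight1; have := nrm_ge0 (im (wderiv (u j))) weight1.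
    rewrite /l /=; set x := sqnorm _ _; set y := sqnorm _ _; set z := sqnorm _ _; set t := sqnorm _ _.
    case: c; set q := _ ^+ 2; set q' := _ ^+ 2; lra.
  rewrite energyE mulrDl; have : 0 <= (\sum_j K j) * \sum_j edge_energy (u j).
    by rewrite mulr_ge0 ?sumr_ge0// => k _; exact: edge_energy_ge0.
  move: e1 e2; set A := edge_energy _; set B := \sum_j edge_energy _; set C := _ ^+ 2; lra.
move=> u /DH Hu; rewrite energyE gip_diag.
have E : \sum_(x : I) l x u ^+ 2 = \sum_j \sum_(i < m j)
    (re (u j) (ts j i) ^+ 2 + im (u j) (ts j i) ^+ 2).
  rewrite -(pair_bigA _ (fun x c => l (x, c) u ^+ 2)) /=.
  rewrite (sig_big_dep _ _ (fun j i => re (u j) (ts j i) ^+ 2 + im (u j) (ts j i) ^+ 2)) /=.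
  by apply: eq_bigr => -[j i] _; rewrite big_bool.
rewrite E !mulr_sumr -big_split /=; apply: ler_sum => j _.
have [[L1 L2] [p3 p4]] := wderivP (Hu j); have [L3 L4] := edge_H1_L2 (Hu j).
have := KP j _ _ L3 L1 p3; have := KP j _ _ L4 L2 p4.
rewrite big_split /=; set s1 := \sum_(i < m j) re _ _ ^+ 2; set s2 := \sum_(i < m j) im _ _ ^+ 2.
have s10 : 0 <= s1 by rewrite sumr_ge0// => i _; exact: sqr_ge0.
have s20 : 0 <= s2 by rewrite sumr_ge0// => i _; exact: sqr_ge0.
have KK : K j <= \sum_i K i + 2.
  by rewrite (bigD1 j)//= -addrA lerDl addr_ge0// sumr_ge0.
have := ler_wpM2r s10 KK; have := ler_wpM2r s20 KK.
rewrite edge_energy_comp// /csqnorm.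
set a := sqnorm _ _; set b := sqnorm _ _; set c := sqnorm _ _; set d := sqnorm _ _; lra.
Qed.

End FixedPotential.
End GraphForms.

(** * Continuity at the vertex, possibly relaxed *)

Section VertexDomains.
Context {R : realType} {N : nat}.
Local Notation mu := (@lebesgue_measure R).
Local Notation edge := (@edge R).
Local Notation E := ('I_N -> R -> R[i]).
Local Notation L2u := (L2 (fun=> 1)).
Local Notation sqnorm1 := (sqnorm (fun=> 1)).
Implicit Types (psi phi : E) (v : 'I_N -> R -> R).

Lemma nrm_ae (f g : R -> R) : L2u f -> L2u g ->
  {ae mu, forall t, edge t -> f t = g t} -> sqnorm1 f = sqnorm1 g.
Proof.
move=> Lf Lg fg; rewrite /sqnorm (ip_ae weight1 Lf Lg Lf fg) ipC.
exact: (ip_ae weight1 Lf Lg Lg fg).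
Qed.

Lemma edge_energyE (f g : R -> R[i]) : edge_H1 f -> cL2 (fun=> 1) g -> cprimitive f g ->
  edge_energy f = (sqnorm1 (re f) + sqnorm1 (re g)) + (sqnorm1 (im f) + sqnorm1 (im g)).
Proof.
move=> Hf Lg fg; rewrite edge_energy_comp//.
have [Lw _] := wderivP Hf; have [e1 e2] := wderiv_unique Hf Lg fg.
by rewrite (nrm_ae Lw.1 Lg.1 e1) (nrm_ae Lw.2 Lg.2 e2).
Qed.

Lemma cprim_sub (f g f' g' : R -> R[i]) : cL2 (fun=> 1) g -> cL2 (fun=> 1) g' ->
  cprimitive f g -> cprimitive f' g' ->
  cprimitive (fun t => f t - f' t) (fun t => g t - g' t).
Proof.
move=> L1 L2 p1 p2; have := cprim_lin (-1) L2 L1 p2 p1.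
by under eq_fun do rewrite mulN1r addrC; under [X in cprimitive _ X]eq_fun do rewrite mulN1r addrC.
Qed.

Lemma cL2_sub w (f g : R -> R[i]) : weight w -> cL2 w f -> cL2 w g ->
  cL2 w (fun t => f t - g t).
Proof.
move=> ww L1 L2; have := cL2_lin (-1) ww L2 L1.
by under eq_fun do rewrite mulN1r addrC.
Qed.

Lemma re_sub (f g : R -> R[i]) : re (fun t => f t - g t) = fun t => re f t - re g t.
Proof. by apply/funext => t; rewrite /re; case: (f t) (g t) => [x y] [z u]. Qed.

Lemma im_sub (f g : R -> R[i]) : im (fun t => f t - g t) = fun t => im f t - im g t.
Proof. by apply/funext => t; rewrite /im; case: (f t) (g t) => [x y] [z u]. Qed.

Lemma edge_H1_sub (f g : R -> R[i]) : edge_H1 f -> edge_H1 g ->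
  edge_H1 (fun t => f t - g t).
Proof.
move=> Hf Hg; have := edge_H1_lin (-1) Hg Hf.
by under eq_fun do rewrite mulN1r addrC.
Qed.

Lemma edge_energy_sub (f g f' g' : R -> R[i]) : edge_H1 f -> edge_H1 f' ->
  cL2 (fun=> 1) g -> cL2 (fun=> 1) g' -> cprimitive f g -> cprimitive f' g' ->
  edge_energy (fun t => f t - f' t) =
  (sqnorm1 (fun t => re f t - re f' t) + sqnorm1 (fun t => re g t - re g' t)) +
  (sqnorm1 (fun t => im f t - im f' t) + sqnorm1 (fun t => im g t - im g' t)).
Proof.
move=> Hf Hf' Lg Lg' p p'.
rewrite (edge_energyE (edge_H1_sub Hf Hf') (cL2_sub weight1 Lg Lg') (cprim_sub Lg Lg' p p')).
by rewrite !re_sub !im_sub.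
Qed.

Section Blocks.
Variables (B : Type) (blk : 'I_N -> B).

(** The edges are grouped by [blk], and the values at the vertex have to agree within each group.
    A constant [blk] gives the form domain of the star graph without positive potential; pairs
    give a disjoint union of lines. *)
Definition vertex_domain psi := gH1 psi /\ forall i j, blk i = blk j -> psi i 0 = psi j 0.

Lemma vertex_domain_H1 psi : vertex_domain psi -> gH1 psi. Proof. by case. Qed.

Lemma vertex_domain_subspace : subspace vertex_domain.
Proof.
split; first by split=> //; exact: gH1_subspace.1.
move=> a u v [Hu Vu] [Hv Vv]; split; first exact: gH1_subspace.2.
by move=> i j ij; rewrite -[LHS]/(a * u i 0 + v i 0) (Vu i j ij) (Vv i j ij).
Qed.

(** Convergence in energy includes convergence of the values at the vertex, so the conditions there
    pass to the limit. *)
Lemma vertex_domain_complete : form_complete vertex_domain kinetic (gip unit_weight).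
Proof.
rewrite /form_complete /= => u Du uC.
have Hu n : gH1 (u n) := (Du n).1.
pose dist n j := edge_energy (fun t => u n j t).
have C j n m : (n <= m)%N ->
    edge_energy (fun t => u n j t - u m j t) <= 16^-1 ^+ n.
  move=> nm; apply: le_trans (uC n m nm); rewrite energyE (bigD1 j)//= lerDl.
  by rewrite sumr_ge0// => i _; exact: edge_energy_ge0.
have /choice[W WP] : forall j, exists W : R -> R[i], edge_H1 W /\
    (forall n, edge_energy (fun t => u n j t - W t) <= 4 * 16^-1 ^+ n) /\
    ((fun n => re (u n j) 0) @ \oo --> re W 0 /\ (fun n => im (u n j) 0) @ \oo --> im W 0).
  move=> j.
  have L n := (wderivP (Hu n j)).1; have p n := (wderivP (Hu n j)).2.
  have Lf n := edge_H1_L2 (Hu n j).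
  have Cj n m (nm : (n <= m)%N) := C j n m nm.
  have [||||Fr [Gr [LF LG FG nF F0]]] :=
    @prim_complete R (fun n => re (u n j)) (fun n => re (wderiv (u n j))).
  - by move=> n; exact: (Lf n).1.
  - by move=> n; exact: (L n).1.
  - by move=> n; exact: (p n).1.
  - move=> n m nm; apply: le_trans (Cj n m nm).
    rewrite (edge_energy_sub (Hu n j) (Hu m j) (L n) (L m) (p n) (p m)) lerDl.
    by rewrite addr_ge0// nrm_ge0//; exact: weight1.
  have [||||Fi [Gi [LFi LGi FGi nFi F0i]]] :=
    @prim_complete R (fun n => im (u n j)) (fun n => im (wderiv (u n j))).
  - by move=> n; exact: (Lf n).2.
  - by move=> n; exact: (L n).2.
  - by move=> n; exact: (p n).2.
  - move=> n m nm; apply: le_trans (Cj n m nm).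
    rewrite (edge_energy_sub (Hu n j) (Hu m j) (L n) (L m) (p n) (p m)) lerDr.
    by rewrite addr_ge0// nrm_ge0//; exact: weight1.
  pose W t := Fr t +i* Fi t; pose G t := Gr t +i* Gi t.
  have LW : cL2 (fun=> 1) W by [].
  have LG' : cL2 (fun=> 1) G by [].
  have pW : cprimitive W G by [].
  have HW : edge_H1 W by apply/edge_H1P; exists G.
  exists W; split=> //; split; last by split; exact: geometric_cvg.
  move=> n; rewrite (edge_energy_sub (Hu n j) HW (L n) LG' (p n) pW).
  by have := nF n; have := nFi n; rewrite /re /im /=; lra.
have Dist n : diag kinetic (u n - W) + diag (gip unit_weight) (u n - W) <= N%:R * (4 * 16^-1 ^+ n).
  rewrite energyE; apply: (@le_trans _ _ (\sum_(j < N) (4 * 16^-1 ^+ n))).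
    by apply: ler_sum => j _; case: (WP j) => _ [+ _]; apply.
  by rewrite sumr_const card_ord [leRHS]mulr_natl.
exists W.
  split; first by move=> j; case: (WP j).
  move=> i j ij.
  have [_ [_ [ri ii]]] := WP i; have [_ [_ [rj ij']]] := WP j.
  have rE : re (W i) 0 = re (W j) 0.
    have c' : (fun n => re (u n i) 0) @ \oo --> re (W j) 0.
      apply: cvg_trans rj; apply: near_eq_cvg; apply: nearW => n /=.
      by rewrite /re ((Du n).2 i j ij).
    exact: (cvg_unique _ ri c').
  have iE : im (W i) 0 = im (W j) 0.
    have c' : (fun n => im (u n i) 0) @ \oo --> im (W j) 0.
      apply: cvg_trans ij'; apply: near_eq_cvg; apply: nearW => n /=.
      by rewrite /im ((Du n).2 i j ij).
    exact: (cvg_unique _ ii c').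
  by move: rE iE; rewrite /re /im; case: (W i 0) (W j 0) => [x y] [z t] /= -> ->.
move=> eps e0.
have d0 : 0 < eps / (4 * (N%:R + 1)) by rewrite divr_gt0// mulr_gt0// ltr_wpDl.
have [n0 n0P] := half_small d0.
exists n0 => n nn; apply: (le_trans (Dist n)).
have : 16^-1 ^+ n <= 2^-1 ^+ n0 :> R.
  apply: (@le_trans _ _ (2^-1 ^+ n)).
    by apply: lerXn2r; rewrite ?nnegrE ?invr_ge0// lef_pV2 ?posrE// ler_nat.
  by rewrite ler_wiXn2l// ?invr_ge0// invf_le1// ler1n.
move=> /le_lt_trans/(_ n0P)/ltW; rewrite ler_pdivlMr; last by rewrite mulr_gt0// ltr_wpDl.
have q0 : 0 <= 16^-1 ^+ n :> R by rewrite exprn_ge0// invr_ge0.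
move: (16^-1 ^+ n) q0 => q q0.
have : 0 <= N%:R :> R by [].
move: N%:R => r r0; nra.
Qed.

Lemma vertex_domain_minimizers v : Lp_potential v ->
  has_minimizers vertex_domain (gip unit_weight) (fun u u' => kinetic u u' + (-1)%:C * gip v u u').
Proof.
move=> hv; apply: exists_minimizer.
- exact: vertex_domain_subspace.
- exact: hermitian_sub vertex_domain_H1 kinetic_hermitian.
- by apply: hermitian_sub (gip_hermitian gweight1) => u /vertex_domain_H1; exact: gH1_L2.
- by apply: hermitian_sub (gip_hermitian hv.1) => u /vertex_domain_H1; exact: gH1_vL2.
- by move=> u _; exact: kinetic_ge0.
- by move=> u _; exact: gip_ge0 gweight1.
- by move=> u _; exact: gip_ge0 hv.1.
- exact: potential_bounded hv _ vertex_domain_H1.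
- exact: potential_compact hv _ vertex_domain_subspace vertex_domain_H1.
- exact: vertex_domain_complete.
Qed.

End Blocks.
End VertexDomains.

(** * Eigenvectors of the Schrodinger operator *)

Section Schrodinger.
Context {R : realType} {N : nat}.
Local Notation mu := (@lebesgue_measure R).
Local Notation edge := (@edge R).
Local Notation E := ('I_N -> R -> R[i]).
Implicit Types (psi phi : E) (V : 'I_N -> R -> R).

Definition Vpos V : 'I_N -> R -> R := fun j => (V j)^\+.
Definition Vneg V : 'I_N -> R -> R := fun j => (V j)^\-.

Lemma admissible_weights V : admissible V -> gweight (Vpos V) /\ Lp_potential (Vneg V).
Proof.
move=> [mV [p [p1 Vp]] _]; split.
  move=> j; split; first exact: measurable_funrpos.
  by move=> t _; exact: funrpos_ge0.
split.
  move=> j; split; first exact: measurable_funrneg.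
  by move=> t _; exact: funrneg_ge0.
exists p => // j; apply: le_lt_trans Vp; rewrite /graph_integral (bigD1 j)//= leeDl//.
apply: sume_ge0 => i _; apply: integral_ge0 => t _.
by rewrite lee_fin powR_ge0.
Qed.

Lemma form_domainE V psi : admissible V ->
  form_domain V psi <-> vertex_domain (fun=> tt) psi /\ gL2 (Vpos V) psi.
Proof.
move=> /admissible_weights[wp _]; split.
  move=> [[H1 H2] H3]; split; first by split=> // i j _; exact: H2.
  by move=> j; apply/(weighted_L2E _ (wp j)); exact: H3.
move=> [[H1 H2] H3]; split; first by split=> // i j; exact: H2.
by move=> j; apply/(weighted_L2E _ (wp j)); exact: H3.
Qed.

(** The signs are written as scalar factors to fit [hermitian_lincomb]. *)
Definition hform V psi phi : R[i] :=
  (kinetic psi phi + 1%:C * gip (Vpos V) psi phi) + (-1)%:C * gip (Vneg V) psi phi.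

Section Admissible.
Variables (V : 'I_N -> R -> R) (aV : admissible V).

Let wp := (admissible_weights aV).1.
Let pot := (admissible_weights aV).2.

Lemma form_domain_H1 psi : form_domain V psi -> gH1 psi.
Proof. by move=> /(form_domainE _ aV)[[]]. Qed.

Lemma form_domain_subspace : subspace (form_domain V).
Proof.
have sv := @vertex_domain_subspace R N unit (fun=> tt); have sp := gL2_subspace wp.
split; first by apply/(form_domainE _ aV); split; [exact: sv.1|exact: sp.1].
move=> a u v /(form_domainE _ aV)[u1 u2] /(form_domainE _ aV)[v1 v2].
by apply/(form_domainE _ aV); split; [exact: sv.2|exact: sp.2].
Qed.

Lemma s_hermitian (D : E -> Prop) : (forall u, D u -> gH1 u) -> hermitian D (gip unit_weight).
Proof. by move=> DH; apply: hermitian_sub (gip_hermitian gweight1) => u /DH; exact: gH1_L2. Qed.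

Lemma hform_hermitian : hermitian (form_domain V) (hform V).
Proof.
apply: hermitian_lincomb; first apply: hermitian_lincomb.
- exact: hermitian_sub form_domain_H1 kinetic_hermitian.
- by apply: hermitian_sub (gip_hermitian wp) => u /(form_domainE _ aV)[].
- by apply: hermitian_sub (gip_hermitian pot.1) => u /form_domain_H1; exact: gH1_vL2.
Qed.

Lemma schrodinger_formE psi phi : form_domain V psi -> form_domain V phi ->
  schrodinger_form V psi phi = hform V psi phi.
Proof.
move=> Dpsi Dphi; have Hp := form_domain_H1 Dpsi; have Hf := form_domain_H1 Dphi.
have [_ Pp] := (form_domainE psi aV).1 Dpsi; have [_ Pf] := (form_domainE phi aV).1 Dphi.
have Np := gH1_vL2 pot Hp; have Nf := gH1_vL2 pot Hf.
have Wp := gH1_wL2 Hp; have Wf := gH1_wL2 Hf.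
rewrite /schrodinger_form /graph_Cintegral /hform /kinetic /gip !mulr_sumr -!big_split /=.
apply: eq_bigr => j _.
rewrite -(cipE weight1 (Wp j) (Wf j)) -(cipE (wp j) (Pp j) (Pf j)).
rewrite -(cipE (pot.1 j) (Np j) (Nf j)) mul1r rmorphN rmorph1 mulN1r.
have C1 := cip_prod weight1 (Wp j) (Wf j).
have C2 := cip_prod (wp j) (Pp j) (Pf j).
have C3 := cip_prod (pot.1 j) (Np j) (Nf j).
rewrite -(CintegralN C3) -(CintegralD C1 C2) -(CintegralD (CintD C1 C2) (CintN C3)).
congr Cintegral; apply/funext => t.
have -> : V j t = Vpos V j t - Vneg V j t.
  by rewrite -[in LHS](funrposBneg (V j)).
by rewrite rmorphB /= mul1r mulrBl addrA.
Qed.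

Lemma graph_innerE psi phi : gL2 unit_weight psi -> gL2 unit_weight phi ->
  graph_inner psi phi = gip unit_weight psi phi.
Proof.
move=> Lp Lf; apply: eq_bigr => j _; rewrite -(cipE weight1 (Lp j) (Lf j)).
by congr Cintegral; apply/funext => t; rewrite mul1r.
Qed.

(** For functions in the form domain all the integrals converge, so the form of the operator is
    the combination [hform] of the kinetic form and of two weighted inner products. *)
Lemma eigenvectorP lam psi : eigenvector V lam psi <->
  form_domain V psi /\ form_eigenvector (form_domain V) (gip unit_weight) (hform V) lam psi.
Proof.
have key phi : form_domain V psi -> form_domain V phi ->
    graph_inner (fun j t => lam%:C * psi j t) phi = lam%:C * gip unit_weight psi phi.
  move=> Dpsi Dphi; have Lp := gH1_L2 (form_domain_H1 Dpsi).
  have Lf := gH1_L2 (form_domain_H1 Dphi).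
  have sL := gL2_subspace (@gweight1 R N).
  rewrite -[fun j t => _]/(lam%:C *: psi) graph_innerE//.
    exact: (hermZ sL (gip_hermitian gweight1)).
  exact: (subspaceZ sL).
split.
  move=> [Dpsi _ H]; split=> // phi Dphi.
  by rewrite -schrodinger_formE// H// key.
move=> [Dpsi H]; split=> //.
  move=> j; apply/edge_L2E.
  exact: (subspaceZ (gL2_subspace gweight1) lam%:C (gH1_L2 (form_domain_H1 Dpsi))).
by move=> phi Dphi; rewrite key// schrodinger_formE// H.
Qed.

Lemma eigenvector_orthogonal lam lam' psi phi : lam != lam' ->
  eigenvector V lam psi -> eigenvector V lam' phi -> gip unit_weight psi phi = 0.
Proof.
move=> ll /eigenvectorP[Dp ep] /eigenvectorP[Df ef].
have h1 := ep _ Df; have h2 := ef _ Dp.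
have hs := s_hermitian form_domain_H1.
have : lam%:C * gip unit_weight psi phi = lam'%:C * gip unit_weight psi phi.
  rewrite -h1 (hform_hermitian.2 _ _ Df Dp) h2 (hs.2 _ _ Df Dp).
  by case: (gip unit_weight phi psi) => x y; simpc.
move=> /eqP; rewrite -subr_eq0 -mulrBl mulf_eq0 -rmorphB.
move=> /orP[/eqP [] /eqP|/eqP //].
by rewrite subr_eq0 (negbTE ll).
Qed.

End Admissible.
End Schrodinger.

(** * The trace as a supremum over orthonormal families *)

Section TraceAndFamilies.
Context {R : realType} {N : nat}.
Local Notation mu := (@lebesgue_measure R).
Local Notation edge := (@edge R).
Local Notation E := ('I_N -> R -> R[i]).
Local Notation L2u := (L2 (fun=> 1)).
Local Notation sqnorm1 := (sqnorm (fun=> 1)).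
Implicit Types (psi phi : E) (V : 'I_N -> R -> R).

Lemma nrm0_ae (f : R -> R) : L2u f -> sqnorm1 f = 0 -> {ae mu, forall t, edge t -> f t = 0}.
Proof.
move=> Lf f0; have mf : measurable_fun (edge : set (measurableTypeR R)) (fun t => (1 * f t ^+ 2)%:E).
  by apply/measurable_EFinP; exact: integ_meas Lf.2.
have : (\int[mu]_(t in edge) `|(1 * f t ^+ 2)%:E| = 0)%E.
  have -> : (\int[mu]_(t in edge) `|(1 * f t ^+ 2)%:E| = \int[mu]_(t in edge) (1 * f t ^+ 2)%:E)%E.
    by apply: eq_integral => t _; rewrite gee0_abs// lee_fin mul1r sqr_ge0.
  by rewrite (Rint_EFin measurable_edge Lf.2); congr EFin; rewrite -[RHS]f0.
move/(ae_eq_integral_abs mu measurable_edge mf); apply: ae_imply => t + et => /(_ et) /= [].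
by rewrite mul1r => /eqP; rewrite sqrf_eq0 => /eqP.
Qed.

Lemma diag0_ae psi : gL2 unit_weight psi -> diag (gip unit_weight) psi = 0 ->
  forall j, {ae mu, forall t, edge t -> psi j t = 0}.
Proof.
move=> Lp; rewrite gip_diag => /eqP; rewrite psumr_eq0; last first.
  by move=> j _; exact: cnrm_ge0 weight1.
move=> /allP p0 j; have := p0 j (mem_index_enum j).
rewrite /= paddr_eq0 ?nrm_ge0//; try exact: weight1.
move=> /andP[/eqP r0 /eqP i0]; have [L1 L2] := Lp j.
have := ae_and (nrm0_ae L1 r0) (nrm0_ae L2 i0).
apply: ae_imply => t [H1 H2] et; move: (H1 et) (H2 et); rewrite /re /im.
by case: (psi j t) => x y /= -> ->.
Qed.

Lemma ip0 (w g : R -> R) : ip w (fun=> 0) g = 0.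
Proof.
rewrite /ip (eq_Rint (g := fun=> 0)) ?Rintegral_cst ?mul0r//; first exact: measurable_edge.
by move=> t _; rewrite mul0r mulr0.
Qed.

Lemma gip_ae0 psi phi : gL2 unit_weight psi -> gL2 unit_weight phi ->
  (forall j, {ae mu, forall t, edge t -> psi j t = 0}) -> gip unit_weight psi phi = 0.
Proof.
move=> Lp Lf p0; rewrite /gip big1// => j _.
have a0 : aeq (psi j) (fun=> 0).
  by split; apply: ae_imply (p0 j) => t + et => /(_ et); rewrite /re /im => ->.
rewrite (cip_ae weight1 (Lp j) (cL2_0 _) (Lf j) a0) /cip.
rewrite -[re (fun=> 0)]/(fun=> 0 : R) -[im (fun=> 0)]/(fun=> 0 : R) !ip0.
by rewrite addr0 subr0.
Qed.

Lemma sum_at n (u : 'I_n -> E) (c : 'I_n -> R[i]) j t :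
  (\sum_(k < n) c k *: u k) j t = \sum_(k < n) c k * u k j t.
Proof. by elim/big_rec2: _ => // k x y _ <-. Qed.

Section Trace.
Variables (V : 'I_N -> R -> R) (aV : admissible V) (gamma : R).

Let DH := form_domain_H1 aV.
Let sD := form_domain_subspace aV.
Let hs := s_hermitian DH.

Lemma independent_family n (psi : 'I_n -> E) : (forall k, form_domain V (psi k)) ->
  linearly_independent psi <->
  (forall c : 'I_n -> R[i], diag (gip unit_weight) (\sum_k c k *: psi k) = 0 -> forall k, c k = 0).
Proof.
move=> Dpsi.
have Dsum (c : 'I_n -> R[i]) : form_domain V (\sum_k c k *: psi k).
  by apply: (subspace_sum sD) => k; exact: (subspaceZ sD).
split=> H c Hc; apply: H.
  move=> j; have := diag0_ae (gH1_L2 (DH (Dsum c))) Hc j.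
  by apply: ae_imply => t + et => /(_ et); rewrite sum_at.
have L := gH1_L2 (DH (Dsum c)).
rewrite /diag (gip_ae0 L L)// => j; apply: ae_imply (Hc j) => t + et => /(_ et).
by rewrite sum_at.
Qed.

(** The scalar [kappa] accommodates families that are orthogonal with a common norm, such as the
    even extensions of functions on one edge. *)
Lemma trace_ge (I : finType) (u : I -> E) (mu_ : I -> R) (kappa : R) :
  kappa != 0 -> (forall i, mu_ i < 0) -> (forall i, eigenvector V (mu_ i) (u i)) ->
  (forall i j, gip unit_weight (u i) (u j) = kappa%:C * (i == j)%:R) ->
  ((\sum_i `|mu_ i| `^ gamma)%:E <= trace_neg gamma V)%E.
Proof.
move=> k0 mu0 eu ou.
have Du i : form_domain V (u i) by have [] := (eigenvectorP aV _ _).1 (eu i).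
pose cnt lam := #|[pred i | mu_ i == lam]|.
have multE lam : ((cnt lam)%:R%:E <= multiplicity V lam)%E.
  apply: ereal_sup_ubound; exists (cnt lam) => //.
  exists (fun k => u (enum_val k)); split.
    move=> k; have mk : mu_ (enum_val k) = lam by apply/eqP; exact: (enum_valP k).
    by have := eu (enum_val k); rewrite mk.
  apply/independent_family => // c c0 k.
  have Ds : form_domain V (\sum_k c k *: u (enum_val k)).
    by apply: (subspace_sum sD) => i; exact: (subspaceZ sD).
  have : gip unit_weight (\sum_k c k *: u (enum_val k)) (u (enum_val k)) = 0.
    apply: nsq_eq0; apply/eqP; rewrite eq_le nsq_ge0 andbT.
    have s0 v : form_domain V v -> 0 <= diag (gip unit_weight) v.
      by move=> _; exact: gip_ge0 gweight1.
    by have := cauchy_schwarz sD hs s0 Ds (Du (enum_val k)); rewrite c0 mul0r.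
  rewrite (herm_sum sD hs)//; last by move=> i; exact: (subspaceZ sD).
  rewrite (bigD1 k)//= big1 => [|i ik]; rewrite (hermZ sD hs)// ou.
    rewrite eqxx mulr1 addr0 => /eqP; rewrite mulf_eq0 => /orP[/eqP //|/eqP[] /eqP].
    by rewrite (negbTE k0).
  by rewrite (inj_eq enum_val_inj) (negbTE ik) !mulr0.
pose r := undup [seq mu_ i | i <- enum I].
have rmu i : mu_ i \in r by rewrite mem_undup map_f// mem_enum.
have -> : \sum_i `|mu_ i| `^ gamma = \sum_(lam <- r) (cnt lam)%:R * `|lam| `^ gamma.
  transitivity (\sum_i \sum_(lam <- r | mu_ i == lam) `|lam| `^ gamma).
    apply: eq_bigr => i _; rewrite -big_filter.
    have -> : [seq lam <- r | mu_ i == lam] = [:: mu_ i].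
      rewrite (eq_filter (a2 := pred1 (mu_ i))); last by move=> x; exact: eq_sym.
      by rewrite filter_pred1_uniq// undup_uniq.
    by rewrite big_seq1.
  rewrite (exchange_big_dep xpredT)//=; apply: eq_bigr => lam _.
  by rewrite sumr_const mulr_natl.
apply: esum_ge; exists [set` r].
  split; first exact: finite_seq.
  by move=> lam /=; rewrite mem_undup => /mapP[i _ ->]; exact: mu0.
rewrite -fsbig_seq ?undup_uniq// -sumEFin; apply: lee_sum => lam _.
by rewrite EFinM lee_wpmul2r// lee_fin powR_ge0.
Qed.

Lemma eigenspace_subspace lam : subspace (eigenvector V lam).
Proof.
have hh := hform_hermitian aV.
split.
  apply/(eigenvectorP aV); split; first exact: sD.1.
  by move=> v Dv; rewrite (herm0 sD hh)// (herm0 sD hs)// mulr0.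
move=> a u v /(eigenvectorP aV)[Du eu] /(eigenvectorP aV)[Dv ev].
apply/(eigenvectorP aV); split; first exact: sD.2.
by move=> w Dw; rewrite hh.1// hs.1// eu// ev//; ring.
Qed.

(** A finite partial sum of the trace, with any multiplicities that are realized, is a sum over an
    orthonormal family, by orthonormalizing in each eigenspace.  Eigenvectors for different
    eigenvalues are orthogonal.  If some multiplicity is infinite, then the bound is infinite. *)
Lemma trace_le (B : \bar R) :
  (forall (I : finType) (u : I -> E) (mu_ : I -> R), (forall i, mu_ i < 0) ->
    (forall i, eigenvector V (mu_ i) (u i)) ->
    (forall i j, gip unit_weight (u i) (u j) = (i == j)%:R) ->
    ((\sum_i `|mu_ i| `^ gamma)%:E <= B)%E) ->
  (trace_neg gamma V <= B)%E.
Proof.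
move=> H; apply: ge_ereal_sup => _ [X [fX Xneg] <-].
rewrite fsbig_finite//=; pose r : seq R := finmap.enum_fset (fset_set X); rewrite -/r.
have rneg lam : lam \in r -> lam < 0.
  by move=> lr; apply: Xneg; have : lam \in fset_set X := lr; rewrite in_fset_set// => /set_mem.
have ur : uniq r by exact: finmap.fset_uniq.
pose S lam := [set n : nat | exists psi : 'I_n -> E,
  (forall k, eigenvector V lam (psi k)) /\ linearly_independent psi].
have key (n : R -> nat) : (forall lam, lam \in r -> S lam (n lam)) ->
    ((\sum_(lam <- r) (n lam)%:R * `|lam| `^ gamma)%:E <= B)%E.
  move=> nS.
  have /choice[u uP] : forall k : 'I_(size r), exists u : nat -> E,
      (forall i : 'I_(n (nth 0 r k)), eigenvector V (nth 0 r k) (u i)) /\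
      (forall i j : 'I_(n (nth 0 r k)), gip unit_weight (u i) (u j) = (i == j)%:R).
    move=> k; have [psi [epsi lpsi]] := nS _ (mem_nth 0 (ltn_ord k)).
    have ED v : eigenvector V (nth 0 r k) v -> form_domain V v.
      by move=> /(eigenvectorP aV)[].
    have [|v [ev ov]] := exists_orthonormal sD hs (fun v _ => gip_ge0 v gweight1)
      (eigenspace_subspace _) ED epsi.
      by apply/independent_family => // i; exact: ED.
    exists (fun x => if insub x is Some i then v i else 0).
    by split=> [i|i j]; rewrite !valK.
  have := H {k : 'I_(size r) & 'I_(n (nth 0 r k))}
    (fun x => u (tag x) (tagged x)) (fun x => nth 0 r (tag x)).
  have -> : \sum_(x : {k : 'I_(size r) & 'I_(n (nth 0 r k))}) `|nth 0 r (tag x)| `^ gamma =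
      \sum_(lam <- r) (n lam)%:R * `|lam| `^ gamma.
    transitivity (\sum_(k < size r) \sum_(i < n (nth 0 r k)) `|nth 0 r k| `^ gamma).
      by rewrite (sig_big_dep _ _
        (fun (k : 'I_(size r)) (_ : 'I_(n (nth 0 r k))) => `|nth 0 r k| `^ gamma)).
    rewrite [RHS](big_nth 0) big_mkord; apply: eq_bigr => k _.
    by rewrite sumr_const card_ord mulr_natl.
  apply.
  - by move=> x; apply: rneg; exact: mem_nth.
  - by move=> x; have [+ _] := uP (tag x); exact.
  move=> [k i] [l j] /=.
  have [kl|kl] := eqVneq k l.
    by subst l; have [_ ->] := uP k; rewrite -tag_eqE /tag_eq /= eqxx tagged_asE.
  rewrite -tag_eqE /tag_eq /= (negbTE kl) /=.
  apply: (@eigenvector_orthogonal _ _ _ aV (nth 0 r k) (nth 0 r l)).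
  - by rewrite nth_uniq.
  - by have [+ _] := uP k; exact.
  - by have [+ _] := uP l; exact.
have S0 lam : S lam 0%N.
  have f : 'I_0 -> E by case.
  by exists f; split; [case|move=> c _; case].
(* An eigenvalue of infinite multiplicity makes the sums arbitrarily large. *)
have [unbounded|bounded] := pselect (exists2 lam, lam \in r &
    forall K : nat, exists2 n, S lam n & (K <= n)%N).
  have [lam lr lamK] := unbounded.
  have l0 : 0 < `|lam| `^ gamma by rewrite powR_gt0// normr_gt0 lt_eqF// rneg.
  suff -> : B = +oo%E by rewrite leey.
  apply: eq_infty => x.
  have [n Sn Kn] := lamK (Num.bound (`|x| / (`|lam| `^ gamma))).
  have kB := key (fun x => if x == lam then n else 0%N).
  apply: (le_trans _ (kB _)); last first.
    by move=> y _; case: eqP => [->|_].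
  rewrite lee_fin (bigD1_seq lam)//= eqxx big1 ?addr0; last first.
    by move=> y /negbTE ->; rewrite mul0r.
  rewrite -ler_pdivrMr// (@le_trans _ _ (`|x| / `|lam| `^ gamma))//.
    by rewrite ler_wpM2r ?invr_ge0 ?(ltW l0)// ler_norm.
  have b1 : `|x| / `|lam| `^ gamma < (Num.bound (`|x| / `|lam| `^ gamma))%:R.
    by rewrite archi_boundP// divr_ge0// ltW.
  by rewrite (le_trans (ltW b1))// ler_nat.
have /choice[n nP] : forall lam, exists n, lam \in r ->
    S lam n /\ multiplicity V lam = n%:R%:E.
  move=> lam; have [lr|] := boolP (lam \in r); last by exists 0%N.
  have [K KP] : exists K, forall n, S lam n -> (n < K)%N.
    apply: contrapT => nK; apply: bounded; exists lam => // K.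
    apply: contrapT => nn; apply: nK; exists K => n Sn.
    by rewrite ltnNge; apply/negP => Kn; apply: nn; exists n.
  have ex : exists n, `[< S lam n >] by exists 0%N; apply/asboolP.
  have ub n : `[< S lam n >] -> (n <= K)%N by move=> /asboolP/KP/ltnW.
  case: (ex_maxnP ex ub) => n /asboolP Sn nmax; exists n => _; split=> //.
  apply/eqP; rewrite eq_le; apply/andP; split.
    apply: ge_ereal_sup => _ [m Sm <-]; rewrite lee_fin ler_nat.
    by apply: nmax; apply/asboolP.
  by apply: ereal_sup_ubound; exists n.
rewrite (@eq_big_seq _ _ _ _ _ _ (fun lam => ((n lam)%:R * `|lam| `^ gamma)%:E)).
  by rewrite sumEFin; apply: key => lam /nP[].
by move=> lam /nP[_ ->]; rewrite EFinM.
Qed.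

End Trace.
End TraceAndFamilies.

(** * Relaxing the vertex condition *)

Section NegativePotentials.
Context {R : realType} {N : nat}.
Local Notation mu := (@lebesgue_measure R).
Local Notation edge := (@edge R).
Local Notation E := ('I_N -> R -> R[i]).
Implicit Types (psi phi : E) (v : 'I_N -> R -> R).

(** The form of the operator with potential [- v], for [v] nonnegative. *)
Definition attractive_form v psi phi : R[i] := kinetic psi phi + (-1)%:C * gip v psi phi.

Lemma cip_w0 (f g : R -> R[i]) : cip (fun=> 0) f g = 0.
Proof.
have ip_w0 (a b : R -> R) : ip (fun=> 0) a b = 0.
  rewrite /ip (eq_Rint (g := fun=> 0)) ?Rintegral_cst ?mul0r//; first exact: measurable_edge.
  by move=> t _; rewrite mul0r.
by rewrite /cip !ip_w0 addr0 subr0.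
Qed.

Lemma attractive_form_hermitian v : Lp_potential v -> hermitian gH1 (attractive_form v).
Proof.
move=> hv; apply: hermitian_lincomb; first exact: kinetic_hermitian.
by apply: hermitian_sub (gip_hermitian hv.1) => u; exact: gH1_vL2.
Qed.

Section Potential.
Variables (v : 'I_N -> R -> R) (v0 : forall j t, 0 <= v j t) (hv : Lp_potential v).
Let W j t := - v j t.

Lemma Vpos_opp : Vpos W = fun _ _ => 0.
Proof.
apply/funext => j; apply/funext => t; rewrite /Vpos /funrpos /W.
by apply/max_idPr; rewrite oppr_le0.
Qed.

Lemma Vneg_opp : Vneg W = v.
Proof.
apply/funext => j; apply/funext => t; rewrite /Vneg /funrneg /W opprK.
by apply/max_idPl.
Qed.

Lemma admissible_opp : admissible W.
Proof.
have [wv [p p1 vp]] := hv; split.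
- move=> j; have [mv _] := wv j.
  by apply: measurableT_comp mv.
- exists p; split=> //; rewrite /graph_integral.
  apply: lte_sum_pinfty => j _.
  by have := vp j; rewrite -{1}Vneg_opp.
- move=> j K cK _; rewrite -[(W j)^\+]/(Vpos W j) Vpos_opp.
  exact: integrable0.
Qed.

Lemma form_domain_opp psi : form_domain W psi <-> vertex_domain (fun=> tt) psi.
Proof.
have [wv _] := hv; split; first by move=> /(form_domainE _ admissible_opp)[].
move=> Dp; apply/(form_domainE _ admissible_opp); split=> //.
rewrite Vpos_opp => j; have [L1 L2] := gH1_L2 (vertex_domain_H1 Dp) j.
have w0 : weight (fun=> 0 : R) by split=> //; exact: measurable_cst.
by split; apply: (L2_dom weight1 w0) => // t _; exact: ler01.
Qed.

(** Without a positive part of the potential, the form domain is the whole of H^1 with continuity at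
    the vertex. *)
Lemma eigenvector_opp lam psi : eigenvector W lam psi <->
  vertex_domain (fun=> tt) psi /\
  form_eigenvector (vertex_domain (fun=> tt)) (gip unit_weight) (attractive_form v) lam psi.
Proof.
have hE : hform W = attractive_form v.
  apply/funext => f; apply/funext => g; rewrite /hform Vneg_opp Vpos_opp.
  rewrite [X in _ + _ * X + _](_ : _ = 0) ?mulr0 ?addr0//.
  by rewrite /gip big1// => j _; exact: cip_w0.
rewrite (eigenvectorP admissible_opp) hE; split=> -[/form_domain_opp D H]; split=> // g.
  by move=> /form_domain_opp; exact: H.
by move=> /form_domain_opp; exact: H.
Qed.

End Potential.

Lemma Vneg_ge0 (V : 'I_N -> R -> R) j t : 0 <= Vneg V j t.
Proof. exact: funrneg_ge0. Qed.

End NegativePotentials.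

Section ZeroEdge.
Context {R : realType}.
Implicit Types (f g : R -> R[i]).

Lemma edge_H1_0 : edge_H1 (0 : R -> R[i]).
Proof. exact: (@gH1_subspace R 1).1 ord0. Qed.

Lemma cip0 w f : cip w 0 f = 0.
Proof.
rewrite /cip -[re (0 : R -> R[i])]/(fun=> 0 : R) -[im (0 : R -> R[i])]/(fun=> 0 : R) !ip0.
by rewrite addr0 subr0.
Qed.

Lemma cip0r w f : cip w f 0 = 0.
Proof. by rewrite cip_herm cip0 conjc0. Qed.

Lemma cip_wderiv0 f : edge_H1 f -> cip (fun=> 1) (wderiv 0) (wderiv f) = 0.
Proof.
move=> Hf; have [Lf _] := wderivP Hf; have [L0 _] := wderivP edge_H1_0.
have p0 : primitive (fun=> 0 : R) (fun=> 0) by move=> t t0; rewrite Rintegral_cst ?mul0r ?addr0.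
have p00 : cprimitive (0 : R -> R[i]) 0 by split.
rewrite (cip_ae weight1 L0 (cL2_0 _) Lf (wderiv_unique edge_H1_0 (cL2_0 _) p00)).
exact: cip0.
Qed.

Lemma cip_wderiv0r f : edge_H1 f -> cip (fun=> 1) (wderiv f) (wderiv 0) = 0.
Proof. by move=> Hf; rewrite cip_herm cip_wderiv0// conjc0. Qed.

End ZeroEdge.

Section BlockProjections.
Context {R : realType} {N : nat}.
Local Notation E := ('I_N -> R -> R[i]).
Variables (B : finType) (blk : 'I_N -> B).
Implicit Types (psi phi : E) (v : 'I_N -> R -> R).

Definition block_proj (b : B) psi : E := fun j => if blk j == b then psi j else 0.

Lemma block_proj_H1 b psi : gH1 psi -> gH1 (block_proj b psi).
Proof. by move=> H j; rewrite /block_proj; case: ifP => // _; exact: edge_H1_0. Qed.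

Lemma block_proj_dom b psi : vertex_domain blk psi -> vertex_domain blk (block_proj b psi).
Proof.
move=> [H V]; split; first exact: block_proj_H1.
by move=> i j ij; rewrite /block_proj ij; case: ifP => _; [exact: (V i j ij)|].
Qed.

Lemma block_proj_proj b c psi :
  block_proj b (block_proj c psi) = if b == c then block_proj b psi else 0.
Proof.
apply/funext => j; rewrite /block_proj; have [->|bc] := eqVneq b c; first by case: ifP => // ->.
case: eqP => [->|_] //; by rewrite (negbTE bc).
Qed.

Lemma block_projZ b a psi : block_proj b (a *: psi) = a *: block_proj b psi.
Proof.
apply/funext => j; rewrite -[RHS]/(a *: (block_proj b psi j)) /block_proj.
by case: ifP => // _; rewrite scaler0.
Qed.

Lemma block_proj_sum psi : \sum_b block_proj b psi = psi.
Proof.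
apply/funext => j; rewrite fct_sumE (bigD1 (blk j))//= big1 => [|b bj].
  by rewrite /block_proj eqxx addr0.
by rewrite /block_proj eq_sym (negbTE bj).
Qed.

Lemma block_proj_gip b w psi phi : gip w (block_proj b psi) phi = gip w psi (block_proj b phi).
Proof.
apply: eq_bigr => j _; rewrite /block_proj; case: ifP => // _.
by rewrite cip0 cip0r.
Qed.

Lemma block_proj_kinetic b psi phi : gH1 psi -> gH1 phi ->
  kinetic (block_proj b psi) phi = kinetic psi (block_proj b phi).
Proof.
move=> Hp Hf; apply: eq_bigr => j _; rewrite /block_proj; case: (blk j == b); first by [].
exact: (etrans (cip_wderiv0 (Hf j)) (esym (cip_wderiv0r (Hp j)))).
Qed.

Section Relaxation.
Variables (V : 'I_N -> R -> R) (aV : admissible V) (gamma : R) (gamma0 : 0 <= gamma).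
Let v := Vneg V.
Let hv : Lp_potential v := (admissible_weights aV).2.
Variables (I : finType) (psi : I -> E) (lam : I -> R).
Hypotheses (lam0 : forall i, lam i < 0) (epsi : forall i, eigenvector V (lam i) (psi i))
  (opsi : forall i j, gip unit_weight (psi i) (psi j) = (i == j)%:R).

(** The eigenvectors of the given operator serve as trial vectors for the relaxed one: its domain
    is larger, and its form is smaller since the positive part of the potential is dropped. *)
Lemma relaxed_eigenvectors : exists n (u : 'I_n -> E) (nu : 'I_n -> R) (beta : 'I_n -> B),
  [/\ forall k, vertex_domain blk (u k) /\ block_proj (beta k) (u k) = u k,
      forall k, form_eigenvector (vertex_domain blk) (gip unit_weight) (attractive_form v) (nu k) (u k),
      orthonormal (gip unit_weight) u, forall k, nu k < 0 &
      \sum_i `|lam i| `^ gamma <= \sum_k `|nu k| `^ gamma].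
Proof.
have sD := @vertex_domain_subspace R N B blk.
have hs := s_hermitian (@vertex_domain_H1 R N B blk).
have hh : hermitian (vertex_domain blk) (attractive_form v).
  by apply: hermitian_sub (attractive_form_hermitian hv) => u; exact: vertex_domain_H1.
have hmin := @vertex_domain_minimizers R N B blk v hv.
have DV i : form_domain V (psi i) by have [] := (eigenvectorP aV _ _).1 (epsi i).
have eV i : form_eigenvector (form_domain V) (gip unit_weight) (hform V) (lam i) (psi i).
  by have [] := (eigenvectorP aV _ _).1 (epsi i).
have sV := form_domain_subspace aV.
have hV := hform_hermitian aV.
have sVh := s_hermitian (form_domain_H1 aV).
have comb := diag_eigencombination sV sVh hV DV eV opsi.
have Dsum (c : I -> R[i]) : form_domain V (\sum_i c i *: psi i).
  by apply: (subspace_sum sV) => i; exact: (subspaceZ sV).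
have [|||||n [u [nu [beta [sigma [Pu eu ou nul sumE]]]]]] :=
  eigenvectors_below_trial sD hs hh (fun u _ => gip_ge0 u gweight1) hmin
    (P := block_proj) block_proj_dom block_proj_proj block_projZ block_proj_sum
    (fun b u w _ _ => block_proj_gip b unit_weight u w) _ (phi := psi) (lam := lam).
- by move=> b u w Du Dw; rewrite /attractive_form block_proj_gip
    (block_proj_kinetic _ (vertex_domain_H1 Du) (vertex_domain_H1 Dw)).
- move=> i; have /(form_domainE _ aV)[[H0 H1] _] := DV i.
  by split=> // k l _; exact: H1.
- exact: lam0.
- move=> t c t0 ct; have [h1 h2] := comb c.
  apply: (@le_trans _ _ (diag (hform V) (\sum_i c i *: psi i))).
    rewrite /attractive_form /hform !diag_lincomb lerD2r lerDl mul1r gip_ge0//.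
    exact: (admissible_weights aV).1.
  rewrite h1 h2 mulr_sumr; apply: ler_sum => i _.
  have [->|ci] := eqVneq (c i) 0; last by rewrite ler_wpM2r ?nsq_ge0 ?ct.
  by rewrite /nsq /= expr0n/= addr0 !mulr0.
- move=> c; rewrite (comb c).2 => /eqP; rewrite psumr_eq0; last by move=> i _; exact: nsq_ge0.
  by move=> /allP c0 i; apply: nsq_eq0; apply/eqP; exact: (c0 i (mem_index_enum i)).
exists n, u, nu, beta; split=> //.
  by move=> k; exact: le_lt_trans (nul k) (lam0 _).
rewrite (sumE (fun i => `|lam i| `^ gamma)); apply: ler_sum => k _.
apply: ge0_ler_powR => //.
have nk := le_lt_trans (nul k) (lam0 (sigma k)).
by rewrite !ltr0_norm// lerN2.
Qed.

End Relaxation.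
End BlockProjections.

(** * From pairs of edges to the line *)

Section LineFromBlock.
Context {R : realType} {N : nat}.
Local Notation mu := (@lebesgue_measure R).
Local Notation edge := (@edge R).
Local Notation E := ('I_N -> R -> R[i]).
Local Notation E2 := ('I_2 -> R -> R[i]).
Variables (B : finType) (blk : 'I_N -> B) (b : B) (l r : 'I_N).
Hypothesis blkE : forall i, (blk i == b) = (i == l) || (i == r).
Variables (v : 'I_N -> R -> R) (v0 : forall j t, 0 <= v j t) (hv : Lp_potential v).

(** The edges [l] and [r] as the two halves of a line.  If they coincide, this is the even
    extension of a function on that edge. *)
Definition line_of T (f : 'I_N -> T) (i : 'I_2) : T := f (if i == ord0 then l else r).

Definition on_edge (a : 'I_N) (f : R -> R[i]) : E := fun j => if j == a then f else 0.

Lemma on_edge_H1 a f : edge_H1 f -> gH1 (on_edge a f).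
Proof. by move=> H j; rewrite /on_edge; case: ifP => // _; exact: edge_H1_0. Qed.

Lemma gip_on_edge w u a f : gip w u (on_edge a f) = cip (w a) (u a) f.
Proof.
rewrite /gip (bigD1 a)//= big1 ?addr0 /on_edge ?eqxx// => j /negbTE ->.
exact: cip0r.
Qed.

Lemma kinetic_on_edge u a f : gH1 u ->
  kinetic u (on_edge a f) = cip (fun=> 1) (wderiv (u a)) (wderiv f).
Proof.
move=> Hu; rewrite /kinetic /gip (bigD1 a)//= big1 ?addr0 /on_edge ?eqxx// => j /negbTE ->.
exact: cip_wderiv0r.
Qed.

(** The adjoint of [line_of], used to turn test functions on the line into test functions on the
    block: if the two edges coincide, then the two halves are added. *)
Definition unline (phi : E2) : E := on_edge l (phi ord0) + on_edge r (phi (lift ord0 ord0)).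

(** On the block, the value at the vertex is that of [phi], or twice that if the two edges
    coincide; it is 0 on the other blocks. *)
Lemma unline_dom phi : vertex_domain (fun=> tt) phi -> vertex_domain blk (unline phi).
Proof.
move=> [H Vphi]; split.
  by apply: (subspaceD (@gH1_subspace R N)); exact: on_edge_H1.
have V01 : phi (lift ord0 ord0) 0 = phi ord0 0 by exact: Vphi.
have val i : unline phi i 0 = ((i == l)%:R + (i == r)%:R) * phi ord0 0.
  rewrite /unline -[LHS]/(on_edge l _ i 0 + on_edge r _ i 0) /on_edge.
  by case: (i == l); case: (i == r); rewrite /= ?V01 -?[(0 : R -> R[i]) 0]/(0 : R[i]); ring.
have cnt i : ((i == l)%:R + (i == r)%:R : R[i]) =
    (blk i == b)%:R * (1 + (l == r)%:R).
  rewrite blkE; have [->|il] := eqVneq i l; first by rewrite /= mul1r.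
  have [ir|_] := eqVneq i r; last by rewrite /=; ring.
  by rewrite -ir eq_sym (negbTE il) /=; ring.
by move=> i j ij; rewrite !val !cnt ij.
Qed.

Lemma line_dom (u : E) : vertex_domain blk u -> vertex_domain (fun=> tt) (line_of u).
Proof.
move=> [H Vu]; split; first by move=> i; exact: H.
move=> i j _; apply: Vu.
have lb : blk l = b by apply/eqP; rewrite blkE eqxx.
have rb : blk r = b by apply/eqP; rewrite blkE eqxx orbT.
by case: ifP => _; case: ifP => _; rewrite ?lb ?rb.
Qed.

Lemma sum2 (T : nmodType) (F : 'I_2 -> T) : \sum_i F i = F ord0 + F (lift ord0 ord0).
Proof. by rewrite big_ord_recl big_ord1. Qed.

Lemma gip_line (w : 'I_N -> R -> R) (u : E) phi : gweight w -> gL2 w u -> gL2 w (unline phi) ->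
  gL2 w (on_edge l (phi ord0)) -> gL2 w (on_edge r (phi (lift ord0 ord0))) ->
  gip (line_of w) (line_of u) phi = gip w u (unline phi).
Proof.
move=> ww Lu _ L1 L2.
rewrite (hermDr (gL2_subspace ww) (gip_hermitian ww) L1 L2 Lu) !gip_on_edge.
by rewrite /gip sum2.
Qed.

Lemma kinetic_line (u : E) phi : gH1 u -> gH1 phi -> kinetic (line_of u) phi = kinetic u (unline phi).
Proof.
move=> Hu Hp.
rewrite (hermDr (@gH1_subspace R N) (@kinetic_hermitian R N) _ _ Hu); try exact: on_edge_H1.
by rewrite !kinetic_on_edge// /kinetic /gip sum2.
Qed.

Lemma line_potential : Lp_potential (line_of v).
Proof.
have [wv [p p1 vp]] := hv; split; first by move=> i; exact: wv.
by exists p => // i; exact: vp.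
Qed.

Lemma line_eigenvector nu (u : E) : vertex_domain blk u ->
  form_eigenvector (vertex_domain blk) (gip unit_weight) (attractive_form v) nu u ->
  eigenvector (fun i t => - line_of v i t) nu (line_of u).
Proof.
move=> Du eu; apply/(eigenvector_opp (fun i => v0 _) line_potential).
split; first exact: line_dom.
move=> phi Dphi; have Dx := unline_dom Dphi.
have := eu _ Dx; have Hu := vertex_domain_H1 Du; have Hp := vertex_domain_H1 Dphi.
have Hx := vertex_domain_H1 Dx.
have H1 := @on_edge_H1 l _ (Hp ord0); have H2 := @on_edge_H1 r _ (Hp (lift ord0 ord0)).
rewrite /attractive_form -(kinetic_line Hu Hp).
rewrite -(gip_line hv.1 (gH1_vL2 hv Hu) (gH1_vL2 hv Hx) (gH1_vL2 hv H1) (gH1_vL2 hv H2)).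
by rewrite -(gip_line (@gweight1 R N) (gH1_L2 Hu) (gH1_L2 Hx) (gH1_L2 H1) (gH1_L2 H2)).
Qed.

Lemma line_gip (u u' : E) : block_proj blk b u = u ->
  gip unit_weight (line_of u) (line_of u') = (if l == r then 2 else 1)%:C * gip unit_weight u u'.
Proof.
move=> bu; have off j : j != l -> j != r -> cip (fun=> 1) (u j) (u' j) = 0.
  move=> jl jr; rewrite -bu /block_proj blkE (negbTE jl) (negbTE jr).
  exact: cip0.
rewrite /gip sum2 [in RHS](bigD1 l)//= /line_of /=.
have [lr|lr] := eqVneq l r.
  rewrite -lr big1 ?addr0 => [|j jl]; first by rewrite rmorphD /= rmorph1; ring.
  by apply: off => //; rewrite -lr.
rewrite (bigD1 r) 1?eq_sym//= big1 ?addr0 => [|j /andP[jl jr]]; last exact: off.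
by rewrite rmorph1 mul1r.
Qed.

(** The eigenvectors of the relaxed operator that live on one block are those of an operator on the
    line, up to a common normalization. *)
Lemma block_bound gamma C (I : finType) (u : I -> E) (nu : I -> R) :
  LT_inequality gamma 2 C ->
  (forall k, vertex_domain blk (u k)) -> (forall k, block_proj blk b (u k) = u k) ->
  (forall k, form_eigenvector (vertex_domain blk) (gip unit_weight) (attractive_form v) (nu k) (u k)) ->
  (forall i j, gip unit_weight (u i) (u j) = (i == j)%:R) -> (forall k, nu k < 0) ->
  ((\sum_k `|nu k| `^ gamma)%:E <= C%:E *
    (\int[mu]_(t in edge) (v l t `^ (gamma + 2^-1))%:E +
     \int[mu]_(t in edge) (v r t `^ (gamma + 2^-1))%:E))%E.
Proof.
move=> LT Du Pu eu ou nu0.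
have aW := admissible_opp (fun i => v0 _) line_potential.
apply: le_trans (trace_ge aW gamma (kappa := if l == r then 2 else 1) _ nu0
  (fun k => line_eigenvector (Du k) (eu k)) _) _.
- by case: ifP => _; rewrite ?pnatr_eq0 ?oner_eq0.
- by move=> i j; rewrite line_gip// ou.
have : (trace_neg gamma (fun i t => (- line_of v i t)%R) <= C%:E * graph_integral
    (fun i t => (Vneg (fun i t => (- line_of v i t)%R) i t `^ (gamma + 2^-1))%:E))%E := LT _ aW.
by rewrite (Vneg_opp (fun i => v0 _)) /graph_integral sum2.
Qed.

End LineFromBlock.

Section Pairing.
Variables (N : nat) (j : 'I_N).

(** Putting [j] last makes it the edge without partner if N is odd.  As the default value of
    [nth], it is then also its own partner. *)
Definition edge_seq : seq 'I_N := rcons (rem j (enum 'I_N)) j.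

Lemma edge_seq_perm : perm_eq edge_seq (enum 'I_N).
Proof.
rewrite perm_rcons perm_sym; apply: perm_to_rem; exact: mem_enum.
Qed.

Lemma size_edge_seq : size edge_seq = N.
Proof. by rewrite (perm_size edge_seq_perm) size_enum_ord. Qed.

Lemma edge_seq_uniq : uniq edge_seq.
Proof. by rewrite (perm_uniq edge_seq_perm) enum_uniq. Qed.

Lemma mem_edge_seq i : i \in edge_seq.
Proof. by rewrite (perm_mem edge_seq_perm) mem_enum. Qed.

Lemma edge_index i : (index i edge_seq < N)%N.
Proof. by rewrite -{2}size_edge_seq index_mem mem_edge_seq. Qed.

Lemma pair_bound i : ((index i edge_seq)./2 < uphalf N)%N.
Proof. by rewrite ltn_half_double; have := edge_index i; lia. Qed.

Definition pair_of i : 'I_(uphalf N) := Ordinal (pair_bound i).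
Definition pair_fst (b : 'I_(uphalf N)) : 'I_N := nth j edge_seq b.*2.
Definition pair_snd (b : 'I_(uphalf N)) : 'I_N := nth j edge_seq b.*2.+1.

Lemma edge_seq_nth i k : (k < N)%N -> (i == nth j edge_seq k) = (index i edge_seq == k).
Proof.
move=> kN; apply/eqP/eqP => [->|<-]; last by rewrite nth_index// mem_edge_seq.
by rewrite index_uniq ?edge_seq_uniq// size_edge_seq.
Qed.

Lemma edge_seq_last : nth j edge_seq N.-1 = j.
Proof.
by rewrite -[X in X.-1]size_edge_seq nth_last last_rcons.
Qed.

Lemma pair_ofE i b : (pair_of i == b) = (i == pair_fst b) || (i == pair_snd b).
Proof.
have bN : (b.*2 < N)%N by have := ltn_ord b; lia.
rewrite -val_eqE /= /pair_fst /pair_snd edge_seq_nth//.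
have [bN1|bN1] := ltnP b.*2.+1 N; first by rewrite edge_seq_nth//; lia.
have iN := edge_index i.
rewrite nth_default ?size_edge_seq// -edge_seq_last edge_seq_nth; last by lia.
by lia.
Qed.

Lemma pair_sum (T : nmodType) (X : 'I_N -> T) :
  \sum_b (X (pair_fst b) + X (pair_snd b)) = \sum_i X i + (if odd N then X j else 0).
Proof.
have dbl (F : nat -> T) m : \sum_(b < m) (F b.*2 + F b.*2.+1) = \sum_(k < m.*2) F k.
  elim: m => [|m IH]; first by rewrite !big_ord0.
  by rewrite big_ord_recr /= IH doubleS !big_ord_recr /= addrA.
rewrite (dbl (fun k => X (nth j edge_seq k))).
have E : \sum_i X i = \sum_(k < N) X (nth j edge_seq k).
  rewrite -[LHS]big_enum /= -[LHS](perm_big _ edge_seq_perm) [LHS](big_nth j) big_mkord.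
  by rewrite size_edge_seq.
have [oN|eN] := boolP (odd N).
  have -> : (uphalf N).*2 = N.+1 by lia.
  by rewrite big_ord_recr /= -E nth_default ?size_edge_seq.
have -> : (uphalf N).*2 = N by lia.
by rewrite addr0 E.
Qed.

End Pairing.

(** * From the line to the star graph *)

Section UpperBound.
Context {R : realType} {N : nat}.
Local Notation mu := (@lebesgue_measure R).
Local Notation edge := (@edge R).

Definition edge_mass (q : R) (V : 'I_N -> R -> R) (i : 'I_N) : \bar R :=
  (\int[mu]_(t in edge) (Vneg V i t `^ q)%:E)%E.

Lemma edge_mass_ge0 q V i : (0 <= edge_mass q V i)%E.
Proof. by apply: integral_ge0 => t _; rewrite lee_fin powR_ge0. Qed.

(** The sum over the pairs of the inequalities on the line.  If N is odd, the remaining edge [j],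
    paired with itself, is counted twice. *)
Theorem trace_upper_bound (gamma C : R) (V : 'I_N -> R -> R) (j : 'I_N) :
  0 <= gamma -> LT_inequality gamma 2 C -> admissible V ->
  (trace_neg gamma V <= C%:E * (\sum_i edge_mass (gamma + 2^-1) V i +
    (if odd N then edge_mass (gamma + 2^-1) V j else 0)))%E.
Proof.
move=> gamma0 LT aV; apply: trace_le => // I psi lam lam0 epsi opsi.
have [n [u [nu [beta [Du eu ou nu0 le]]]]] :=
  relaxed_eigenvectors (pair_of j) aV gamma0 lam0 epsi opsi.
rewrite -pair_sum ge0_sume_distrr; last by move=> b _; rewrite adde_ge0// edge_mass_ge0.
apply: (@le_trans _ _ (\sum_k `|nu k| `^ gamma)%:E); first by rewrite lee_fin.
rewrite (partition_big beta xpredT)//= -sumEFin; apply: lee_sum => b _.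
pose A := [pred k | beta k == b].
have := @block_bound R N _ (pair_of j) b (pair_fst j b) (pair_snd j b) (fun i => pair_ofE j i b)
  (Vneg V) (Vneg_ge0 V) (admissible_weights aV).2 gamma C _ (fun x : 'I_#|A| => u (enum_val x))
  (fun x => nu (enum_val x)) LT.
rewrite -(big_enum_val (fun k => `|nu k| `^ gamma)); apply.
- by move=> x; case: (Du (enum_val x)).
- move=> x; have [_ <-] := Du (enum_val x).
  by have /eqP -> := enum_valP x; rewrite block_proj_proj eqxx.
- by move=> x; exact: eu.
- by move=> x y; rewrite ou (inj_eq enum_val_inj).
- by move=> x; exact: nu0.
Qed.

End UpperBound.

(** * Moving the vertex away along an edge *)

Section Gluing.
Context {R : realType}.
Local Notation mu := (@lebesgue_measure R).
Local Notation edge := (@edge R).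
Variables (S : R) (S0 : 0 < S).

Definition tail T (f : R -> T) : R -> T := fun t => f (t + S).
(** On the edge that receives a whole half-line, the points before [S] come from the edge [f1],
    traversed towards the vertex, and the points after [S] from the edge [f0]. *)
Definition glue T (f1 f0 : R -> T) : R -> T := fun t => if t < S then f1 (S - t) else f0 (t - S).

Lemma glue_map T T' (F : T -> T') (f1 f0 : R -> T) :
  (fun t => F (glue f1 f0 t)) = glue (fun t => F (f1 t)) (fun t => F (f0 t)).
Proof. by apply/funext => t; rewrite /glue; case: ifP. Qed.

Let co_oc : (fun t : R => S - t) @^-1` `]0, S] = `[0, S[%classic.
Proof. by apply/seteqP; split => t /=; rewrite !in_itv /= => /andP[h1 h2]; apply/andP; split; lra. Qed.

Let cc_cc (a : R) : (fun t : R => S - t) @^-1` `[S - a, S] = `[0, a]%classic.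
Proof. by apply/seteqP; split => t /=; rewrite !in_itv /= => /andP[h1 h2]; apply/andP; split; lra. Qed.

Let far : (fun t : R => t - S) @^-1` edge = `[S, +oo[%classic.
Proof. by apply/seteqP; split => t; rewrite /Defs.edge /= !in_itv /= !andbT => h; lra. Qed.

Let near_tail : (fun t : R => t + S) @^-1` `[S, +oo[%classic = edge.
Proof. by apply/seteqP; split => t; rewrite /Defs.edge /= !in_itv /= !andbT => h; lra. Qed.

Let edge_split : edge = (`[0, S[ `|` `[S, +oo[)%classic.
Proof.
apply/seteqP; split => t; rewrite /Defs.edge /= !in_itv /= !andbT.
  by move=> t0; have [tS|tS] := ltP t S; [left|right]; rewrite ?t0.
by case=> [/andP[]//|]; apply: le_trans (ltW S0).
Qed.

Let edge_disj : [disjoint (`[0, S[%classic : set R) & (`[S, +oo[%classic : set R)].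
Proof.
apply/disj_setPS => t /= []; rewrite !in_itv /= andbT => /andP[_ tS] St.
by move: (lt_le_trans tS St); rewrite ltxx.
Qed.

Lemma mpres_shiftB : measure_preserving (fun t : R => t - S).
Proof. exact: mpres_shift (- S). Qed.

Let moc : meas (`]0, S]%classic : set R). Proof. exact: measurable_itv. Qed.
Let mco : meas (`[0, S[%classic : set R). Proof. exact: measurable_itv. Qed.
Let mfar : meas (`[S, +oo[%classic : set R). Proof. exact: measurable_itv. Qed.

Let oc_edge : `]0, S] `<=` edge.
Proof. by move=> t /=; rewrite in_itv /= => /andP[t0 _]; rewrite edgeE ltW. Qed.

Let far_edge : `[S, +oo[ `<=` edge.
Proof. by move=> t /=; rewrite in_itv /= andbT => St; rewrite edgeE; apply: le_trans St; exact: ltW. Qed.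

Lemma glue_meas f1 f0 : measurable_fun edge f1 -> measurable_fun edge f0 ->
  measurable_fun edge (glue f1 f0 : R -> R).
Proof.
move=> m1 m0; rewrite edge_split; apply/measurable_funU; [exact: mco|exact: mfar|split].
  rewrite -co_oc; have := mpres_meas (mpres_reflect S) moc (measurable_funS measurable_edge oc_edge m1).
  apply: eq_measurable_fun => t /set_mem; rewrite co_oc /= in_itv /= => /andP[_ tS].
  by rewrite /glue tS.
rewrite -far; have := mpres_meas mpres_shiftB measurable_edge m0.
apply: eq_measurable_fun => t /set_mem; rewrite far /= in_itv /= andbT => St.
by rewrite /glue ltNge St.
Qed.

Lemma tail_meas f : measurable_fun edge f -> measurable_fun edge (tail f : R -> R).
Proof.
move=> m; rewrite -near_tail; apply: (mpres_meas (mpres_shift S) mfar).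
exact: measurable_funS measurable_edge far_edge m.
Qed.

Lemma tail_integral (h : R -> R) : measurable_fun edge h -> (forall t, 0 <= t -> 0 <= h t) ->
  (\int[mu]_(t in edge) (tail h t)%:E = \int[mu]_(t in `[S, +oo[) (h t)%:E)%E.
Proof.
move=> m h0; rewrite -near_tail.
apply: (mpres_integral (f := fun t => (h t)%:E) (mpres_shift S) mfar).
  by apply/measurable_EFinP; exact: measurable_funS measurable_edge far_edge m.
by move=> t /far_edge /edge_ge0 /h0; rewrite lee_fin.
Qed.

(** Gluing and cutting off the tail rearrange the two edges without loss, so all the norms and
    integrals of the two pieces add up to the original ones. *)
Lemma glue_tail_integral (h1 h0 : R -> R) : measurable_fun edge h1 -> measurable_fun edge h0 ->
  (forall t, 0 <= t -> 0 <= h1 t) -> (forall t, 0 <= t -> 0 <= h0 t) ->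
  (\int[mu]_(t in edge) (glue h1 h0 t)%:E + \int[mu]_(t in edge) (tail h1 t)%:E =
   \int[mu]_(t in edge) (h0 t)%:E + \int[mu]_(t in edge) (h1 t)%:E)%E.
Proof.
move=> m1 m0 h10 h00; have mg := glue_meas m1 m0.
have me (h : R -> R) : measurable_fun edge h ->
    measurable_fun (edge : set (measurableTypeR R)) (fun t => (h t)%:E).
  by move=> m; apply/measurable_EFinP.
have near_part : (\int[mu]_(t in `[0%R, S[) (glue h1 h0 t)%:E = \int[mu]_(t in `[0%R, S[) (h1 t)%:E)%E.
  transitivity (\int[mu]_(t in `[0%R, S[) (h1 (S - t))%:E)%E.
    apply: eq_integral => t /set_mem /=; rewrite in_itv /= => /andP[_ tS].
    by rewrite /glue tS.
  rewrite -[in LHS]co_oc (mpres_integral (f := fun t => (h1 t)%:E) (mpres_reflect S) moc); last first.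
  - by move=> t /oc_edge /edge_ge0 /h10; rewrite lee_fin.
  - by apply/measurable_EFinP; exact: measurable_funS measurable_edge oc_edge m1.
  have mcc : measurable_fun (`[0, S] : set R) h1.
    by apply: measurable_funS measurable_edge _ m1; exact: itv_edge.
  have mE (A : set R) : meas A -> A `<=` `[0, S] ->
      measurable_fun (A : set (measurableTypeR R)) (fun t => (h1 t)%:E).
    by move=> mA AS; apply/measurable_EFinP; exact: measurable_funS (meas_itv _ _) AS mcc.
  have m1' : measurable_fun (`]0, S]%classic : set (measurableTypeR R)) (fun t => (h1 t)%:E).
    by apply: mE => // t /=; rewrite !in_itv /= => /andP[/ltW -> ->].
  have m2' : measurable_fun (`[0, S[%classic : set (measurableTypeR R)) (fun t => (h1 t)%:E).
    by apply: mE => // t /=; rewrite !in_itv /= => /andP[-> /ltW ->].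
  rewrite (integral_itv_obnd_cbnd m1'). exact: (esym (integral_itv_bndo_bndc m2')).
have far_part : (\int[mu]_(t in `[S, +oo[) (glue h1 h0 t)%:E = \int[mu]_(t in edge) (h0 t)%:E)%E.
  transitivity (\int[mu]_(t in `[S, +oo[) (h0 (t - S))%:E)%E.
    apply: eq_integral => t /set_mem /=; rewrite in_itv /= andbT => St.
    by rewrite /glue ltNge St.
  rewrite -far (mpres_integral (f := fun t => (h0 t)%:E) mpres_shiftB measurable_edge)//.
    exact: me.
  by move=> t /edge_ge0 /h00; rewrite lee_fin.
have g0 t : edge t -> (0 <= (glue h1 h0 t)%:E)%E.
  move=> /edge_ge0 t0; rewrite lee_fin /glue; have [tS|St] := ltP t S.
    by rewrite h10// subr_ge0 ltW.
  by rewrite h00// subr_ge0.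
have split_int (h : R -> R) : measurable_fun edge h -> (forall t, edge t -> (0 <= (h t)%:E)%E) ->
    (\int[mu]_(t in edge) (h t)%:E =
     \int[mu]_(t in `[0%R, S[) (h t)%:E + \int[mu]_(t in `[S, +oo[) (h t)%:E)%E.
  move=> mh h0'; rewrite [in LHS]edge_split (@ge0_integral_setU _ _ _ mu _ _ mco mfar) //.
    by rewrite -edge_split; exact: me.
  by move=> t; rewrite -edge_split; exact: h0'.
rewrite (split_int _ mg g0) near_part far_part tail_integral//.
rewrite (split_int h1)//; last by move=> t /edge_ge0/h10; rewrite lee_fin.
by rewrite [RHS]addeCA addeA.
Qed.

Local Notation L2u := (L2 (fun=> 1)).
Local Notation sqnorm1 := (sqnorm (fun=> 1)).

Lemma nrm_integral (w f : R -> R) : L2 w f ->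
  (\int[mu]_(t in edge) (w t * f t ^+ 2)%:E)%E = (sqnorm w f)%:E.
Proof. by move=> [_ If]; rewrite (Rint_EFin measurable_edge If). Qed.

Lemma glue_weight w1 w0 : weight w1 -> weight w0 -> weight (glue w1 w0).
Proof.
move=> [m1 w10] [m0 w00]; split; first exact: glue_meas.
move=> t t0; rewrite /glue; have [tS|St] := ltP t S.
  by rewrite w10// subr_ge0 ltW.
by rewrite w00// subr_ge0.
Qed.

Lemma tail_weight w : weight w -> weight (tail w).
Proof. by move=> [m w0]; split=> [|t t0]; [exact: tail_meas|apply: w0; rewrite addr_ge0// ltW]. Qed.

Lemma glue_tail_L2 w1 w0 f1 f0 : weight w1 -> weight w0 -> L2 w1 f1 -> L2 w0 f0 ->
  [/\ L2 (glue w1 w0) (glue f1 f0), L2 (tail w1) (tail f1) &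
    sqnorm (glue w1 w0) (glue f1 f0) + sqnorm (tail w1) (tail f1) = sqnorm w0 f0 + sqnorm w1 f1].
Proof.
move=> ww1 ww0 L1 L0; have [mw1 w10] := ww1; have [mw0 w00] := ww0.
have [m1 _] := L1; have [m0 _] := L0.
have gE t : glue w1 w0 t * glue f1 f0 t ^+ 2 =
    glue (fun t => w1 t * f1 t ^+ 2) (fun t => w0 t * f0 t ^+ 2) t.
  by rewrite /glue; case: ifP.
have K := glue_tail_integral (meas_wf2 mw1 m1) (meas_wf2 mw0 m0)
  (fun t t0 => mulr_ge0 (w10 t t0) (sqr_ge0 _)) (fun t t0 => mulr_ge0 (w00 t t0) (sqr_ge0 _)).
rewrite (nrm_integral L1) (nrm_integral L0) in K.
have i0 (h : R -> R) : (forall t, 0 <= t -> 0 <= h t) -> (0 <= \int[mu]_(t in edge) (h t)%:E)%E.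
  by move=> h0; apply: integral_ge0 => t /edge_ge0/h0; rewrite lee_fin.
have G0 := i0 (fun t => glue w1 w0 t * glue f1 f0 t ^+ 2)
  (fun t t0 => mulr_ge0 ((glue_weight ww1 ww0).2 t t0) (sqr_ge0 _)).
have T0 := i0 (fun t => tail w1 t * tail f1 t ^+ 2)
  (fun t t0 => mulr_ge0 ((tail_weight ww1).2 t t0) (sqr_ge0 _)).
have K' : (\int[mu]_(t in edge) (glue w1 w0 t * glue f1 f0 t ^+ 2)%:E +
    \int[mu]_(t in edge) (tail w1 t * tail f1 t ^+ 2)%:E = (sqnorm w0 f0 + sqnorm w1 f1)%:E)%E.
  by rewrite EFinD -K; congr (_ + _)%E; apply: eq_integral => t _; rewrite gE.
have Lg : L2 (glue w1 w0) (glue f1 f0).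
  apply/(L2P (glue_weight ww1 ww0)); first exact: glue_meas.
  by apply: (@le_lt_trans _ _ (sqnorm w0 f0 + sqnorm w1 f1)%:E); rewrite ?ltry// -K' leeDl.
have Lt : L2 (tail w1) (tail f1).
  apply/(L2P (tail_weight ww1)); first exact: tail_meas.
  by apply: (@le_lt_trans _ _ (sqnorm w0 f0 + sqnorm w1 f1)%:E); rewrite ?ltry// -K' leeDr.
split=> //; apply: EFin_inj; rewrite -K'.
by rewrite EFinD -(nrm_integral Lt) -(nrm_integral Lg).
Qed.

Lemma tail_prim f g : L2u g -> primitive f g -> primitive (tail f) (tail g).
Proof.
move=> Lg fg t t0; rewrite /tail add0r.
have St : S <= t + S by rewrite lerDr.
rewrite -[LHS](subrK (f S)) (prim_sub Lg fg (ltW S0) St) [LHS]addrC; congr (_ + _).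
have mg : measurable_fun (`[S, t + S] : set R) g.
  by apply: measurable_funS measurable_edge _ Lg.1; apply: itv_edge; exact: ltW.
rewrite -(mpres_Rint (mpres_shift S) (meas_itv _ _) mg); congr (Rintegral mu _ _).
by apply/seteqP; split => x /=; rewrite !in_itv /= => /andP[h1 h2]; apply/andP; split; lra.
Qed.

(** The reflected half changes the sign of the derivative. *)
Lemma glue_prim f1 g1 f0 g0 : L2u g1 -> L2u g0 -> primitive f1 g1 -> primitive f0 g0 -> f1 0 = f0 0 ->
  primitive (glue f1 f0) (glue (fun t => - g1 t) g0).
Proof.
move=> L1 L0 p1 p0 f10.
have LN1 : L2u (fun t => - g1 t).
  by have := L2_Z (-1) weight1 L1; congr L2; apply/funext => t; rewrite mulN1r.
have [Lg _ _] := glue_tail_L2 weight1 weight1 LN1 L0.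
have {}Lg : L2u (glue (fun t => - g1 t) g0).
  by move: Lg; congr L2; apply/funext => t; rewrite /glue; case: ifP.
have part a : 0 <= a -> a <= S -> \int[mu]_(x in `[0, a]) glue (fun t => - g1 t) g0 x = f1 (S - a) - f1 S.
  move=> a0 aS; have Sa : 0 <= S - a by rewrite subr_ge0.
  have SaS : S - a <= S by rewrite gerBl.
  have mg : measurable_fun (`[S - a, S] : set R) g1.
    by apply: measurable_funS measurable_edge _ L1.1; exact: itv_edge.
  have mr := mpres_meas (mpres_reflect S) (meas_itv _ _) mg; rewrite cc_cc in mr.
  have mN : measurable_fun (`[0, a] : set R) (fun x => - g1 (S - x)).
    by apply: measurable_funN.
  transitivity (\int[mu]_(x in `[0, a]) (- g1 (S - x))).
    apply: ae_eq_Rint => //; first exact: meas_itv.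
      by apply: measurable_funS measurable_edge _ Lg.1; exact: itv_edge.
    apply: ae_imply (ae_neq S) => x xS; rewrite /= in_itv /= => /andP[x0 xa].
    by rewrite /glue lt_neqAle (le_trans xa aS) andbT; case: eqP xS.
  have Ig : integ `[0, a] (fun x => g1 (S - x)).
    rewrite -(cc_cc a); apply: (mpres_integ (mpres_reflect S) (meas_itv _ _)).
    exact: L2_itv.
  transitivity (- \int[mu]_(x in `[0, a]) g1 (S - x)).
    rewrite -mulN1r -(RintZ _ (meas_itv _ _) Ig); apply: eq_Rint => x _; exact/esym/mulN1r.
  rewrite -(cc_cc a) (mpres_Rint (mpres_reflect S) (meas_itv _ _) mg).
  by rewrite -(prim_sub L1 p1 Sa SaS) opprB.
move=> t t0; have -> : glue f1 f0 0 = f1 S by rewrite /glue S0 subr0.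
have [tS|St] := ltP t S.
  by rewrite part ?(ltW tS)// /glue tS; ring.
rewrite (Rint_split (ltW S0) St); last exact: L2_itv.
rewrite part ?(ltW S0)// subrr f10.
have -> : \int[mu]_(x in `[S, t]) glue (fun t => - g1 t) g0 x = \int[mu]_(x in `[S, t]) g0 (x - S).
  by apply: eq_Rint => x /=; rewrite in_itv /= => /andP[Sx _]; rewrite /glue ltNge Sx.
have tS0 : 0 <= t - S by rewrite subr_ge0.
have mg : measurable_fun (`[0, t - S] : set R) g0.
  by apply: measurable_funS measurable_edge _ L0.1; exact: itv_edge.
have -> : `[S, t]%classic = (fun x : R => x - S) @^-1` `[0, t - S].
  by apply/seteqP; split => x /=; rewrite !in_itv /= => /andP[h1 h2]; apply/andP; split; lra.
rewrite (mpres_Rint mpres_shiftB (meas_itv _ _) mg) -(prim_sub L0 p0 (lexx 0) tS0).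
by rewrite /glue ltNge St /=; ring.
Qed.

End Gluing.

Section TailSmall.
Context {R : realType}.
Local Notation mu := (@lebesgue_measure R).
Local Notation edge := (@edge R).
Local Notation L2u := (L2 (fun=> 1)).
Local Notation sqnorm1 := (sqnorm (fun=> 1)).

Lemma tail_small (I : finType) (f : I -> R -> R) (e : R) : (forall i, L2u (f i)) -> 0 < e ->
  exists2 S : R, 0 < S & \sum_i sqnorm1 (tail S (f i)) <= e.
Proof.
move=> Lf e0; pose P t := \sum_i (1 * f i t ^+ 2).
have IP : integ edge P.
  rewrite /P; have : forall r : seq I, integ edge (fun t => \sum_(i <- r) (1 * f i t ^+ 2)).
    elim=> [|i r IH].
      by apply: eq_integ (integ0 edge) => // t _; rewrite big_nil.
    have := integD measurable_edge (Lf i).2 IH.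
    by apply: eq_integ => // t _; rewrite big_cons.
  exact.
pose A (n : nat) : set R := `[n.+1%:R, +oo[%classic.
have [|||n [In le]] := @integ_tail R P A IP _ _ _ e e0.
- by move=> n; exact: measurable_itv.
- by move=> t _; apply: sumr_ge0 => i _; rewrite mul1r sqr_ge0.
- move=> t t0; exists (Num.bound t) => n tn; rewrite /A /= in_itv /= andbT => nt.
  have := archi_boundP (edge_ge0 t0); apply/negP; rewrite -leNgt (le_trans _ nt)// ler_nat.
  exact: leqW.
exists n.+1%:R => //; apply: le_trans le.
have S0 : 0 < n.+1%:R :> R by [].
have [Afar mA] : A n `<=` edge /\ meas (A n).
  split; last exact: measurable_itv.
  by move=> t; rewrite /A /= in_itv /= andbT => nt; rewrite edgeE (le_trans _ nt).
have nE i : sqnorm1 (tail n.+1%:R (f i)) = \int[mu]_(t in A n) (1 * f i t ^+ 2).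
  have [_ Lt _] := glue_tail_L2 S0 weight1 weight1 (Lf i) (Lf i).
  apply: EFin_inj; rewrite -(nrm_integral Lt).
  rewrite -(Rint_EFin mA (integS measurable_edge mA Afar (Lf i).2)).
  apply: (tail_integral S0 (meas_wf2 weight1.1 (Lf i).1)) => t _.
  by rewrite mul1r sqr_ge0.
have sE : \int[mu]_(t in A n) P t = \sum_i \int[mu]_(t in A n) (1 * f i t ^+ 2).
  rewrite /P; have : forall r : seq I, integ (A n) (fun t => \sum_(i <- r) (1 * f i t ^+ 2)) /\
      \int[mu]_(t in A n) (\sum_(i <- r) (1 * f i t ^+ 2)) =
      \sum_(i <- r) \int[mu]_(t in A n) (1 * f i t ^+ 2).
    elim=> [|i r [I1 E1]].
      split; first by apply: eq_integ (integ0 (A n)) => // t _; rewrite big_nil.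
      by rewrite big_nil (eq_Rint (g := fun=> 0)) ?Rintegral_cst ?mul0r// => t _; rewrite big_nil.
    have I2 := integS measurable_edge mA Afar (Lf i).2; split.
      by apply: eq_integ (integD mA I2 I1) => // t _; rewrite big_cons.
    by rewrite big_cons -E1 -RintD//; apply: eq_Rint => t _; rewrite big_cons.
  by move=> /(_ (index_enum I))[].
under eq_bigr do rewrite nE.
rewrite -sE (Rint_vanish (A := edge) (B := A n) (f := fun t => P t * \1_(A n) t)) //.
  rewrite le_eqVlt; apply/orP; left; apply/eqP; apply: eq_Rint => t At.
  by rewrite indicE mem_set// mulr1.
by move=> t _ nA; rewrite indicE memNset// mulr0.
Qed.

End TailSmall.

(** * From the star graph to the line *)

Section FiniteSums.
Context {R : realType} {E : lmodType R[i]}.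
Variables (D : E -> Prop) (q : E -> E -> R[i]).
Hypotheses (sD : subspace D) (hq : hermitian D q) (q_ge0 : forall u, D u -> 0 <= diag q u).

(** The constant depends on the number of terms alone, so it is known before the cut [S] is chosen. *)
Lemma diag_sum_le (I : finType) (u : I -> E) : (forall i, D (u i)) ->
  diag q (\sum_i u i) <= 2 ^+ #|I| * \sum_i diag q (u i).
Proof.
move=> Du; rewrite cardT.
have : forall r : seq I, D (\sum_(i <- r) u i) /\
    diag q (\sum_(i <- r) u i) <= 2 ^+ size r * \sum_(i <- r) diag q (u i).
  elim=> [|i r [Dr IH]].
    by rewrite !big_nil (diag0 sD hq) mulr0; split=> //; exact: sD.1.
  rewrite !big_cons; split; first exact: subspaceD.
  apply: le_trans (diagD_le sD hq q_ge0 (Du i) Dr) _.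
  rewrite /= exprS -mulrA -mulrDr ler_pM2l// mulrDr lerD//.
  by rewrite ler_peMl ?q_ge0// exprn_ege1// ler1n.
by move=> /(_ (enum I))[_]; rewrite !big_enum.
Qed.

End FiniteSums.

Section ComplexGluing.
Context {R : realType}.
Local Notation mu := (@lebesgue_measure R).
Local Notation edge := (@edge R).
Variables (S : R) (S0 : 0 < S).
Implicit Types (f g : R -> R[i]).
Local Notation gl := (glue S).
Local Notation tl := (tail S).

Lemma glue_tail_cL2 w1 w0 f1 f0 : weight w1 -> weight w0 -> cL2 w1 f1 -> cL2 w0 f0 ->
  [/\ cL2 (gl w1 w0) (gl f1 f0), cL2 (tl w1) (tl f1) &
    csqnorm (gl w1 w0) (gl f1 f0) + csqnorm (tl w1) (tl f1) = csqnorm w0 f0 + csqnorm w1 f1].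
Proof.
move=> ww1 ww0 [L1 L2] [L3 L4].
have [A1 A2 A3] := glue_tail_L2 S0 ww1 ww0 L1 L3.
have [B1 B2 B3] := glue_tail_L2 S0 ww1 ww0 L2 L4.
have rE : re (gl f1 f0) = gl (re f1) (re f0) := glue_map S (@complex.Re R) f1 f0.
have iE : im (gl f1 f0) = gl (im f1) (im f0) := glue_map S (@complex.Im R) f1 f0.
split; [by split; rewrite ?rE ?iE|by split|].
by rewrite /csqnorm rE iE -[re (tl f1)]/(tl (re f1)) -[im (tl f1)]/(tl (im f1)); lra.
Qed.

Lemma cnrm_wderiv f g : edge_H1 f -> cL2 (fun=> 1) g -> cprimitive f g ->
  csqnorm (fun=> 1) (wderiv f) = csqnorm (fun=> 1) g.
Proof.
move=> Hf Lg fg; have [Lw _] := wderivP Hf; have [e1 e2] := wderiv_unique Hf Lg fg.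
by rewrite /csqnorm (nrm_ae Lw.1 Lg.1 e1) (nrm_ae Lw.2 Lg.2 e2).
Qed.

Lemma glue1 (T : Type) (a : T) : gl (fun=> a) (fun=> a) = fun=> a.
Proof. by apply/funext => t; rewrite /glue; case: ifP. Qed.

Lemma glue_tail_H1 f1 f0 : edge_H1 f1 -> edge_H1 f0 -> f1 0 = f0 0 ->
  [/\ edge_H1 (gl f1 f0), edge_H1 (tl f1),
   csqnorm (fun=> 1) (wderiv (gl f1 f0)) + csqnorm (fun=> 1) (wderiv (tl f1)) =
     csqnorm (fun=> 1) (wderiv f0) + csqnorm (fun=> 1) (wderiv f1) &
   csqnorm (fun=> 1) (wderiv (tl f1)) = csqnorm (fun=> 1) (tl (wderiv f1))].
Proof.
move=> H1 H0 f10; have [L1 [p1 p1']] := wderivP H1; have [L0 [p0 p0']] := wderivP H0.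
have [A1 A2 A3] := glue_tail_cL2 weight1 weight1 (edge_H1_L2 H1) (edge_H1_L2 H0).
pose g1 t := - wderiv f1 t.
have LN : cL2 (fun=> 1) g1.
  have := cL2_sub weight1 (cL2_0 (fun=> 1 : R)) L1; congr cL2.
  by apply/funext => t; rewrite sub0r.
have reg1 : re g1 = fun t => - re (wderiv f1) t.
  by apply/funext => t; rewrite /re /g1; case: (wderiv f1 t).
have img1 : im g1 = fun t => - im (wderiv f1) t.
  by apply/funext => t; rewrite /im /g1; case: (wderiv f1 t).
have Ng1 : csqnorm (fun=> 1) g1 = csqnorm (fun=> 1) (wderiv f1).
  rewrite /csqnorm reg1 img1; congr (_ + _); apply: eq_Rint => t _; ring.
have [B1 B2 B3] := glue_tail_cL2 weight1 weight1 LN L0.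
have [_ C2 _] := glue_tail_cL2 weight1 weight1 L1 L0.
rewrite !glue1 in A1 A3 B1 B3.
have pg : cprimitive (gl f1 f0) (gl g1 (wderiv f0)).
  have rE : re (gl f1 f0) = gl (re f1) (re f0) := glue_map S (@complex.Re R) f1 f0.
  have iE : im (gl f1 f0) = gl (im f1) (im f0) := glue_map S (@complex.Im R) f1 f0.
  have rE' : re (gl g1 (wderiv f0)) = gl (re g1) (re (wderiv f0)) := glue_map S (@complex.Re R) _ _.
  have iE' : im (gl g1 (wderiv f0)) = gl (im g1) (im (wderiv f0)) := glue_map S (@complex.Im R) _ _.
  split; rewrite ?rE ?rE' ?iE ?iE' ?reg1 ?img1.
    by apply: (glue_prim S0 L1.1 L0.1 p1 p0); rewrite /re f10.
  by apply: (glue_prim S0 L1.2 L0.2 p1' p0'); rewrite /im f10.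
have pt : cprimitive (tl f1) (tl (wderiv f1)).
  by split; [have := tail_prim S0 L1.1 p1|have := tail_prim S0 L1.2 p1'].
have Hg : edge_H1 (gl f1 f0) by apply/edge_H1P; exists (gl g1 (wderiv f0)).
have Ht : edge_H1 (tl f1) by apply/edge_H1P; exists (tl (wderiv f1)).
split; [exact: Hg|exact: Ht| |exact: cnrm_wderiv Ht C2 pt].
rewrite (cnrm_wderiv Hg B1 pg) (cnrm_wderiv Ht C2 pt) -Ng1 -B3; congr (_ + _).
rewrite /csqnorm -[re (tl g1)]/(tl (re g1)) -[im (tl g1)]/(tl (im g1)) reg1 img1.
by congr (_ + _); apply: eq_Rint => t _; rewrite /tail /re /im; ring.
Qed.

End ComplexGluing.

Section Unfolding.
Context {R : realType} {n : nat}.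
Local Notation mu := (@lebesgue_measure R).
Local Notation edge := (@edge R).
Variables (S : R) (S0 : 0 < S).
Local Notation E2 := ('I_2 -> R -> R[i]).
Local Notation EN := ('I_n.+2 -> R -> R[i]).
Local Notation e0 := (ord0 : 'I_2).
Local Notation e1 := (lift ord0 ord0 : 'I_2).

(** The common value at the vertex is that of [psi] at distance [S] on its second half.  Only one of
    the tails carries the potential, in [spread_potential]. *)
Definition spread (psi : E2) : EN := fun j =>
  if j == ord0 then glue S (psi e1) (psi e0) else tail S (psi e1).

Definition spread_potential (v : 'I_2 -> R -> R) : 'I_n.+2 -> R -> R := fun j =>
  if j == ord0 then glue S (v e1) (v e0)
  else if j == lift ord0 ord0 then tail S (v e1) else fun=> 0.

Lemma spread_lin a u w : spread (a *: u + w) = a *: spread u + spread w.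
Proof.
apply/funext => j; apply/funext => t.
rewrite -[RHS]/(a * spread u j t + spread w j t) /spread; case: ifP => // _.
by rewrite /glue; case: ifP.
Qed.

Lemma spread_sum (I : finType) (c : I -> R[i]) (u : I -> E2) :
  spread (\sum_i c i *: u i) = \sum_i c i *: spread (u i).
Proof.
have s0 : spread 0 = 0.
  have := spread_lin (-1) 0 0; rewrite !scaler0 addr0 => ->.
  by rewrite scaleN1r addNr.
have sD x y : spread (x + y) = spread x + spread y.
  by have := spread_lin 1 x y; rewrite !scale1r.
rewrite (big_morph spread sD s0); apply: eq_bigr => i _.
by have := spread_lin (c i) (u i) 0; rewrite s0 !addr0.
Qed.

Lemma sum_spread (a b : R) :
  \sum_(j < n.+2) (if j == ord0 then a else b) = a + b + n%:R * b.
Proof.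
rewrite big_ord_recl eqxx -addrA; congr (_ + _).
rewrite (eq_bigr (fun=> b)) => [|j _]; last by [].
by rewrite sumr_const card_ord -[LHS]mulr_natl -addn1 natrD; ring.
Qed.

Section Function.
Variables (psi : E2) (Hpsi : vertex_domain (fun=> tt) psi).

Let H0 : edge_H1 (psi e0) := vertex_domain_H1 Hpsi e0.
Let H1 : edge_H1 (psi e1) := vertex_domain_H1 Hpsi e1.
Let V10 : psi e1 0 = psi e0 0 := Hpsi.2 e1 e0 erefl.

Lemma spread_dom : vertex_domain (fun=> tt) (spread psi).
Proof.
have [Hg Ht _ _] := glue_tail_H1 S0 H1 H0 V10.
split; first by move=> j; rewrite /spread; case: ifP.
have v i : spread psi i 0 = psi e1 S.
  by rewrite /spread; case: ifP => _; rewrite /glue /tail ?S0 ?subr0 ?add0r.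
by move=> i j _; rewrite !v.
Qed.

Lemma spread_kinetic : diag kinetic (spread psi) =
  diag kinetic psi + n%:R * csqnorm (fun=> 1) (tail S (wderiv (psi e1))).
Proof.
have [Hg Ht E1 E2] := glue_tail_H1 S0 H1 H0 V10.
rewrite -[diag kinetic (spread psi)]/(diag (gip unit_weight) (fun j => wderiv (spread psi j))).
rewrite -[diag kinetic psi]/(diag (gip unit_weight) (fun j => wderiv (psi j))) !gip_diag.
rewrite sum2 -[csqnorm _ (wderiv (psi e0)) + _]E1 -E2 -sum_spread.
by apply: eq_bigr => j _; rewrite /spread; case: ifP.
Qed.

Lemma spread_norm : diag (gip unit_weight) (spread psi) =
  diag (gip unit_weight) psi + n%:R * csqnorm (fun=> 1) (tail S (psi e1)).
Proof.
have [_ _ E] := glue_tail_cL2 S0 weight1 weight1 (edge_H1_L2 H1) (edge_H1_L2 H0).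
rewrite glue1 in E; rewrite !gip_diag.
rewrite sum2 -[csqnorm _ (psi e0) + _]E -sum_spread.
by apply: eq_bigr => j _; rewrite /spread; case: ifP.
Qed.

Lemma spread_energy_potential v : Lp_potential v ->
  diag (gip (spread_potential v)) (spread psi) = diag (gip v) psi.
Proof.
move=> hv; have Lv := gH1_vL2 hv (vertex_domain_H1 Hpsi).
have [_ _ E] := glue_tail_cL2 S0 (hv.1 e1) (hv.1 e0) (Lv e1) (Lv e0).
rewrite !gip_diag sum2 -[csqnorm _ (psi e0) + _]E 2!big_ord_recl big1 ?addr0//.
move=> j _; rewrite /spread_potential /=.
by rewrite -[csqnorm _ _]/(complex.Re (csqnorm _ _)%:C) -cip_diag cip_w0.
Qed.

End Function.

Section Potential.
Variables (v : 'I_2 -> R -> R) (v0 : forall i t, 0 <= v i t) (hv : Lp_potential v).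

Lemma spread_potential_ge0 j t : 0 <= spread_potential v j t.
Proof.
by rewrite /spread_potential /glue /tail; do 2 case: ifP => //; case: ifP.
Qed.

Lemma spread_potential_powR q : q != 0 ->
  (\sum_j \int[mu]_(t in edge) (spread_potential v j t `^ q)%:E =
   \sum_i \int[mu]_(t in edge) (v i t `^ q)%:E)%E.
Proof.
move=> q0; have mv i : measurable_fun edge (fun t => v i t `^ q).
  by apply: (measurableT_comp (measurable_powR q)); have [] := hv.1 i.
have p0 i t : 0 <= v i t `^ q by exact: powR_ge0.
rewrite [RHS]sum2 -(glue_tail_integral S0 (mv e1) (mv e0) (fun t _ => p0 _ _) (fun t _ => p0 _ _)).
rewrite 2!big_ord_recl big1 ?adde0 => [|j _].
  congr (_ + _)%E; apply: eq_integral => t _; rewrite /spread_potential//=.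
  by rewrite /glue; case: ifP.
by rewrite integral0_eq// => t _; rewrite /spread_potential /= powR0.
Qed.

Lemma spread_Lp_potential : Lp_potential (spread_potential v).
Proof.
split.
  move=> j; split=> [|t _]; last exact: spread_potential_ge0.
  have [m1 _] := hv.1 e1; have [m0 _] := hv.1 e0.
  rewrite /spread_potential; case: ifP => _; first exact: glue_meas.
  by case: ifP => _; [exact: tail_meas|exact: measurable_cst].
have [p p1 vp] := hv.2; exists p => // j.
have p0 : p != 0 by rewrite gt_eqF// (lt_le_trans ltr01).
have : (\sum_j \int[mu]_(t in edge) (spread_potential v j t `^ p)%:E < +oo)%E.
  by rewrite spread_potential_powR// sum2 lte_add_pinfty.
apply: le_lt_trans; rewrite (bigD1 j)//= leeDl//; apply: sume_ge0 => i _.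
by apply: integral_ge0 => t _; rewrite lee_fin powR_ge0.
Qed.

End Potential.
End Unfolding.

Section TailForms.
Context {R : realType}.
Local Notation E2 := ('I_2 -> R -> R[i]).
Local Notation e1 := (lift ord0 ord0 : 'I_2).

Lemma ctail_small (I : finType) (f : I -> R -> R[i]) (e : R) :
  (forall i, cL2 (fun=> 1) (f i)) -> 0 < e ->
  exists2 S : R, 0 < S & \sum_i csqnorm (fun=> 1) (tail S (f i)) <= e.
Proof.
move=> Lf e0.
have [|S S0 le] := @tail_small R (I * bool)%type
  (fun x => (if x.2 then re else im) (f x.1)) e _ e0.
  by move=> [i []]; case: (Lf i).
exists S => //; apply: le_trans le.
rewrite -(pair_bigA _ (fun i (c : bool) => sqnorm (fun=> 1) (tail S ((if c then re else im) (f i))))).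
by apply: ler_sum => i _; rewrite big_bool.
Qed.

Section TailForm.
Variables (S : R) (S0 : 0 < S) (La : R) (La0 : 0 <= La).

(** The tail is seen as a function on a graph with a single edge, so that [tail_form] inherits
    sesquilinearity from the forms on graphs. *)
Definition tail_part (u : E2) : 'I_1 -> R -> R[i] := fun=> tail S (u e1).
(** This form bounds the change of the quotient under [spread], for trial values of modulus at most
    [La]. *)
Definition tail_form (u u' : E2) : R[i] :=
  kinetic (tail_part u) (tail_part u') + La%:C * gip unit_weight (tail_part u) (tail_part u').

Lemma tail_part_H1 u : gH1 u -> gH1 (tail_part u).
Proof. by move=> Hu i; have [] := glue_tail_H1 S0 (Hu e1) (Hu e1) erefl. Qed.

Lemma tail_form_hermitian : hermitian gH1 tail_form.
Proof.
have hs : hermitian (@gH1 R 1) (gip unit_weight).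
  exact: hermitian_sub (@gH1_L2 R 1) (gip_hermitian gweight1).
have [h1 h2] := hermitian_lincomb La (@kinetic_hermitian R 1) hs.
split=> [a u v w Hu Hv Hw|u v Hu Hv].
  exact: (h1 a _ _ _ (tail_part_H1 Hu) (tail_part_H1 Hv) (tail_part_H1 Hw)).
exact: (h2 _ _ (tail_part_H1 Hu) (tail_part_H1 Hv)).
Qed.

Lemma tail_form_diag u : gH1 u -> diag tail_form u =
  csqnorm (fun=> 1) (tail S (wderiv (u e1))) + La * csqnorm (fun=> 1) (tail S (u e1)).
Proof.
move=> Hu; have [_ _ _ <-] := glue_tail_H1 S0 (Hu e1) (Hu e1) erefl.
have := diag_lincomb La kinetic (gip unit_weight) (tail_part u); rewrite /diag -/(tail_form u u) => ->.
congr (_ + _ * _).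
  by have := gip_diag unit_weight (fun j => wderiv (tail_part u j)); rewrite big_ord1.
by have := gip_diag unit_weight (tail_part u); rewrite big_ord1.
Qed.

Lemma tail_form_ge0 u : gH1 u -> 0 <= diag tail_form u.
Proof.
by move=> Hu; rewrite tail_form_diag// addr_ge0 ?mulr_ge0 ?cnrm_ge0//; exact: weight1.
Qed.

End TailForm.
End TailForms.

Section LowerBound.
Context {R : realType} {n : nat}.
Local Notation mu := (@lebesgue_measure R).
Local Notation edge := (@edge R).
Local Notation E2 := ('I_2 -> R -> R[i]).
Local Notation e1 := (lift ord0 ord0 : 'I_2).
Variables (V : 'I_2 -> R -> R) (aV : admissible V).
Let v := Vneg V.
Let v0 : forall i t, 0 <= v i t := Vneg_ge0 V.
Let hv : Lp_potential v := (admissible_weights aV).2.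

Section Trial.
Variables (I : finType) (psi : I -> E2) (lam : I -> R).
Hypotheses (lam0 : forall i, lam i < 0) (epsi : forall i, eigenvector V (lam i) (psi i))
  (opsi : forall i j, gip unit_weight (psi i) (psi j) = (i == j)%:R).

Let DV i : form_domain V (psi i).
Proof. by have [] := (eigenvectorP aV _ _).1 (epsi i). Qed.

Let sV := form_domain_subspace aV.
Let hV := hform_hermitian aV.

(** The original operator has the same kinetic form and a larger potential. *)
Lemma combination_form (c : I -> R[i]) : let f := \sum_i c i *: psi i in
  [/\ vertex_domain (fun=> tt) f, diag (attractive_form v) f <= \sum_i lam i * nsq (c i) &
      diag (gip unit_weight) f = \sum_i nsq (c i)].
Proof.
have eV i : form_eigenvector (form_domain V) (gip unit_weight) (hform V) (lam i) (psi i).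
  by have [] := (eigenvectorP aV _ _).1 (epsi i).
have [h1 h2] := diag_eigencombination sV (s_hermitian (form_domain_H1 aV)) hV DV eV opsi c.
move=> f; split=> //.
  have : form_domain V f by apply: (subspace_sum sV) => i; exact: (subspaceZ sV).
  by move=> /(form_domainE _ aV)[].
rewrite -h1 /attractive_form /hform !diag_lincomb lerD2r lerDl mul1r gip_ge0//.
exact: (admissible_weights aV).1.
Qed.

(** For large [S] the tails of the finitely many functions are so small that the quotients of all
    their combinations increase by at most [e]. *)
Lemma spread_trial (e : R) : 0 < e -> exists2 S : R, 0 < S &
  forall (t : R) (c : I -> R[i]), t < 0 -> (forall i, c i != 0 -> lam i + e <= t) ->
    diag (attractive_form (spread_potential S v : 'I_n.+2 -> R -> R))
      (\sum_i c i *: spread (n := n) S (psi i)) <=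
    t * diag (gip unit_weight) (\sum_i c i *: spread (n := n) S (psi i)).
Proof.
move=> e0; pose La := \sum_i - lam i.
have La_ge0 : 0 <= La by apply: sumr_ge0 => i _; rewrite oppr_ge0 ltW.
(* n copies of the tail, the constant of [diag_sum_le], and the factor of the norm in [tail_form]. *)
pose k : R := n.+1%:R * 2 ^+ #|I| * (1 + La).
have k0 : 0 < k by rewrite !mulr_gt0// ?exprn_gt0// ltr_wpDr.
have Hpsi i : gH1 (psi i) by exact: form_domain_H1 aV _ (DV i).
have [T1 T1E] : exists T1 : R -> E2 -> R, forall S u,
    T1 S u = csqnorm (fun=> 1) (tail S (wderiv (u e1))) by eexists.
have [T0 T0E] : exists T0 : R -> E2 -> R, forall S u,
    T0 S u = csqnorm (fun=> 1) (tail S (u e1)) by eexists.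
pose F (x : I * bool) := if x.2 then wderiv (psi x.1 e1) else psi x.1 e1.
have [|S S0] := @ctail_small R (I * bool)%type F (e / k) _ (divr_gt0 e0 k0).
  by move=> [i []]; [exact: (gH1_wL2 (Hpsi i))|exact: (gH1_L2 (Hpsi i))].
rewrite -(pair_bigA _ (fun i (c : bool) => csqnorm (fun=> 1) (tail S (F (i, c))))) /=.
under eq_bigr do rewrite big_bool /= -T1E -T0E.
have {}T1_ge0 u : 0 <= T1 S u by rewrite T1E; exact: cnrm_ge0 weight1.
have {}T0_ge0 u : 0 <= T0 S u by rewrite T0E; exact: cnrm_ge0 weight1.
rewrite ler_pdivlMr// => le; exists S => // t c t0 ct.
have [c0|/existsP[i0 ci0]] := altP (@forallP _ (fun i => c i == 0)).
  rewrite big1 => [|i _]; last by rewrite (eqP (c0 i)) scale0r.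
  have hw := spread_Lp_potential S0 v0 hv (n := n).
  rewrite (diag0 (@gH1_subspace R n.+2) (attractive_form_hermitian hw)).
  by rewrite (diag0 (gL2_subspace gweight1) (gip_hermitian gweight1)) mulr0.
have [Df hf sf] := combination_form c; rewrite -spread_sum.
set f := \sum_i c i *: psi i in Df hf sf *.
have Hf := vertex_domain_H1 Df.
have nc i : 0 <= nsq (c i) by exact: nsq_ge0.
pose Ns := \sum_i nsq (c i).
have Ns0 : 0 <= Ns by exact: sumr_ge0.
rewrite /attractive_form diag_lincomb (spread_kinetic S0 Df) (spread_norm S0 Df).
rewrite (spread_energy_potential S0 Df hv) sf -/Ns.
rewrite -T1E -T0E.
have form_le : diag kinetic f + (-1) * diag (gip v) f <= (t - e) * Ns.
  move: hf; rewrite /attractive_form diag_lincomb => /le_trans; apply.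
  rewrite mulr_sumr; apply: ler_sum => i _.
  have [->|ci] := eqVneq (c i) 0; last by rewrite ler_wpM2r// lerBrDr ct.
  by rewrite /nsq /= expr0n/= addr0 !mulr0.
have t_le : - t <= La.
  have : - lam i0 <= La by rewrite /La (bigD1 i0)//= lerDl sumr_ge0// => i _; rewrite oppr_ge0 ltW.
  have := ct i0 ci0; set x := lam i0; lra.
pose m : R := 2 ^+ #|I|; have m0 : 0 <= m by exact: exprn_ge0.
have tail_le : T1 S f + La * T0 S f <= m * ((1 + La) * Ns * \sum_i (T1 S (psi i) + T0 S (psi i))).
  have diagE u : gH1 u -> diag (tail_form S La) u = T1 S u + La * T0 S u.
    by rewrite T1E T0E; exact: tail_form_diag.
  have q0 u : gH1 u -> 0 <= diag (tail_form S La) u by exact: tail_form_ge0.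
  have Dc i : gH1 (c i *: psi i) by apply: (subspaceZ (@gH1_subspace R 2)); exact: Hpsi.
  have hq := tail_form_hermitian S0 La.
  have sumq := @diag_sum_le R _ _ (tail_form S La) (@gH1_subspace R 2) hq q0 I _ Dc.
  rewrite -(diagE f Hf); apply: (le_trans sumq).
  rewrite ler_wpM2l// mulr_sumr; apply: ler_sum => i _.
  rewrite (diagZ (@gH1_subspace R 2) (tail_form_hermitian S0 La) _ (Hpsi i)) (diagE _ (Hpsi i)).
  rewrite [(1 + La) * Ns]mulrC -mulrA.
  have cN : nsq (c i) <= Ns by rewrite /Ns (bigD1 i)//= lerDl; apply: sumr_ge0.
  have L0 := mulr_ge0 La_ge0 (T0_ge0 (psi i)).
  apply: le_trans (ler_wpM2r (addr_ge0 (T1_ge0 (psi i)) L0) cN) _.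
  rewrite ler_wpM2l//; have := T1_ge0 (psi i); have := T0_ge0 (psi i).
  by move: (T1 S _) (T0 S _) => x y ? ?; nra.
have tails0 : 0 <= \sum_i (T1 S (psi i) + T0 S (psi i)) by apply: sumr_ge0 => i _; exact: addr_ge0.
have {}le : n%:R * (m * ((1 + La) * Ns * \sum_i (T1 S (psi i) + T0 S (psi i)))) <= e * Ns.
  apply: (@le_trans _ _ ((\sum_i (T1 S (psi i) + T0 S (psi i))) * k * Ns)); last by rewrite ler_wpM2r.
  have -> : (\sum_i (T1 S (psi i) + T0 S (psi i))) * k * Ns =
      n.+1%:R * (m * ((1 + La) * Ns * \sum_i (T1 S (psi i) + T0 S (psi i)))).
    by rewrite /k -/m; ring.
  rewrite ler_wpM2r ?ler_nat// !mulr_ge0// addr_ge0//.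
have n0 : 0 <= n%:R :> R by [].
have small := le_trans (ler_wpM2l n0 tail_le) le.
have tB : - t * (n%:R * T0 S f) <= La * (n%:R * T0 S f) by rewrite ler_wpM2r// mulr_ge0.
have E1 : n%:R * (T1 S f + La * T0 S f) = n%:R * T1 S f + La * (n%:R * T0 S f) by ring.
have E2 : (t - e) * Ns = t * Ns - e * Ns by ring.
rewrite E1 in small; rewrite E2 in form_le; rewrite mulNr in tB; rewrite mulrDr.
by lra.
Qed.

End Trial.

(** The trial values [lam i + e] are at most [theta * lam i] for a factor [theta] < 1 as close to 1 as
    desired, chosen such that its power with exponent gamma is a given eta < 1. *)
Theorem trace_lower_bound (gamma C : R) : 0 < gamma -> LT_inequality gamma n.+2 C ->
  (trace_neg gamma V <= C%:E * \sum_i edge_mass (gamma + 2^-1) V i)%E.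
Proof.
move=> gamma0 LT; apply: trace_le => // I psi lam lam0 epsi opsi.
have S0 : 0 <= \sum_i `|lam i| `^ gamma by apply: sumr_ge0 => i _; exact: powR_ge0.
apply/lee_mul01Pr => // eta /andP[eta0 eta1].
pose theta := eta `^ gamma^-1.
have theta_gamma : theta `^ gamma = eta.
  by rewrite -powRrM mulVf ?gt_eqF// powRr1// ltW.
have theta0 : 0 <= theta by exact: powR_ge0.
have theta1 : theta < 1.
  rewrite ltNge; apply/negP => th1; have : 1 `^ gamma <= theta `^ gamma.
    by apply: ge0_ler_powR => //; rewrite ?nnegrE// ltW.
  by rewrite powR1 theta_gamma leNgt eta1.
have [m m0 mlam] : exists2 m : R, 0 < m & forall i, m <= - lam i.
  exists (\big[Num.min/1]_i - lam i).
    by apply/bigmin_gtP; split=> // i _; rewrite oppr_gt0.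
  by move=> i; exact: bigmin_le_cond.
pose e := (1 - theta) * m.
have e0 : 0 < e by rewrite mulr_gt0// subr_gt0.
have lame i : lam i + e <= theta * lam i.
  have := mlam i; rewrite /e; move: (lam i) => x mx; nra.
have lame0 i : lam i + e < 0.
  by apply: le_lt_trans (lame i) _; rewrite nmulr_llt0 ?lam0// powR_gt0.
have [S Spos below] := spread_trial lam0 epsi opsi e0.
have hw := spread_Lp_potential Spos v0 hv (n := n).
have w0 := spread_potential_ge0 (n := n) S v0.
pose D := @vertex_domain R n.+2 unit (fun=> tt).
have DH (u : 'I_n.+2 -> R -> R[i]) : D u -> gH1 u by exact: vertex_domain_H1.
have hh := hermitian_sub DH (attractive_form_hermitian hw).
have single i : \sum_k (if k == i then 1 else 0 : R[i]) *: psi k = psi i.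
  by rewrite (bigD1 i)//= eqxx scale1r big1 ?addr0// => k /negbTE ->; rewrite scale0r.
have Dpsi i : D (spread S (psi i)).
  have [+ _ _] := combination_form epsi opsi (fun k => if k == i then 1 else 0).
  by rewrite single; exact: spread_dom.
have indep (c : I -> R[i]) : diag (gip unit_weight) (\sum_i c i *: spread (n := n) S (psi i)) = 0 ->
    forall i, c i = 0.
  have [Df _ sf] := combination_form epsi opsi c.
  rewrite -spread_sum (spread_norm Spos Df) sf => /eqP.
  rewrite paddr_eq0; last 2 first.
  - by apply: sumr_ge0 => i _; exact: nsq_ge0.
  - by rewrite mulr_ge0// cnrm_ge0//; exact: weight1.
  move=> /andP[+ _]; rewrite psumr_eq0; last by move=> i _; exact: nsq_ge0.
  by move=> /allP c0 i; apply: nsq_eq0; apply/eqP; exact: (c0 i (mem_index_enum i)).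
have [||k [u [nu [beta [sigma [Du eu ou nul sumE]]]]]] :=
  @eigenvectors_below_trial R _ D (gip unit_weight) (attractive_form (spread_potential S v))
    (@vertex_domain_subspace R n.+2 unit _) (s_hermitian DH) hh (fun u _ => gip_ge0 u gweight1)
    (@vertex_domain_minimizers R n.+2 unit _ _ hw) unit (fun _ u => u)
    (fun _ u Du => Du) _ (fun _ _ _ => erefl) _ (fun _ _ _ _ _ => erefl)
    (fun _ _ _ _ _ => erefl) I (fun i => spread S (psi i)) (fun i => lam i + e)
    Dpsi lame0 below indep.
- by move=> [] [] u; rewrite eqxx.
- by move=> u; rewrite (bigD1 tt)//= big1 ?addr0// => -[].
have aW := admissible_opp w0 hw.
have nu0 j : nu j < 0 by exact: le_lt_trans (nul j) (lame0 _).
have eW j : eigenvector (fun i t => - spread_potential S v i t) (nu j) (u j).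
  by apply/(eigenvector_opp w0 hw); split; [case: (Du j)|exact: eu].
have ou1 i j : gip unit_weight (u i) (u j) = 1%:C * (i == j)%:R by rewrite mul1r ou.
have tr := trace_ge aW gamma (oner_neq0 R) nu0 eW ou1.
have massE : (\sum_(j < n.+2) edge_mass (gamma + 2^-1) (fun i t => (- spread_potential S v i t)%R) j =
    \sum_i edge_mass (gamma + 2^-1) V i :> \bar R)%E.
  rewrite /edge_mass (Vneg_opp w0); apply: (spread_potential_powR Spos hv).
  by rewrite gt_eqF// addr_gt0// invr_gt0.
rewrite -massE; apply: (le_trans _ (LT _ aW)); apply: le_trans tr.
rewrite -EFinM lee_fin mulr_sumr -(theta_gamma) (sumE (fun i => _)).
apply: ler_sum => j _; rewrite -powRM//.
apply: ge0_ler_powR => //; first exact: ltW.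
- by rewrite nnegrE mulr_ge0.
have lj := lam0 (sigma j).
rewrite (ltr0_norm lj) (ltr0_norm (nu0 j)) mulrN lerN2.
exact: le_trans (nul j) (lame _).
Qed.

End LowerBound.

(** * The optimal constants *)

Section OptimalConstants.
Context {R : realType}.

Lemma LT_line_even (gamma C : R) N : 0 <= gamma -> (1 <= N)%N -> ~~ odd N ->
  LT_inequality gamma 2 C -> LT_inequality gamma N C.
Proof.
move=> gamma0 N1 eN LT V aV.
by have := trace_upper_bound (Ordinal N1) gamma0 LT aV; rewrite (negbTE eN) adde0.
Qed.

Lemma LT_even_line (gamma C : R) n : 0 < gamma ->
  LT_inequality gamma n.+2 C -> LT_inequality gamma 2 C.
Proof. by move=> gamma0 LT V aV; exact: (trace_lower_bound aV gamma0 LT). Qed.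

(** Any edge may be the one without partner.  The sum of the N resulting bounds counts every edge
    N + 1 times. *)
Lemma LT_line_odd (gamma C : R) N : 0 <= gamma -> odd N ->
  LT_inequality gamma 2 C -> LT_inequality gamma N (N.+1%:R / N%:R * C).
Proof.
move=> gamma0 oN LT V aV; have N0 : 0 < N%:R :> R by rewrite ltr0n; case: (N) oN.
pose X := edge_mass (gamma + 2^-1) V; pose s := (\sum_i X i)%E.
have X0 i : (0 <= X i)%E by exact: edge_mass_ge0.
have s0 : (0 <= s)%E by exact: sume_ge0.
have le j : (trace_neg gamma V <= C%:E * (s + X j))%E.
  by have := trace_upper_bound j gamma0 LT aV; rewrite oN.
have : (\sum_(j < N) trace_neg gamma V <= \sum_(j < N) C%:E * (s + X j))%E.
  by apply: lee_sum => j _; exact: le.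
rewrite -ge0_sume_distrr; last by move=> j _; exact: adde_ge0.
rewrite big_split /= -/s.
have sumE (y : \bar R) : (\sum_(j < N) y = N%:R%:E * y)%E.
  by rewrite mule_natl sumr_const card_ord.
rewrite !sumE.
have -> : (N%:R%:E * s + s = N.+1%:R%:E * s)%E.
  by rewrite -[X in (_ + X)%E]mul1e -ge0_muleDl// -EFinD natr1.
rewrite muleA -EFinM -lee_pdivlMl// muleA -EFinM => /le_trans; apply.
by rewrite le_eqVlt; apply/orP; left; apply/eqP; congr (_%:E * _)%E; ring.
Qed.

(** Dividing by [a] turns the claim into a lower bound for an infimum, whatever infinite values
    occur. *)
Lemma LT_const_le (gamma a : R) N M : 0 < a ->
  (forall C, LT_inequality gamma M C -> LT_inequality gamma N (a * C)) ->
  (LT_const gamma N <= a%:E * LT_const gamma M)%E.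
Proof.
move=> a0 H; rewrite -lee_pdivrMl//; apply: le_ereal_inf_tmp => _ [C /H LT <-].
rewrite lee_pdivrMl// -EFinM; apply: ereal_inf_lbound; exists (a * C) => //.
Qed.

End OptimalConstants.

Theorem theorem1 (R : realType) (gamma : R) (N : nat)
    (hgamma : 2^-1 <= gamma) (hN : (1 <= N)%N) :
  (~~ odd N -> LT_const gamma N = LT_const_line gamma) /\
  (odd N ->
    (LT_const gamma N <= (N.+1%:R / N%:R)%:E * LT_const_line gamma)%E).
Proof.
have gamma0 : 0 < gamma by apply: lt_le_trans hgamma; rewrite invr_gt0.
split=> [eN|oN]; last first.
  apply: LT_const_le; first by rewrite divr_gt0// ltr0n.
  by move=> C; apply: LT_line_odd => //; exact: ltW.
apply/eqP; rewrite eq_le; apply/andP; split.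
  rewrite -[leRHS]mul1e; apply: LT_const_le => // C; rewrite mul1r.
  by apply: LT_line_even => //; exact: ltW.
rewrite -[leRHS]mul1e; apply: LT_const_le => // C; rewrite mul1r.
by case: N hN eN => [|[|n]] // _ _; exact: LT_even_line.
Qed.
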